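(* Up to similarity, the space-like surfaces in Minkowski space $\mathbb R^3_1$ whose curvatures $K'$, $H$ and $H'$ satisfy a linear relation $$\delta K'=\alpha H+\beta H'+\gamma,\qquad\alpha,\beta,\gamma,\delta\ \text{constants},\quad\alpha^2-\beta^2+4\gamma\delta\neq0,$$ are described by the natural PDE's of the following basic surfaces (each item gives the relation defining the basic class, where needed the substitution expressing $\nu$ through a new function $\lambda$, and the natural PDE of the class; $p,q$ are constants): (1) $H=0$: $\ \nu=-e^{\lambda}$, $\ \Delta\lambda=e^{\lambda}$; (2) $H=\frac12$: $\ \nu=\frac12(1-e^{\lambda})$, $\ \Delta\lambda=\sinh\lambda$; (3) $H'=1$: $\ \Delta^*(e^{\nu})=2\nu(\nu+2)$; (4) $H=pH'$, $p^2>1$: $\ \Delta^*(\nu^{p})=2\,\frac{p(p+1)}{(p-1)^2}\,\nu$; (5) $H=pH'$, $p^2<1$, $p\neq0$: $\ \bar\Delta^*(\nu^{p})=2\,\frac{p(p+1)}{(p-1)^2}\,\nu$; (6) $H=pH'+1$, $p^2>1$: $\ \nu=\frac{(p-1)\lambda+2}{2}$, $\ \Delta^*(\lambda^{p})=\frac{p\,((p-1)\lambda+2)((p+1)\lambda+2)}{2(p-1)\lambda}$; (7) $H=pH'+1$, $p^2<1$, $p\neq0$: $\ \nu=\frac{(p-1)\lambda+2}{2}$, $\ \bar\Delta^*(\lambda^{p})=\frac{p\,((p-1)\lambda+2)((p+1)\lambda+2)}{2(p-1)\lambda}$; (8) $K'=-1$: $\ \nu=\tan\frac{\lambda}{2}$,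 $\ \bar\Delta\lambda=-\sin\lambda$; (9) $K'=2H'$: $\ \nu=\frac{\lambda-4}{\lambda-2}$, $\ \Delta^*(e^{\lambda})=2$; (10) $K'=pH'-q$, $p\neq0$, $q>0$: $\ \nu=\lambda+\frac p2$, $\ \mathcal I=\frac1{\sqrt q}\arctan\frac{\lambda}{\sqrt q}$, $\ \Delta^*(e^{p\mathcal I})=\frac{pq}{2}\,\frac{\lambda(p\lambda-2q)}{\lambda^2+q}$. That is: every such surface is, up to similarity, parallel to (or coincides with) a surface of one of the basic classes (1)–(10), and its natural PDE, for an appropriate choice of natural principal parameters $(u,v)$, is the PDE listed for that class.
   Context: $\mathbb R^3_1$ is three-dimensional Minkowski space with flat metric of signature $(2,1)$. All functions are smooth and considerations are local. A surface $z=z(u,v)$ is space-like if its induced metric is positive definite; its unit normal $l$ satisfies $l^2=-1$. Put $E=z_u^2$, $F=z_uz_v$, $G=z_v^2$, $L=lz_{uu}$, $M=lz_{uv}$, $N=lz_{vv}$. Surfaces are free of umbilical points; $(u,v)$ are principal parameters if $F=M=0$, and then the principal curvatures are $\nu_1=L/E$, $\nu_2=N/G$ and the principal geodesic curvatures are $\gamma_1=-\frac{E_v}{2E\sqrt G}$, $\gamma_2=\frac{G_u}{2G\sqrt E}$. Put $K'=\nu_1\nu_2$ (extrinsic Gauss curvature; the intrinsic one is $K=-K'$), $H=\frac12(\nu_1+\nu_2)$, $H'=\frac12(\nu_1-\nu_2)$. W-surfaces: $\nu_1=f(\nu)$, $\nu_2=g(\nu)$ for a differentiable function $\nu(u,v)$,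 with $f'g'\neq0$, $f-g\neq0$. Surfaces satisfying the linear relation above are W-surfaces, of two kinds: strongly regular ($(\nu_1-\nu_2)\gamma_1\gamma_2\ne0$) or $\gamma_1=0$, $(\nu_1-\nu_2)\gamma_2\neq0$ (then all functions depend on $u$ only and the PDE's are read as ODE's). With $I=\int_{\nu_0}^{\nu}\frac{f'\,d\nu}{f-g}$, $J=\int_{\nu_0}^{\nu}\frac{g'\,d\nu}{g-f}$, principal parameters are natural principal if $\sqrt E\,e^{I}$ and $\sqrt G\,e^{J}$ are both constant; they are defined up to affine changes of the variables $u,v$ separately (and interchange of $u$ and $v$). For natural principal parameters with $\sqrt E=\mathfrak a^{-1}e^{-I}$, $\sqrt G=\mathfrak b^{-1}e^{-J}$ ($\mathfrak a,\mathfrak b>0$ constants), the Gauss equation becomes the natural PDE $$\mathfrak a^2e^{2I}(J_{uu}+I_uJ_u-J_u^2)+\mathfrak b^2e^{2J}(I_{vv}+I_vJ_v-I_v^2)=-f(\nu)g(\nu)$$ (without the second summand when $\gamma_1=0$). The natural PDE of a class of surfaces is this equation written for an appropriate choice of the constants $\mathfrak a,\mathfrak b,\nu_0$, possibly in terms of a new unknown $\lambda$ related to $\nu$. The parameter $\nu$ used in the list: in (1)–(7), $\nu=\nu_2$; in (8), $\nu=\nu_1$; in (9), $\nu=\nu_1+1$; in (10), $\nu=\nu_1+\frac p2$ (so $\lambda=\nu_1$). In (4) and (5) the unit normal is taken so that $\nu>0$, and in (6), (7) $\lambda=2H'>0$. Parallel surfaces of $S$: $\bar S(a):\ \bar z=z+a\,l$,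 $a=\mathrm{const}\neq0$, excluding points with $(1-a\nu_1)(1-a\nu_2)=0$; they are space-like with unit normal $\varepsilon l$, $\varepsilon=\mathrm{sign}(1-a\nu_1)(1-a\nu_2)$. A surface and its parallel surfaces have the same natural principal parameters and the same natural PDE. ''Up to similarity'' means up to similarities of $\mathbb R^3_1$ (homotheties and motions), including a change of the unit normal to its opposite and the corresponding relabelling of the principal curvatures. Operators: $$\Delta\lambda=\lambda_{uu}+\lambda_{vv},\quad \bar\Delta\lambda=\lambda_{uu}-\lambda_{vv},\quad \Delta^*\lambda=\lambda_{uu}+\Big(\frac1\lambda\Big)_{vv},\quad \bar\Delta^*\lambda=\lambda_{uu}-\Big(\frac1\lambda\Big)_{vv}.$$ *)

(* Defs.v *)
From Stdlib Require Import Reals.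
From Coquelicot Require Import Coquelicot.
Open Scope R_scope.

(** * Smooth functions of two variables *)

Definition region := R -> R -> Prop.

Definition open2 (D : region) : Prop :=
  forall u v, D u v -> locally_2d D u v.

Definition Du (f : R -> R -> R) : R -> R -> R :=
  fun u v => Derive (fun t => f t v) u.
Definition Dv (f : R -> R -> R) : R -> R -> R :=
  fun u v => Derive (fun t => f u t) v.
Definition Duu (f : R -> R -> R) := Du (Du f).
Definition Dvv (f : R -> R -> R) := Dv (Dv f).

Definition smooth1 (X : R -> Prop) (f : R -> R) : Prop :=
  forall (n : nat) t, X t -> ex_derive_n f n t.
Definition smooth2 (D : region) (f : R -> R -> R) : Prop :=
  forall (n : nat) u v, D u v -> ex_diff_n f n u v.

Definition dense_in (D S : region) : Prop :=
  forall u v, D u v -> forall eps, 0 < eps ->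
    exists u' v', Rabs (u' - u) < eps /\ Rabs (v' - v) < eps /\ S u' v'.

(** * Minkowski space *)

(* The third coordinate is the time-like one. *)
Record vec3 : Type := Vec { x1 : R; x2 : R; x3 : R }.

Definition vadd (a b : vec3) : vec3 :=
  Vec (x1 a + x1 b) (x2 a + x2 b) (x3 a + x3 b).
Definition vscal (c : R) (a : vec3) : vec3 :=
  Vec (c * x1 a) (c * x2 a) (c * x3 a).
Definition mdot (a b : vec3) : R :=
  x1 a * x1 b + x2 a * x2 b - x3 a * x3 b.

Definition linear_isometry (A : vec3 -> vec3) : Prop :=
  (forall a b, A (vadd a b) = vadd (A a) (A b)) /\
  (forall c a, A (vscal c a) = vscal c (A a)) /\
  (forall a b, mdot (A a) (A b) = mdot a b).

(** * Space-like surfaces *)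

Definition vsmooth (D : region) (z : R -> R -> vec3) : Prop :=
  smooth2 D (fun u v => x1 (z u v)) /\
  smooth2 D (fun u v => x2 (z u v)) /\
  smooth2 D (fun u v => x3 (z u v)).

Definition vDu (z : R -> R -> vec3) : R -> R -> vec3 := fun u v =>
  Vec (Du (fun s t => x1 (z s t)) u v)
      (Du (fun s t => x2 (z s t)) u v)
      (Du (fun s t => x3 (z s t)) u v).
Definition vDv (z : R -> R -> vec3) : R -> R -> vec3 := fun u v =>
  Vec (Dv (fun s t => x1 (z s t)) u v)
      (Dv (fun s t => x2 (z s t)) u v)
      (Dv (fun s t => x3 (z s t)) u v).

Definition EE (z : R -> R -> vec3) u v := mdot (vDu z u v) (vDu z u v).
Definition FF (z : R -> R -> vec3) u v := mdot (vDu z u v) (vDv z u v).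
Definition GG (z : R -> R -> vec3) u v := mdot (vDv z u v) (vDv z u v).
Definition LL (z l : R -> R -> vec3) u v := mdot (l u v) (vDu (vDu z) u v).
Definition MM (z l : R -> R -> vec3) u v := mdot (l u v) (vDv (vDu z) u v).
Definition NN (z l : R -> R -> vec3) u v := mdot (l u v) (vDv (vDv z) u v).

Record spacelike_surface (D : region) (z l : R -> R -> vec3) : Prop := {
  surf_open : open2 D;
  surf_smooth : vsmooth D z;
  surf_normal_smooth : vsmooth D l;
  surf_metric_E : forall u v, D u v -> 0 < EE z u v;
  surf_metric_det : forall u v, D u v ->
    0 < EE z u v * GG z u v - FF z u v ^ 2;
  surf_normal_unit : forall u v, D u v -> mdot (l u v) (l u v) = -1;
  surf_normal_u : forall u v, D u v -> mdot (l u v) (vDu z u v) = 0;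
  surf_normal_v : forall u v, D u v -> mdot (l u v) (vDv z u v) = 0 }.

Definition principal_parameters (D : region) (z l : R -> R -> vec3) : Prop :=
  forall u v, D u v -> FF z u v = 0 /\ MM z l u v = 0.

(* The invariants below are meaningful in principal parameters only. *)
Definition nu1 (z l : R -> R -> vec3) u v := LL z l u v / EE z u v.
Definition nu2 (z l : R -> R -> vec3) u v := NN z l u v / GG z u v.
Definition gamma1 (z : R -> R -> vec3) u v :=
  - (Dv (EE z) u v / (2 * EE z u v * sqrt (GG z u v))).
Definition gamma2 (z : R -> R -> vec3) u v :=
  Du (GG z) u v / (2 * GG z u v * sqrt (EE z u v)).
Definition Kext (z l : R -> R -> vec3) u v := nu1 z l u v * nu2 z l u v.
Definition Hmean (z l : R -> R -> vec3) u v := (nu1 z l u v + nu2 z l u v) / 2.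
Definition Hdiff (z l : R -> R -> vec3) u v := (nu1 z l u v - nu2 z l u v) / 2.

Definition strongly_regular (D : region) (z l : R -> R -> vec3) : Prop :=
  forall u v, D u v ->
    (nu1 z l u v - nu2 z l u v) * gamma1 z u v * gamma2 z u v <> 0.
Definition gamma1_zero_kind (D : region) (z l : R -> R -> vec3) : Prop :=
  forall u v, D u v ->
    gamma1 z u v = 0 /\ (nu1 z l u v - nu2 z l u v) * gamma2 z u v <> 0.

(** * Parallel surfaces, similarities, changes of principal parameters *)

Definition parallel_factor (z l : R -> R -> vec3) (a : R) u v : R :=
  (1 - a * nu1 z l u v) * (1 - a * nu2 z l u v).
Definition parallel_domain (D : region) (z l : R -> R -> vec3) (a : R) : region :=
  fun u v => D u v /\ parallel_factor z l a u v <> 0.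
(* For a = 0 these are z and l themselves. *)
Definition parallel_point (z l : R -> R -> vec3) (a : R) : R -> R -> vec3 :=
  fun u v => vadd (z u v) (vscal a (l u v)).
Definition parallel_normal (z l : R -> R -> vec3) (a : R) : R -> R -> vec3 :=
  fun u v => vscal (sign (parallel_factor z l a u v)) (l u v).

(* Homothety of ratio k, linear isometry A, translation by b. *)
Definition similar_point (k : R) (A : vec3 -> vec3) (b : vec3)
  (z : R -> R -> vec3) : R -> R -> vec3 :=
  fun u v => vadd (vscal k (A (z u v))) b.
(* sigma = 1 or -1 is the choice of the unit normal of the similar surface. *)
Definition similar_normal (sigma : R) (A : vec3 -> vec3)
  (l : R -> R -> vec3) : R -> R -> vec3 :=
  fun u v => vscal sigma (A (l u v)).

(* The old parameters are (phi u, psi v), or (phi v, psi u) when the two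
   families of principal lines are interchanged; the interchange swaps the
   labels of the principal curvatures. *)
Definition reparam {T : Type} (swap : bool) (phi psi : R -> R)
  (h : R -> R -> T) : R -> R -> T :=
  fun u v => if swap then h (phi v) (psi u) else h (phi u) (psi v).

Definition open_rect (a1 b1 a2 b2 : R) : region :=
  fun u v => (a1 < u < b1) /\ (a2 < v < b2).

Definition regular_curve_parameter (X : R -> Prop) (phi : R -> R) : Prop :=
  smooth1 X phi /\ forall t, X t -> Derive phi t <> 0.

(* Change of principal parameters from a rectangle onto a neighbourhood of
   (u0, v0) inside D. *)
Definition parameter_change (D : region) (u0 v0 a1 b1 a2 b2 : R)
  (swap : bool) (phi psi : R -> R) : Prop :=
  let P := fun t => a1 < t < b1 in
  let Q := fun t => a2 < t < b2 in
  regular_curve_parameter (if swap then Q else P) phi /\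
  regular_curve_parameter (if swap then P else Q) psi /\
  (forall u v, open_rect a1 b1 a2 b2 u v -> reparam swap phi psi D u v) /\
  (exists u v, open_rect a1 b1 a2 b2 u v /\
     reparam swap phi psi (fun x y => x = u0 /\ y = v0) u v).

(** * Weingarten surfaces and the natural PDE *)

Definition is_interval (X : R -> Prop) : Prop :=
  forall x y t, X x -> X y -> x <= t <= y -> X t.

Record Weingarten_functions (X : R -> Prop) (f g : R -> R) : Prop := {
  W_open : open X;
  W_interval : is_interval X;
  W_smooth_f : smooth1 X f;
  W_smooth_g : smooth1 X g;
  W_derive : forall t, X t -> Derive f t * Derive g t <> 0;
  W_neq : forall t, X t -> f t - g t <> 0 }.

Definition Iint (f g : R -> R) (nu0 t : R) : R :=
  RInt (fun s => Derive f s / (f s - g s)) nu0 t.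
Definition Jint (f g : R -> R) (nu0 t : R) : R :=
  RInt (fun s => Derive g s / (g s - f s)) nu0 t.

(* Natural principal parameters with constants ca, cb, for the
   representation nu1 = f(nu), nu2 = g(nu). *)
Definition natural_principal (D : region) (z l : R -> R -> vec3)
  (X : R -> Prop) (f g : R -> R) (nu : R -> R -> R) (nu0 ca cb : R) : Prop :=
  0 < ca /\ 0 < cb /\
  principal_parameters D z l /\
  forall u v, D u v ->
    X (nu u v) /\
    nu1 z l u v = f (nu u v) /\
    nu2 z l u v = g (nu u v) /\
    sqrt (EE z u v) = / ca * exp (- Iint f g nu0 (nu u v)) /\
    sqrt (GG z u v) = / cb * exp (- Jint f g nu0 (nu u v)).

(* When gamma1 = 0 (or gamma2 = 0, after an interchange) nu depends on one
   variable only, and one of the two summands vanishes identically. *)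
Definition natural_pde (f g : R -> R) (nu0 ca cb : R) (nu : R -> R -> R)
  (u v : R) : Prop :=
  let I := fun u v => Iint f g nu0 (nu u v) in
  let J := fun u v => Jint f g nu0 (nu u v) in
  ca ^ 2 * exp (2 * I u v) * (Duu J u v + Du I u v * Du J u v - Du J u v ^ 2) +
  cb ^ 2 * exp (2 * J u v) * (Dvv I u v + Dv I u v * Dv J u v - Dv I u v ^ 2)
  = - (f (nu u v) * g (nu u v)).

(** * The basic classes *)

Definition Lap (f : R -> R -> R) u v := Duu f u v + Dvv f u v.
Definition Lap_bar (f : R -> R -> R) u v := Duu f u v - Dvv f u v.
Definition Lap_star (f : R -> R -> R) u v :=
  Duu f u v + Dvv (fun s t => / f s t) u v.
Definition Lap_bar_star (f : R -> R -> R) u v :=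
  Duu f u v - Dvv (fun s t => / f s t) u v.

Inductive basic_class : Type :=
| H_zero
| H_half
| Hdiff_one
| H_prop_gt (p : R)
| H_prop_lt (p : R)
| H_affine_gt (p : R)
| H_affine_lt (p : R)
| K_minus_one
| K_twice_Hdiff
| K_affine (p q : R).

Definition valid_class (c : basic_class) : Prop :=
  match c with
  | H_prop_gt p | H_affine_gt p => 1 < p ^ 2
  | H_prop_lt p | H_affine_lt p => p ^ 2 < 1 /\ p <> 0
  | K_affine p q => p <> 0 /\ 0 < q
  | _ => True
  end.

Definition class_relation (c : basic_class) (K H H' : R) : Prop :=
  match c with
  | H_zero => H = 0
  | H_half => H = 1 / 2
  | Hdiff_one => H' = 1
  | H_prop_gt p | H_prop_lt p => H = p * H'
  | H_affine_gt p | H_affine_lt p => H = p * H' + 1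
  | K_minus_one => K = -1
  | K_twice_Hdiff => K = 2 * H'
  | K_affine p q => K = p * H' - q
  end.

(* The parameter nu as a function of the principal curvatures k1, k2. *)
Definition class_nu (c : basic_class) (k1 k2 : R) : R :=
  match c with
  | K_minus_one => k1
  | K_twice_Hdiff => k1 + 1
  | K_affine p q => k1 + p / 2
  | _ => k2
  end.

(* The substitution nu = nu(lambda); lambda is nu itself when the class has
   no substitution. *)
Definition class_subst (c : basic_class) (lam : R) : R :=
  match c with
  | H_zero => - exp lam
  | H_half => (1 - exp lam) / 2
  | Hdiff_one | H_prop_gt _ | H_prop_lt _ => lam
  | H_affine_gt p | H_affine_lt p => ((p - 1) * lam + 2) / 2
  | K_minus_one => tan (lam / 2)
  | K_twice_Hdiff => (lam - 4) / (lam - 2)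
  | K_affine p q => lam + p / 2
  end.

(* Values of lambda for which the substitution and the PDE are meaningful:
   sign conventions for the bases of real powers, nonzero denominators. *)
Definition class_admissible (c : basic_class) (lam : R) : Prop :=
  match c with
  | H_prop_gt _ | H_prop_lt _ | H_affine_gt _ | H_affine_lt _ => 0 < lam
  | K_minus_one => cos (lam / 2) <> 0
  | K_twice_Hdiff => lam <> 2
  | _ => True
  end.

Definition class_pde (c : basic_class) (lam : R -> R -> R) (u v : R) : Prop :=
  match c with
  | H_zero => Lap lam u v = exp (lam u v)
  | H_half => Lap lam u v = sinh (lam u v)
  | Hdiff_one =>
      Lap_star (fun s t => exp (lam s t)) u v
      = 2 * lam u v * (lam u v + 2)
  | H_prop_gt p =>
      Lap_star (fun s t => Rpower (lam s t) p) u v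
      = 2 * (p * (p + 1) / (p - 1) ^ 2) * lam u v
  | H_prop_lt p =>
      Lap_bar_star (fun s t => Rpower (lam s t) p) u v
      = 2 * (p * (p + 1) / (p - 1) ^ 2) * lam u v
  | H_affine_gt p =>
      Lap_star (fun s t => Rpower (lam s t) p) u v
      = p * ((p - 1) * lam u v + 2) * ((p + 1) * lam u v + 2)
        / (2 * (p - 1) * lam u v)
  | H_affine_lt p =>
      Lap_bar_star (fun s t => Rpower (lam s t) p) u v
      = p * ((p - 1) * lam u v + 2) * ((p + 1) * lam u v + 2)
        / (2 * (p - 1) * lam u v)
  | K_minus_one => Lap_bar lam u v = - sin (lam u v)
  | K_twice_Hdiff => Lap_star (fun s t => exp (lam s t)) u v = 2
  | K_affine p q =>
      Lap_star
        (fun s t => exp (p * (/ sqrt q * atan (lam s t / sqrt q)))) u v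
      = p * q / 2 * (lam u v * (p * lam u v - 2 * q) / (lam u v ^ 2 + q))
  end.

(* In the natural principal parameters (u, v) of the surface (z, l), the
   natural PDE of the surface for the unknown nu = nu(lambda), with suitable
   constants ca, cb, nu0, is the equation of the class c: both have the same
   solutions, even pointwise, among all functions with values where f and g
   are defined. *)
Definition natural_pde_is (c : basic_class) (D : region)
  (z l : R -> R -> vec3) (nu : R -> R -> R) : Prop :=
  exists (X : R -> Prop) (f g : R -> R) (nu0 ca cb : R),
    Weingarten_functions X f g /\ X nu0 /\
    natural_principal D z l X f g nu nu0 ca cb /\
    forall (D0 : region) (lam : R -> R -> R),
      open2 D0 -> smooth2 D0 lam ->
      (forall u v, D0 u v ->
         class_admissible c (lam u v) /\ X (class_subst c (lam u v))) ->
      forall u v, D0 u v ->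
        (natural_pde f g nu0 ca cb (fun s t => class_subst c (lam s t)) u v
         <-> class_pde c lam u v).

(* A surface of the basic class c, in principal parameters, whose parameter
   nu is expressed through lam. *)
Definition basic_surface (c : basic_class) (D : region)
  (w n : R -> R -> vec3) (lam : R -> R -> R) : Prop :=
  spacelike_surface D w n /\ principal_parameters D w n /\
  smooth2 D lam /\
  forall u v, D u v ->
    class_relation c (Kext w n u v) (Hmean w n u v) (Hdiff w n u v) /\
    class_admissible c (lam u v) /\
    class_nu c (nu1 w n u v) (nu2 w n u v) = class_subst c (lam u v).

(* Main.v *)
Require Import Defs.
From Stdlib Require Import Reals Lra Lia FunctionalExtensionality.
From Stdlib Require Import Classical ClassicalEpsilon Ranalysis5.
From Coquelicot Require Import Coquelicot.
Open Scope R_scope.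

(** Why the theorem is true. In principal parameters the Weingarten equations are
    l_u = - nu1 z_u and l_v = - nu2 z_v. Hence z + a l has the tangent vectors
    (1 - a nu1) z_u and (1 - a nu2) z_v, and its principal curvatures are those of z
    with the radii of curvature translated by a ([transformed_surface]). Under this
    translation the linear relation keeps its form and its discriminant
    alpha^2 - beta^2 + 4 gamma delta ([linear_relation_parallel]), while a can be
    chosen so that either K' disappears, when the quadratic equation
    gamma a^2 + alpha a = delta has a real root, or H does
    ([parallel_reduction]). A homothety, the choice of the normal and the order of
    the principal curvatures bring what remains to one of the ten relations
    ([classification]). The points lost in passing to the parallel surface form a
    set without interior, since otherwise nu2 would be constant on an open set and
    gamma2 would vanish there ([parallel_domain_dense]).

    It remains to find the PDE. By the Codazzi equations sqrt E exp I depends on u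
    only and sqrt G exp J on v only ([weingarten_line_element]); the inverse function
    of a primitive makes both constant, which gives natural principal parameters
    ([natural_parameters_exist]). In them x = sqrt E and y = sqrt G are
    functions of nu, and the Gauss equation

      (y_u / x)_u + (x_v / y)_v = nu1 nu2 x y

    is the natural PDE ([surface_natural_pde]). Written for a function lambda of nu
    it takes the form kappa Q(lambda)_uu + kappa P(lambda)_vv = kappa R(lambda),
    where kappa Q' and kappa P' are the derivatives of y and x in lambda divided by x
    and by y ([natural_pde_class_pde]). For each class x and y are
    elementary functions of nu ([class_line_elements]), with constant factors chosen
    so that Q, P and R are those of the list ([class_pde_reduction]).

    For a parallel surface x and y are multiplied by 1 - a nu1 and 1 - a nu2 and,
    because of x' (nu1 - nu2) = - nu1' x and y' (nu2 - nu1) = - nu2' y, the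
    quotients x' / y, y' / x and the product nu1 nu2 x y remain the same up to a
    common sign. So the given surface has the same natural PDE as the basic one
    ([parallel_data]). *)

(** * Smooth functions *)

(** Smoothness to a finite order, the quantity on which all closure properties
    are proved by induction. *)
Definition Ck (D : region) (n : nat) (f : R -> R -> R) : Prop :=
  forall u v, D u v -> ex_diff_n f n u v.

Lemma open2_u D u v : open2 D -> D u v -> locally u (fun t => D t v).
Proof. intros HD H. exact (locally_2d_1d_const_y D u v (HD u v H)). Qed.

Lemma open2_v D u v : open2 D -> D u v -> locally v (fun t => D u t).
Proof. intros HD H. exact (locally_2d_1d_const_x D u v (HD u v H)). Qed.

Lemma Ck_ext D n f g :
  open2 D -> (forall u v, D u v -> f u v = g u v) -> Ck D n f -> Ck D n g.
Proof.
  intros HD E H u v Huv. apply ex_diff_n_ext_loc with f; auto.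
  destruct (HD u v Huv) as [d Hd]. exists d; auto.
Qed.

Lemma Ck_continuity D n f u v : Ck D n f -> D u v -> continuity_2d_pt f u v.
Proof. intros H Huv. destruct n; apply (H u v Huv). Qed.

Lemma Ck_le D n m f : (m <= n)%nat -> Ck D n f -> Ck D m f.
Proof. intros Hm H u v Huv. apply ex_diff_n_m with n; auto. Qed.

(** The way every closure property is proved: it is enough to know formulas for
    the two partial derivatives on the open set and their smoothness to one order
    less. *)
Lemma Ck_S D n f fu fv :
  open2 D ->
  (forall u v, D u v -> continuity_2d_pt f u v) ->
  (forall u v, D u v -> is_derive (fun t => f t v) u (fu u v)) ->
  (forall u v, D u v -> is_derive (fun t => f u t) v (fv u v)) ->
  Ck D n fu -> Ck D n fv -> Ck D (S n) f.
Proof.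
  intros HD Hc Hu Hv Cu Cv u v Huv. split; [now apply Hc|].
  split; [eexists; now apply Hu|]. split; [eexists; now apply Hv|].
  split.
  - refine (Ck_ext D n fu _ HD _ Cu u v Huv).
    intros x y Hxy. symmetry. apply is_derive_unique. now apply Hu.
  - refine (Ck_ext D n fv _ HD _ Cv u v Huv).
    intros x y Hxy. symmetry. apply is_derive_unique. now apply Hv.
Qed.

Lemma Ck_is_derive_u D n f u v :
  Ck D (S n) f -> D u v -> is_derive (fun t => f t v) u (Du f u v).
Proof. intros H Huv. apply Derive_correct. apply (H u v Huv). Qed.

Lemma Ck_is_derive_v D n f u v :
  Ck D (S n) f -> D u v -> is_derive (fun t => f u t) v (Dv f u v).
Proof. intros H Huv. apply Derive_correct. apply (H u v Huv). Qed.

Lemma Ck_Du D n f : Ck D (S n) f -> Ck D n (Du f).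
Proof. intros H u v Huv. apply (H u v Huv). Qed.

Lemma Ck_Dv D n f : Ck D (S n) f -> Ck D n (Dv f).
Proof. intros H u v Huv. apply (H u v Huv). Qed.

Lemma Ck_const D n c : open2 D -> Ck D n (fun _ _ => c).
Proof.
  intros HD. revert c. induction n as [|n IH]; intros c.
  - intros u v _. split; [apply continuity_2d_pt_const|exact I].
  - apply Ck_S with (fun _ _ => 0) (fun _ _ => 0); auto.
    + intros; apply continuity_2d_pt_const.
    + intros; apply @is_derive_const.
    + intros; apply @is_derive_const.
Qed.

Lemma Ck_fst D n : open2 D -> Ck D n (fun u _ => u).
Proof.
  intros HD. destruct n as [|n].
  - intros u v _. split; [apply continuity_2d_pt_id1|exact I].
  - apply Ck_S with (fun _ _ => 1) (fun _ _ => 0); auto using Ck_const.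
    + intros; apply continuity_2d_pt_id1.
    + intros; apply @is_derive_id.
    + intros; apply @is_derive_const.
Qed.

Lemma Ck_snd D n : open2 D -> Ck D n (fun _ v => v).
Proof.
  intros HD. destruct n as [|n].
  - intros u v _. split; [apply continuity_2d_pt_id2|exact I].
  - apply Ck_S with (fun _ _ => 0) (fun _ _ => 1); auto using Ck_const.
    + intros; apply continuity_2d_pt_id2.
    + intros; apply @is_derive_const.
    + intros; apply @is_derive_id.
Qed.

Lemma Ck_plus D n f g :
  open2 D -> Ck D n f -> Ck D n g -> Ck D n (fun u v => f u v + g u v).
Proof.
  intros HD. revert f g. induction n as [|n IH]; intros f g Hf Hg.
  - intros u v Huv. split; [|exact I].
    apply continuity_2d_pt_plus; [apply (Hf u v Huv)|apply (Hg u v Huv)].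
  - apply Ck_S with (fun u v => Du f u v + Du g u v)
                    (fun u v => Dv f u v + Dv g u v); auto using Ck_Du, Ck_Dv.
    + intros u v Huv. apply continuity_2d_pt_plus; eauto using Ck_continuity.
    + intros u v Huv.
      apply (is_derive_plus (fun t => f t v) (fun t => g t v));
        eauto using Ck_is_derive_u.
    + intros u v Huv.
      apply (is_derive_plus (fun t => f u t) (fun t => g u t));
        eauto using Ck_is_derive_v.
Qed.

Lemma Ck_mult D n f g :
  open2 D -> Ck D n f -> Ck D n g -> Ck D n (fun u v => f u v * g u v).
Proof.
  intros HD. revert f g. induction n as [|n IH]; intros f g Hf Hg.
  - intros u v Huv. split; [|exact I].
    apply continuity_2d_pt_mult; [apply (Hf u v Huv)|apply (Hg u v Huv)].
  - assert (Hf' := Ck_le D (S n) n f (le_S n n (le_n n)) Hf).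
    assert (Hg' := Ck_le D (S n) n g (le_S n n (le_n n)) Hg).
    apply Ck_S with (fun u v => Du f u v * g u v + f u v * Du g u v)
                    (fun u v => Dv f u v * g u v + f u v * Dv g u v); auto.
    + intros u v Huv. apply continuity_2d_pt_mult; eauto using Ck_continuity.
    + intros u v Huv.
      apply (is_derive_mult (fun t => f t v) (fun t => g t v));
        eauto using Ck_is_derive_u. intros; apply Rmult_comm.
    + intros u v Huv.
      apply (is_derive_mult (fun t => f u t) (fun t => g u t));
        eauto using Ck_is_derive_v. intros; apply Rmult_comm.
    + apply Ck_plus; auto using Ck_Du.
    + apply Ck_plus; auto using Ck_Dv.
Qed.

Lemma ex_derive_n_Derive n F t :
  ex_derive_n F (S (S n)) t <-> ex_derive_n (Derive F) (S n) t.
Proof.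
  assert (E : Derive_n F (S n) = Derive_n (Derive F) n).
  { apply functional_extensionality; intros x.
    replace (S n) with (n + 1)%nat by lia.
    exact (eq_sym (Derive_n_comp F n 1 x)). }
  unfold ex_derive_n. rewrite E. tauto.
Qed.

Lemma smooth1_is_derive X F t :
  smooth1 X F -> X t -> is_derive F t (Derive F t).
Proof. intros H Ht. apply Derive_correct. exact (H 1%nat t Ht). Qed.

Lemma smooth1_Derive X F : smooth1 X F -> smooth1 X (Derive F).
Proof.
  unfold smooth1. intros H n t Ht. destruct n as [|n]; [exact I|].
  exact (proj1 (ex_derive_n_Derive n F t) (H (S (S n)) t Ht)).
Qed.

Lemma smooth1_intro X F k :
  open X -> (forall t, X t -> is_derive F t (k t)) -> smooth1 X k ->
  smooth1 X F.
Proof.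
  unfold smooth1. intros HX HF Hk n t Ht. destruct n as [|[|n]]; [exact I| |].
  - eexists; now apply HF.
  - apply (proj2 (ex_derive_n_Derive n F t)).
    apply ex_derive_n_ext_loc with k; [|now apply Hk].
    generalize (HX t Ht). apply filter_imp. intros x Hx.
    symmetry. apply is_derive_unique. now apply HF.
Qed.

Lemma smooth1_subset (X Y : R -> Prop) F :
  (forall t, Y t -> X t) -> smooth1 X F -> smooth1 Y F.
Proof. intros HXY H n t Ht. apply H; auto. Qed.

Lemma smooth2_subset (D D' : region) f :
  (forall u v, D' u v -> D u v) -> smooth2 D f -> smooth2 D' f.
Proof. intros HD H n u v Huv. apply H; auto. Qed.

(** The outer function is smooth to all orders while the order of the inner one
    is kept finite; this asymmetry is what [smooth1_ode] needs. *)
Lemma Ck_comp D n X F h :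
  open2 D -> open X -> smooth1 X F -> Ck D n h ->
  (forall u v, D u v -> X (h u v)) -> Ck D n (fun u v => F (h u v)).
Proof.
  intros HD HX HF Hh HDX. revert F HF. induction n as [|n IH]; intros F HF.
  - intros u v Huv. split; [|exact I].
    apply continuity_1d_2d_pt_comp; [|apply (Hh u v Huv)].
    apply derivable_continuous_pt. exists (Derive F (h u v)).
    apply is_derive_Reals. now apply smooth1_is_derive with X; auto.
  - assert (Hh' := Ck_le D (S n) n h (le_S n n (le_n n)) Hh).
    assert (IHF := IH Hh' (Derive F) (smooth1_Derive X F HF)).
    apply Ck_S with (fun u v => Du h u v * Derive F (h u v))
                    (fun u v => Dv h u v * Derive F (h u v)); auto.
    + intros u v Huv.
      exact (Ck_continuity D n _ u v (IH Hh' F HF) Huv).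
    + intros u v Huv. apply (is_derive_comp F (fun t => h t v)).
      * apply smooth1_is_derive with X; auto.
      * eauto using Ck_is_derive_u.
    + intros u v Huv. apply (is_derive_comp F (fun t => h u t)).
      * apply smooth1_is_derive with X; auto.
      * eauto using Ck_is_derive_v.
    + apply Ck_mult; auto using Ck_Du.
    + apply Ck_mult; auto using Ck_Dv.
Qed.

Lemma smooth2_const D c : open2 D -> smooth2 D (fun _ _ => c).
Proof. intros HD n. now apply Ck_const. Qed.

Lemma smooth2_plus D f g :
  open2 D -> smooth2 D f -> smooth2 D g -> smooth2 D (fun u v => f u v + g u v).
Proof. intros HD Hf Hg n. apply (Ck_plus D n f g HD (Hf n) (Hg n)). Qed.

Lemma smooth2_mult D f g :
  open2 D -> smooth2 D f -> smooth2 D g -> smooth2 D (fun u v => f u v * g u v).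
Proof. intros HD Hf Hg n. apply (Ck_mult D n f g HD (Hf n) (Hg n)). Qed.

Lemma smooth2_scal D c f :
  open2 D -> smooth2 D f -> smooth2 D (fun u v => c * f u v).
Proof. intros HD Hf. apply smooth2_mult; auto using smooth2_const. Qed.

Lemma smooth2_ext D f g :
  open2 D -> (forall u v, D u v -> f u v = g u v) ->
  smooth2 D f -> smooth2 D g.
Proof. intros HD E H n. apply (Ck_ext D n f g HD E (H n)). Qed.

Lemma smooth2_minus D f g :
  open2 D -> smooth2 D f -> smooth2 D g -> smooth2 D (fun u v => f u v - g u v).
Proof.
  intros HD Hf Hg. apply smooth2_ext with (fun u v => f u v + (-1) * g u v); auto.
  - intros; ring.
  - apply smooth2_plus; auto using smooth2_scal.
Qed.

Lemma smooth2_comp D X F h :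
  open2 D -> open X -> smooth1 X F -> smooth2 D h ->
  (forall u v, D u v -> X (h u v)) -> smooth2 D (fun u v => F (h u v)).
Proof. intros HD HX HF Hh HDX n. apply (Ck_comp D n X F h); auto. exact (Hh n). Qed.

Lemma smooth2_Du D f : smooth2 D f -> smooth2 D (Du f).
Proof. intros H n. apply (Ck_Du D n f (H (S n))). Qed.

Lemma smooth2_Dv D f : smooth2 D f -> smooth2 D (Dv f).
Proof. intros H n. apply (Ck_Dv D n f (H (S n))). Qed.

Lemma smooth2_is_derive_u D f u v :
  smooth2 D f -> D u v -> is_derive (fun t => f t v) u (Du f u v).
Proof. intros H. apply (Ck_is_derive_u D 0). exact (H 1%nat). Qed.

Lemma smooth2_is_derive_v D f u v :
  smooth2 D f -> D u v -> is_derive (fun t => f u t) v (Dv f u v).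
Proof. intros H. apply (Ck_is_derive_v D 0). exact (H 1%nat). Qed.

Lemma smooth2_continuity D f u v :
  smooth2 D f -> D u v -> continuity_2d_pt f u v.
Proof. intros H. apply (Ck_continuity D 0). exact (H 0%nat). Qed.

Lemma Du_ext D f g u v :
  open2 D -> (forall x y, D x y -> f x y = g x y) -> D u v -> Du f u v = Du g u v.
Proof.
  intros HD E H. apply Derive_ext_loc.
  generalize (open2_u D u v HD H). apply filter_imp. auto.
Qed.

Lemma Dv_ext D f g u v :
  open2 D -> (forall x y, D x y -> f x y = g x y) -> D u v -> Dv f u v = Dv g u v.
Proof.
  intros HD E H. apply Derive_ext_loc.
  generalize (open2_v D u v HD H). apply filter_imp. auto.
Qed.

Lemma Du_Dv_comm D f u v :
  open2 D -> smooth2 D f -> D u v -> Du (Dv f) u v = Dv (Du f) u v.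
Proof.
  intros HD Hf H. symmetry. unfold Du, Dv. symmetry.
  apply (Schwarz f u v).
  - destruct (HD u v H) as [d Hd]. exists d. intros x y Hx Hy.
    specialize (Hd x y Hx Hy).
    repeat split.
    + eexists. exact (smooth2_is_derive_u D f x y Hf Hd).
    + eexists. exact (smooth2_is_derive_v D f x y Hf Hd).
    + eexists. exact (smooth2_is_derive_u D _ x y (smooth2_Dv D f Hf) Hd).
    + eexists. exact (smooth2_is_derive_v D _ x y (smooth2_Du D f Hf) Hd).
  - exact (smooth2_continuity D _ u v (smooth2_Du D _ (smooth2_Dv D f Hf)) H).
  - exact (smooth2_continuity D _ u v (smooth2_Dv D _ (smooth2_Du D f Hf)) H).
Qed.

(** A function of one variable is a function of two variables that ignores the
    second one, so that the one-variable rules follow from the two-variable ones. *)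
Definition cyl (X : R -> Prop) : region := fun u _ => X u.

Lemma open2_cyl X : open X -> open2 (cyl X).
Proof.
  intros HX u v Hu. destruct (HX u Hu) as [d Hd]. exists d.
  intros x y Hx _. apply Hd. exact Hx.
Qed.

Lemma smooth1_cyl X F : open X -> smooth1 X F -> smooth2 (cyl X) (fun u _ => F u).
Proof.
  intros HX HF. apply smooth2_comp with (F := F) (h := fun u _ => u) (X := X); auto.
  - now apply open2_cyl.
  - intros n. apply Ck_fst. now apply open2_cyl.
Qed.

Lemma ex_diff_n_ex_derive_n n f u v :
  ex_diff_n f n u v -> ex_derive_n (fun t => f t v) n u.
Proof.
  revert f. induction n as [|n IH]; intros f H; [exact I|].
  destruct n as [|n].
  - apply H.
  - apply (proj2 (ex_derive_n_Derive n (fun t => f t v) u)).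
    apply (IH (fun x y => Derive (fun t => f t y) x)). apply H.
Qed.

Lemma smooth2_smooth1 D f v :
  smooth2 D f -> smooth1 (fun u => D u v) (fun u => f u v).
Proof. intros H n u Hu. apply ex_diff_n_ex_derive_n. now apply H. Qed.

Lemma ex_diff_n_ex_derive_n_snd n f u v :
  ex_diff_n f n u v -> ex_derive_n (fun t => f u t) n v.
Proof.
  revert f. induction n as [|n IH]; intros f H; [exact I|].
  destruct n as [|n].
  - apply H.
  - apply (proj2 (ex_derive_n_Derive n (fun t => f u t) v)).
    apply (IH (fun x y => Derive (fun t => f x t) y)). apply H.
Qed.

Lemma smooth2_smooth1_snd D f u :
  smooth2 D f -> smooth1 (fun v => D u v) (fun v => f u v).
Proof. intros H n v Hv. apply ex_diff_n_ex_derive_n_snd. now apply H. Qed.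

Lemma smooth1_of_cyl X F : smooth2 (cyl X) (fun u _ => F u) -> smooth1 X F.
Proof. intros H. exact (smooth2_smooth1 (cyl X) (fun u _ => F u) 0 H). Qed.

(** Bootstrapping: if F is of class C^n, then so is k(F) = F', hence F is of class
    C^(n+1). The square root, the exponential, the tangent, x -> 1/x and the inverse
    of a primitive all come from this. *)
Lemma smooth1_ode (X Y : R -> Prop) (F k : R -> R) :
  open X -> open Y -> smooth1 Y k -> (forall t, X t -> Y (F t)) ->
  (forall t, X t -> is_derive F t (k (F t))) -> smooth1 X F.
Proof.
  intros HX HY Hk HXY HF. apply smooth1_of_cyl. intros n.
  assert (HC := open2_cyl X HX).
  assert (HF0 : forall u v, cyl X u v -> continuity_2d_pt (fun x _ => F x) u v).
  { intros u v Hu. apply continuity_1d_2d_pt_comp; [|apply continuity_2d_pt_id1].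
    apply derivable_continuous_pt. exists (k (F u)). apply is_derive_Reals.
    now apply HF. }
  induction n as [|n IH].
  - intros u v Hu. split; [auto|exact I].
  - apply Ck_S with (fun u _ => k (F u)) (fun _ _ => 0); auto.
    + intros; apply @is_derive_const.
    + apply (Ck_comp (cyl X) n Y k (fun u _ => F u)); auto.
    + now apply Ck_const.
Qed.

Lemma smooth1_const X c : open X -> smooth1 X (fun _ => c).
Proof.
  intros HX. apply smooth1_of_cyl. apply smooth2_const. now apply open2_cyl.
Qed.

Lemma smooth1_id X : open X -> smooth1 X (fun t => t).
Proof.
  intros HX. apply smooth1_of_cyl. intros n. apply Ck_fst. now apply open2_cyl.
Qed.

Lemma smooth1_plus X F G :
  open X -> smooth1 X F -> smooth1 X G -> smooth1 X (fun t => F t + G t).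
Proof.
  intros HX HF HG. apply smooth1_of_cyl.
  apply (smooth2_plus (cyl X) (fun u _ => F u) (fun u _ => G u));
    auto using open2_cyl, smooth1_cyl.
Qed.

Lemma smooth1_mult X F G :
  open X -> smooth1 X F -> smooth1 X G -> smooth1 X (fun t => F t * G t).
Proof.
  intros HX HF HG. apply smooth1_of_cyl.
  apply (smooth2_mult (cyl X) (fun u _ => F u) (fun u _ => G u));
    auto using open2_cyl, smooth1_cyl.
Qed.

Lemma smooth1_comp X Y F G :
  open X -> open Y -> smooth1 Y F -> smooth1 X G -> (forall t, X t -> Y (G t)) ->
  smooth1 X (fun t => F (G t)).
Proof.
  intros HX HY HF HG HXY. apply smooth1_of_cyl.
  apply (smooth2_comp (cyl X) Y F (fun u _ => G u));
    auto using open2_cyl, smooth1_cyl.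
Qed.

Lemma smooth1_ext X F G :
  open X -> (forall t, X t -> F t = G t) -> smooth1 X F -> smooth1 X G.
Proof.
  intros HX E HF. apply smooth1_of_cyl.
  apply smooth2_ext with (fun u _ => F u); auto using open2_cyl, smooth1_cyl.
Qed.

Lemma open_neq0 : open (fun t : R => t <> 0).
Proof. exact (open_neq 0). Qed.

Lemma smooth1_inv_id : smooth1 (fun t => t <> 0) (fun t => / t).
Proof.
  apply smooth1_ode with (Y := fun _ => True) (k := fun y => (-1) * (y * y)).
  - exact open_neq0.
  - exact open_true.
  - apply smooth1_mult; auto using open_true, smooth1_const.
    apply smooth1_mult; auto using open_true, smooth1_id.
  - auto.
  - intros t Ht. auto_derive; [exact Ht|]. field. exact Ht.
Qed.

Lemma smooth1_inv X F :
  open X -> smooth1 X F -> (forall t, X t -> F t <> 0) ->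
  smooth1 X (fun t => / F t).
Proof.
  intros HX HF H0.
  apply (smooth1_comp X (fun t => t <> 0) (fun t => / t) F);
    auto using open_neq0, smooth1_inv_id.
Qed.

Lemma smooth2_inv D f :
  open2 D -> smooth2 D f -> (forall u v, D u v -> f u v <> 0) ->
  smooth2 D (fun u v => / f u v).
Proof.
  intros HD Hf H0.
  apply (smooth2_comp D (fun t => t <> 0) (fun t => / t) f);
    auto using open_neq0, smooth1_inv_id.
Qed.

Lemma smooth2_div D f g :
  open2 D -> smooth2 D f -> smooth2 D g -> (forall u v, D u v -> g u v <> 0) ->
  smooth2 D (fun u v => f u v / g u v).
Proof. intros. apply smooth2_mult; auto using smooth2_inv. Qed.

Lemma open_pos : open (fun t : R => 0 < t).
Proof. exact (open_gt 0). Qed.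

Lemma smooth1_sqrt : smooth1 (fun t => 0 < t) sqrt.
Proof.
  apply smooth1_ode with (Y := fun t => 0 < t) (k := fun y => / (2 * y)).
  - exact open_pos.
  - exact open_pos.
  - apply smooth1_inv; [exact open_pos| |intros; lra].
    apply smooth1_mult; auto using open_pos, smooth1_const, smooth1_id.
  - intros t Ht. now apply sqrt_lt_R0.
  - intros t Ht. auto_derive; [exact Ht|].
    field. apply Rgt_not_eq. now apply sqrt_lt_R0.
Qed.

Lemma smooth1_exp : smooth1 (fun _ => True) exp.
Proof.
  apply smooth1_ode with (Y := fun _ => True) (k := fun y => y);
    auto using open_true, smooth1_id.
  intros t _. auto_derive; auto. ring.
Qed.

Lemma smooth1_ln : smooth1 (fun t => 0 < t) ln.
Proof.
  apply smooth1_intro with (fun t => / t); [exact open_pos| |].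
  - intros t Ht. auto_derive; [exact Ht|]. field. lra.
  - apply smooth1_inv; [exact open_pos| |intros; lra].
    apply smooth1_id, open_pos.
Qed.

Lemma smooth1_atan : smooth1 (fun _ => True) atan.
Proof.
  apply smooth1_intro with (fun t => / (1 + t * t)); [exact open_true| |].
  - intros t _. apply is_derive_atan.
  - apply smooth1_inv; [exact open_true| |intros t _; nra].
    apply smooth1_plus; auto using open_true, smooth1_const.
    apply smooth1_mult; auto using open_true, smooth1_id.
Qed.

Lemma continuity_2d_pt_reparam f phi psi u v :
  continuity_pt phi u -> continuity_pt psi v ->
  continuity_2d_pt f (phi u) (psi v) ->
  continuity_2d_pt (fun x y => f (phi x) (psi y)) u v.
Proof.
  intros Hphi Hpsi Hf eps. destruct (Hf eps) as [d Hd].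
  destruct (continuity_2d_pt_id1 u v (mkposreal _ Rlt_0_1)) as [d0 _].
  apply continuity_pt_locally with (eps := d) in Hphi.
  apply continuity_pt_locally with (eps := d) in Hpsi.
  destruct Hphi as [d1 H1], Hpsi as [d2 H2].
  assert (Hm : 0 < Rmin d1 d2) by (apply Rmin_pos; apply cond_pos).
  exists (mkposreal _ Hm). simpl. intros x y Hx Hy. apply Hd.
  - apply H1. apply Rlt_le_trans with (1 := Hx). apply Rmin_l.
  - apply H2. apply Rlt_le_trans with (1 := Hy). apply Rmin_r.
Qed.

Lemma is_derive_continuity_pt F t l : is_derive F t l -> continuity_pt F t.
Proof.
  intros H. apply derivable_continuous_pt. exists l. now apply is_derive_Reals.
Qed.

Lemma smooth1_continuity X F t : smooth1 X F -> X t -> continuity_pt F t.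
Proof.
  intros H Ht. eapply is_derive_continuity_pt. now apply smooth1_is_derive with X.
Qed.

Definition box (P Q : R -> Prop) : region := fun u v => P u /\ Q v.

Lemma open2_box P Q : open P -> open Q -> open2 (box P Q).
Proof.
  intros HP HQ u v [Hu Hv]. destruct (HP u Hu) as [d1 H1], (HQ v Hv) as [d2 H2].
  assert (Hm : 0 < Rmin d1 d2) by (apply Rmin_pos; apply cond_pos).
  exists (mkposreal _ Hm). simpl. intros x y Hx Hy. split.
  - apply H1. apply Rlt_le_trans with (1 := Hx). apply Rmin_l.
  - apply H2. apply Rlt_le_trans with (1 := Hy). apply Rmin_r.
Qed.

Lemma smooth2_reparam D P Q phi psi f :
  open P -> open Q -> smooth1 P phi -> smooth1 Q psi ->
  smooth2 D f -> (forall u v, box P Q u v -> D (phi u) (psi v)) ->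
  smooth2 (box P Q) (fun u v => f (phi u) (psi v)).
Proof.
  intros HP HQ Hphi Hpsi Hf HD n.
  assert (HB := open2_box P Q HP HQ).
  assert (Cphi : forall m, Ck (box P Q) m (fun u _ => Derive phi u)).
  { intros m u v [Hu _].
    exact (smooth1_cyl P _ HP (smooth1_Derive _ _ Hphi) m u v Hu). }
  assert (Cpsi : forall m, Ck (box P Q) m (fun _ v => Derive psi v)).
  { intros m.
    apply (Ck_comp (box P Q) m Q (Derive psi) (fun _ v => v)); auto using Ck_snd.
    - now apply smooth1_Derive.
    - intros u v [_ Hv]; exact Hv. }
  assert (Hc : forall g, smooth2 D g -> forall u v, box P Q u v ->
            continuity_2d_pt (fun x y => g (phi x) (psi y)) u v).
  { intros g Hg u v [Hu Hv]. apply continuity_2d_pt_reparam.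
    - now apply smooth1_continuity with P.
    - now apply smooth1_continuity with Q.
    - apply smooth2_continuity with D; auto. apply HD; split; auto. }
  change (Ck (box P Q) n (fun u v => f (phi u) (psi v))).
  revert f Hf. induction n as [|n IH]; intros f Hf.
  - intros u v Huv. split; [now apply Hc|exact I].
  - apply Ck_S with (fun u v => Derive phi u * Du f (phi u) (psi v))
                    (fun u v => Derive psi v * Dv f (phi u) (psi v)); auto.
    + intros u v [Hu Hv]. apply (is_derive_comp (fun t => f t (psi v)) phi).
      * apply smooth2_is_derive_u with D; auto. apply HD; split; auto.
      * now apply smooth1_is_derive with P.
    + intros u v [Hu Hv]. apply (is_derive_comp (fun t => f (phi u) t) psi).
      * apply smooth2_is_derive_v with D; auto. apply HD; split; auto.
      * now apply smooth1_is_derive with Q.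
    + apply Ck_mult; auto using smooth2_Du.
    + apply Ck_mult; auto using smooth2_Dv.
Qed.

(** * Vector functions in Minkowski space *)

Lemma vec_eq a b : x1 a = x1 b -> x2 a = x2 b -> x3 a = x3 b -> a = b.
Proof. destruct a, b; simpl; intros; now subst. Qed.

Lemma vsmooth_vDu D a : vsmooth D a -> vsmooth D (vDu a).
Proof. intros (H1 & H2 & H3). split; [|split].
  - exact (smooth2_Du D _ H1).
  - exact (smooth2_Du D _ H2).
  - exact (smooth2_Du D _ H3). Qed.

Lemma vsmooth_vDv D a : vsmooth D a -> vsmooth D (vDv a).
Proof. intros (H1 & H2 & H3). split; [|split].
  - exact (smooth2_Dv D _ H1).
  - exact (smooth2_Dv D _ H2).
  - exact (smooth2_Dv D _ H3). Qed.

Lemma vsmooth_ext D a b :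
  open2 D -> (forall u v, D u v -> a u v = b u v) -> vsmooth D a -> vsmooth D b.
Proof.
  intros HD E (H1 & H2 & H3).
  split; [|split].
  - refine (smooth2_ext D _ _ HD _ H1). intros u v Huv. now rewrite (E u v Huv).
  - refine (smooth2_ext D _ _ HD _ H2). intros u v Huv. now rewrite (E u v Huv).
  - refine (smooth2_ext D _ _ HD _ H3). intros u v Huv. now rewrite (E u v Huv).
Qed.

Lemma vsmooth_add D a b :
  open2 D -> vsmooth D a -> vsmooth D b -> vsmooth D (fun u v => vadd (a u v) (b u v)).
Proof.
  intros HD (a1 & a2 & a3) (b1 & b2 & b3). split; [|split].
  - exact (smooth2_plus D _ _ HD a1 b1).
  - exact (smooth2_plus D _ _ HD a2 b2).
  - exact (smooth2_plus D _ _ HD a3 b3). Qed.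

Lemma vsmooth_scal D c a :
  open2 D -> smooth2 D c -> vsmooth D a -> vsmooth D (fun u v => vscal (c u v) (a u v)).
Proof.
  intros HD Hc (a1 & a2 & a3). split; [|split].
  - exact (smooth2_mult D _ _ HD Hc a1).
  - exact (smooth2_mult D _ _ HD Hc a2).
  - exact (smooth2_mult D _ _ HD Hc a3). Qed.

Lemma smooth2_mdot D a b :
  open2 D -> vsmooth D a -> vsmooth D b -> smooth2 D (fun u v => mdot (a u v) (b u v)).
Proof.
  intros HD (? & ? & ?) (? & ? & ?). apply smooth2_minus; auto.
  - apply smooth2_plus; auto; now apply smooth2_mult.
  - now apply smooth2_mult.
Qed.

Lemma vDu_ext D a b u v :
  open2 D -> (forall x y, D x y -> a x y = b x y) -> D u v -> vDu a u v = vDu b u v.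
Proof.
  intros HD E H. apply vec_eq; simpl; apply (Du_ext D); auto;
    intros x y Hxy; now rewrite (E x y Hxy).
Qed.

Lemma vDv_ext D a b u v :
  open2 D -> (forall x y, D x y -> a x y = b x y) -> D u v -> vDv a u v = vDv b u v.
Proof.
  intros HD E H. apply vec_eq; simpl; apply (Dv_ext D); auto;
    intros x y Hxy; now rewrite (E x y Hxy).
Qed.

Lemma vDu_vDv_comm D a u v :
  open2 D -> vsmooth D a -> D u v -> vDu (vDv a) u v = vDv (vDu a) u v.
Proof.
  intros HD (H1 & H2 & H3) H.
  apply vec_eq; simpl.
  - exact (Du_Dv_comm D (fun s t => x1 (a s t)) u v HD H1 H).
  - exact (Du_Dv_comm D (fun s t => x2 (a s t)) u v HD H2 H).
  - exact (Du_Dv_comm D (fun s t => x3 (a s t)) u v HD H3 H).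
Qed.

Lemma Du_plus D f g u v :
  smooth2 D f -> smooth2 D g -> D u v ->
  Du (fun s t => f s t + g s t) u v = Du f u v + Du g u v.
Proof.
  intros Hf Hg H. apply is_derive_unique.
  apply (is_derive_plus (fun t => f t v) (fun t => g t v));
    now apply smooth2_is_derive_u with D.
Qed.

Lemma Dv_plus D f g u v :
  smooth2 D f -> smooth2 D g -> D u v ->
  Dv (fun s t => f s t + g s t) u v = Dv f u v + Dv g u v.
Proof.
  intros Hf Hg H. apply is_derive_unique.
  apply (is_derive_plus (fun t => f u t) (fun t => g u t));
    now apply smooth2_is_derive_v with D.
Qed.

Lemma Du_minus D f g u v :
  smooth2 D f -> smooth2 D g -> D u v ->
  Du (fun s t => f s t - g s t) u v = Du f u v - Du g u v.
Proof.
  intros Hf Hg H. apply is_derive_unique.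
  apply (is_derive_minus (fun t => f t v) (fun t => g t v));
    now apply smooth2_is_derive_u with D.
Qed.

Lemma Dv_minus D f g u v :
  smooth2 D f -> smooth2 D g -> D u v ->
  Dv (fun s t => f s t - g s t) u v = Dv f u v - Dv g u v.
Proof.
  intros Hf Hg H. apply is_derive_unique.
  apply (is_derive_minus (fun t => f u t) (fun t => g u t));
    now apply smooth2_is_derive_v with D.
Qed.

Lemma Du_mult D f g u v :
  smooth2 D f -> smooth2 D g -> D u v ->
  Du (fun s t => f s t * g s t) u v = Du f u v * g u v + f u v * Du g u v.
Proof.
  intros Hf Hg H. apply is_derive_unique.
  apply (is_derive_mult (fun t => f t v) (fun t => g t v));
    try (now apply smooth2_is_derive_u with D). intros; apply Rmult_comm.
Qed.

Lemma Dv_mult D f g u v :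
  smooth2 D f -> smooth2 D g -> D u v ->
  Dv (fun s t => f s t * g s t) u v = Dv f u v * g u v + f u v * Dv g u v.
Proof.
  intros Hf Hg H. apply is_derive_unique.
  apply (is_derive_mult (fun t => f u t) (fun t => g u t));
    try (now apply smooth2_is_derive_v with D). intros; apply Rmult_comm.
Qed.

Lemma Du_const c u v : Du (fun _ _ => c) u v = 0.
Proof. exact (Derive_const c u). Qed.

Lemma Dv_const c u v : Dv (fun _ _ => c) u v = 0.
Proof. exact (Derive_const c v). Qed.

Lemma Du_mdot D a b u v :
  open2 D -> vsmooth D a -> vsmooth D b -> D u v ->
  Du (fun s t => mdot (a s t) (b s t)) u v
  = mdot (vDu a u v) (b u v) + mdot (a u v) (vDu b u v).
Proof.
  intros HD (a1 & a2 & a3) (b1 & b2 & b3) H. unfold mdot.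
  rewrite (Du_minus D), (Du_plus D), !(Du_mult D);
    auto using smooth2_plus, smooth2_mult.
  simpl. ring.
Qed.

Lemma Dv_mdot D a b u v :
  open2 D -> vsmooth D a -> vsmooth D b -> D u v ->
  Dv (fun s t => mdot (a s t) (b s t)) u v
  = mdot (vDv a u v) (b u v) + mdot (a u v) (vDv b u v).
Proof.
  intros HD (a1 & a2 & a3) (b1 & b2 & b3) H. unfold mdot.
  rewrite (Dv_minus D), (Dv_plus D), !(Dv_mult D);
    auto using smooth2_plus, smooth2_mult.
  simpl. ring.
Qed.

Lemma vDu_add D a b u v :
  vsmooth D a -> vsmooth D b -> D u v ->
  vDu (fun s t => vadd (a s t) (b s t)) u v = vadd (vDu a u v) (vDu b u v).
Proof.
  intros (a1 & a2 & a3) (b1 & b2 & b3) H.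
  apply vec_eq; simpl; now rewrite (Du_plus D).
Qed.

Lemma vDv_add D a b u v :
  vsmooth D a -> vsmooth D b -> D u v ->
  vDv (fun s t => vadd (a s t) (b s t)) u v = vadd (vDv a u v) (vDv b u v).
Proof.
  intros (a1 & a2 & a3) (b1 & b2 & b3) H.
  apply vec_eq; simpl; now rewrite (Dv_plus D).
Qed.

Lemma vDu_scal D c a u v :
  smooth2 D c -> vsmooth D a -> D u v ->
  vDu (fun s t => vscal (c s t) (a s t)) u v
  = vadd (vscal (Du c u v) (a u v)) (vscal (c u v) (vDu a u v)).
Proof.
  intros Hc (a1 & a2 & a3) H.
  apply vec_eq; simpl; now rewrite (Du_mult D).
Qed.

Lemma vDv_scal D c a u v :
  smooth2 D c -> vsmooth D a -> D u v ->
  vDv (fun s t => vscal (c s t) (a s t)) u v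
  = vadd (vscal (Dv c u v) (a u v)) (vscal (c u v) (vDv a u v)).
Proof.
  intros Hc (a1 & a2 & a3) H.
  apply vec_eq; simpl; now rewrite (Dv_mult D).
Qed.

Lemma mdot_comm a b : mdot a b = mdot b a.
Proof. unfold mdot; ring. Qed.
Lemma mdot_addl a b c : mdot (vadd a b) c = mdot a c + mdot b c.
Proof. unfold mdot; simpl; ring. Qed.
Lemma mdot_addr a b c : mdot c (vadd a b) = mdot c a + mdot c b.
Proof. unfold mdot; simpl; ring. Qed.
Lemma mdot_scall k a b : mdot (vscal k a) b = k * mdot a b.
Proof. unfold mdot; simpl; ring. Qed.
Lemma mdot_scalr k a b : mdot a (vscal k b) = k * mdot a b.
Proof. unfold mdot; simpl; ring. Qed.

Definition vdet (a b c : vec3) : R :=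
  x1 a * (x2 b * x3 c - x3 b * x2 c)
  - x2 a * (x1 b * x3 c - x3 b * x1 c)
  + x3 a * (x1 b * x2 c - x2 b * x1 c).

(** The square of the determinant of three vectors is minus their Gram
    determinant, so that three orthogonal non-isotropic vectors form a basis. *)
Lemma mdot_frame_0 e f g a :
  mdot e f = 0 -> mdot e g = 0 -> mdot f g = 0 ->
  mdot e e * mdot f f * mdot g g <> 0 ->
  mdot a e = 0 -> mdot a f = 0 -> mdot a g = 0 -> a = Vec 0 0 0.
Proof.
  intros Hef Heg Hfg H0 He Hf Hg.
  assert (Hdet : vdet e f g ^ 2 = - (mdot e e * mdot f f * mdot g g)).
  { transitivity (- (mdot e e * (mdot f f * mdot g g - mdot f g ^ 2)
       - mdot e f * (mdot e f * mdot g g - mdot f g * mdot e g)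
       + mdot e g * (mdot e f * mdot f g - mdot f f * mdot e g))).
    - unfold mdot, vdet; ring.
    - rewrite Hef, Heg, Hfg; ring. }
  assert (Hd : vdet e f g <> 0).
  { intros E. rewrite E in Hdet. apply H0. lra. }
  apply vec_eq; simpl; apply (Rmult_eq_reg_l (vdet e f g)); auto;
    rewrite Rmult_0_r.
  - transitivity (mdot a e * (x2 f * x3 g - x3 f * x2 g)
      - mdot a f * (x2 e * x3 g - x3 e * x2 g)
      + mdot a g * (x2 e * x3 f - x3 e * x2 f)).
    + unfold mdot, vdet; ring.
    + rewrite He, Hf, Hg; ring.
  - transitivity (- (mdot a e * (x1 f * x3 g - x3 f * x1 g)
      - mdot a f * (x1 e * x3 g - x3 e * x1 g)
      + mdot a g * (x1 e * x3 f - x3 e * x1 f))).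
    + unfold mdot, vdet; ring.
    + rewrite He, Hf, Hg; ring.
  - transitivity (- (mdot a e * (x1 f * x2 g - x2 f * x1 g)
      - mdot a f * (x1 e * x2 g - x2 e * x1 g)
      + mdot a g * (x1 e * x2 f - x2 e * x1 f))).
    + unfold mdot, vdet; ring.
    + rewrite He, Hf, Hg; ring.
Qed.

Lemma mdot_frame_expand e f g a :
  mdot e f = 0 -> mdot e g = 0 -> mdot f g = 0 ->
  mdot e e <> 0 -> mdot f f <> 0 -> mdot g g <> 0 ->
  a = vadd (vscal (mdot a e / mdot e e) e)
       (vadd (vscal (mdot a f / mdot f f) f) (vscal (mdot a g / mdot g g) g)).
Proof.
  intros Hef Heg Hfg He Hf Hg.
  assert (Hfe : mdot f e = 0) by now rewrite mdot_comm.
  assert (Hge : mdot g e = 0) by now rewrite mdot_comm.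
  assert (Hgf : mdot g f = 0) by now rewrite mdot_comm.
  set (s := vadd _ _).
  assert (E : vadd a (vscal (-1) s) = Vec 0 0 0).
  { apply mdot_frame_0 with e f g; auto.
    - repeat apply Rmult_integral_contrapositive_currified; auto.
    - unfold s. rewrite !mdot_addl, !mdot_scall, !mdot_addl, !mdot_scall, Hfe, Hge.
      field; auto.
    - unfold s. rewrite !mdot_addl, !mdot_scall, !mdot_addl, !mdot_scall, Hef, Hgf.
      field; auto.
    - unfold s. rewrite !mdot_addl, !mdot_scall, !mdot_addl, !mdot_scall, Heg, Hfg.
      field; auto. }
  clearbody s. assert (E1 := f_equal x1 E). assert (E2 := f_equal x2 E).
  assert (E3 := f_equal x3 E). simpl in E1, E2, E3.
  apply vec_eq; lra.
Qed.

(** * Weingarten, Codazzi and Gauss equations in principal parameters *)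

Lemma surf_G_pos D z l u v : spacelike_surface D z l -> D u v -> 0 < GG z u v.
Proof.
  intros S H. assert (HE := surf_metric_E D z l S u v H).
  assert (Hd := surf_metric_det D z l S u v H).
  assert (0 <= FF z u v ^ 2) by apply pow2_ge_0.
  apply Rmult_lt_reg_l with (EE z u v); lra.
Qed.

Lemma smooth2_EE D z : open2 D -> vsmooth D z -> smooth2 D (EE z).
Proof.
  intros HD Hz. exact (smooth2_mdot D _ _ HD (vsmooth_vDu D z Hz) (vsmooth_vDu D z Hz)).
Qed.
Lemma smooth2_GG D z : open2 D -> vsmooth D z -> smooth2 D (GG z).
Proof.
  intros HD Hz. exact (smooth2_mdot D _ _ HD (vsmooth_vDv D z Hz) (vsmooth_vDv D z Hz)).
Qed.
Lemma smooth2_nu1 D z l : spacelike_surface D z l -> smooth2 D (nu1 z l).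
Proof.
  intros S. assert (HD := surf_open D z l S). assert (Hz := surf_smooth D z l S).
  apply smooth2_div; auto using smooth2_EE.
  - apply smooth2_mdot; auto using vsmooth_vDu. apply (surf_normal_smooth D z l S).
  - intros u v H. apply Rgt_not_eq. exact (surf_metric_E D z l S u v H).
Qed.
Lemma smooth2_nu2 D z l : spacelike_surface D z l -> smooth2 D (nu2 z l).
Proof.
  intros S. assert (HD := surf_open D z l S). assert (Hz := surf_smooth D z l S).
  apply smooth2_div; auto using smooth2_GG.
  - apply smooth2_mdot; auto using vsmooth_vDv. apply (surf_normal_smooth D z l S).
  - intros u v H. apply Rgt_not_eq. exact (surf_G_pos D z l u v S H).
Qed.

(** Differentiating the relations between l, z_u and z_v gives the products of l_u
    and l_v with the frame z_u, z_v, l; here M = 0 is used. *)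
Lemma weingarten_equations D z l u v :
  spacelike_surface D z l -> principal_parameters D z l -> D u v ->
  vDu l u v = vscal (- nu1 z l u v) (vDu z u v) /\
  vDv l u v = vscal (- nu2 z l u v) (vDv z u v).
Proof.
  intros S P H. destruct (P u v H) as [HF HM].
  assert (HD := surf_open D z l S). assert (Hz := surf_smooth D z l S).
  assert (Hl := surf_normal_smooth D z l S).
  assert (HE := surf_metric_E D z l S u v H). assert (HG := surf_G_pos D z l u v S H).
  assert (Hzu := vsmooth_vDu D z Hz). assert (Hzv := vsmooth_vDv D z Hz).
  assert (Hll := surf_normal_unit D z l S u v H).
  assert (Hlu := surf_normal_u D z l S u v H).
  assert (Hlv := surf_normal_v D z l S u v H).
  assert (A1 : mdot (vDu l u v) (vDu z u v) + LL z l u v = 0).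
  { unfold LL. rewrite <- (Du_mdot D); auto.
    rewrite (Du_ext D _ (fun _ _ => 0)); auto using Du_const.
    apply (surf_normal_u D z l S). }
  assert (A2 : mdot (vDv l u v) (vDu z u v) + MM z l u v = 0).
  { unfold MM. rewrite <- (Dv_mdot D); auto.
    rewrite (Dv_ext D _ (fun _ _ => 0)); auto using Dv_const.
    apply (surf_normal_u D z l S). }
  assert (A3 : mdot (vDu l u v) (vDv z u v) + MM z l u v = 0).
  { unfold MM. rewrite <- (vDu_vDv_comm D), <- (Du_mdot D); auto.
    rewrite (Du_ext D _ (fun _ _ => 0)); auto using Du_const.
    apply (surf_normal_v D z l S). }
  assert (A4 : mdot (vDv l u v) (vDv z u v) + NN z l u v = 0).
  { unfold NN. rewrite <- (Dv_mdot D); auto.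
    rewrite (Dv_ext D _ (fun _ _ => 0)); auto using Dv_const.
    apply (surf_normal_v D z l S). }
  assert (A5 : 2 * mdot (vDu l u v) (l u v) = 0).
  { transitivity (Du (fun s t => mdot (l s t) (l s t)) u v).
    - rewrite (Du_mdot D), (mdot_comm (l u v)); auto. ring.
    - rewrite (Du_ext D _ (fun _ _ => -1)); auto using Du_const.
      apply (surf_normal_unit D z l S). }
  assert (A6 : 2 * mdot (vDv l u v) (l u v) = 0).
  { transitivity (Dv (fun s t => mdot (l s t) (l s t)) u v).
    - rewrite (Dv_mdot D), (mdot_comm (l u v)); auto. ring.
    - rewrite (Dv_ext D _ (fun _ _ => -1)); auto using Dv_const.
      apply (surf_normal_unit D z l S). }
  rewrite HM in A2, A3.
  fold (EE z u v) (FF z u v) (GG z u v) in *.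
  assert (Hfr : forall a, a = vadd (vscal (mdot a (vDu z u v) / EE z u v) (vDu z u v))
       (vadd (vscal (mdot a (vDv z u v) / GG z u v) (vDv z u v))
             (vscal (mdot a (l u v) / -1) (l u v)))).
  { intros a. rewrite <- Hll. apply mdot_frame_expand.
    - exact HF.
    - now rewrite mdot_comm.
    - now rewrite mdot_comm.
    - unfold EE in HE; lra.
    - unfold GG in HG; lra.
    - lra. }
  unfold nu1, nu2. split.
  - rewrite (Hfr (vDu l u v)).
    replace (mdot (vDu l u v) (vDu z u v)) with (- LL z l u v) by lra.
    replace (mdot (vDu l u v) (vDv z u v)) with 0 by lra.
    replace (mdot (vDu l u v) (l u v)) with 0 by lra.
    apply vec_eq; simpl; field; lra.
  - rewrite (Hfr (vDv l u v)).
    replace (mdot (vDv l u v) (vDv z u v)) with (- NN z l u v) by lra.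
    replace (mdot (vDv l u v) (vDu z u v)) with 0 by lra.
    replace (mdot (vDv l u v) (l u v)) with 0 by lra.
    apply vec_eq; simpl; field; lra.
Qed.

Lemma prod_neq_0 a b : a <> 0 -> b <> 0 -> a * b <> 0.
Proof. apply Rmult_integral_contrapositive_currified. Qed.

Lemma div_neq_0 a b : a <> 0 -> b <> 0 -> a / b <> 0.
Proof. intros. apply prod_neq_0; auto. now apply Rinv_neq_0_compat. Qed.

Lemma Dv_EE D z u v : open2 D -> vsmooth D z -> D u v ->
  Dv (EE z) u v = 2 * mdot (vDu z u v) (vDv (vDu z) u v).
Proof.
  intros HD Hz H. unfold EE. rewrite (Dv_mdot D); auto using vsmooth_vDu.
  rewrite (mdot_comm (vDv _ u v)). ring.
Qed.

Lemma Du_EE D z u v : open2 D -> vsmooth D z -> D u v ->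
  Du (EE z) u v = 2 * mdot (vDu z u v) (vDu (vDu z) u v).
Proof.
  intros HD Hz H. unfold EE. rewrite (Du_mdot D); auto using vsmooth_vDu.
  rewrite (mdot_comm (vDu (vDu z) u v)). ring.
Qed.

Lemma Du_GG D z u v : open2 D -> vsmooth D z -> D u v ->
  Du (GG z) u v = 2 * mdot (vDv z u v) (vDv (vDu z) u v).
Proof.
  intros HD Hz H. unfold GG. rewrite (Du_mdot D); auto using vsmooth_vDv.
  rewrite (vDu_vDv_comm D), (mdot_comm (vDv (vDu z) u v)); auto. ring.
Qed.

Lemma Dv_GG D z u v : open2 D -> vsmooth D z -> D u v ->
  Dv (GG z) u v = 2 * mdot (vDv z u v) (vDv (vDv z) u v).
Proof.
  intros HD Hz H. unfold GG. rewrite (Dv_mdot D); auto using vsmooth_vDv.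
  rewrite (mdot_comm (vDv (vDv z) u v)). ring.
Qed.

Lemma Du_scal c f u v : Du (fun s t => c * f s t) u v = c * Du f u v.
Proof. apply (Derive_scal (fun t => f t v)). Qed.

Lemma Dv_scal c f u v : Dv (fun s t => c * f s t) u v = c * Dv f u v.
Proof. apply (Derive_scal (fun t => f u t)). Qed.

(** The equality of the mixed derivatives of l, with l_u = - nu1 z_u and
    l_v = - nu2 z_v, multiplied by z_u and by z_v. *)
Lemma codazzi_equations D z l u v :
  spacelike_surface D z l -> principal_parameters D z l -> D u v ->
  2 * Dv (nu1 z l) u v * EE z u v
    = - ((nu1 z l u v - nu2 z l u v) * Dv (EE z) u v) /\
  2 * Du (nu2 z l) u v * GG z u v
    = (nu1 z l u v - nu2 z l u v) * Du (GG z) u v.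
Proof.
  intros S P H. destruct (P u v H) as [HF _].
  assert (HD := surf_open D z l S). assert (Hz := surf_smooth D z l S).
  assert (Hl := surf_normal_smooth D z l S).
  assert (Hzu := vsmooth_vDu D z Hz). assert (Hzv := vsmooth_vDv D z Hz).
  assert (S1 := smooth2_nu1 D z l S). assert (S2 := smooth2_nu2 D z l S).
  assert (W := fun x y => weingarten_equations D z l x y S P).
  assert (C := vDu_vDv_comm D l u v HD Hl H).
  rewrite (vDu_ext D (vDv l) (fun x y => vscal (-1 * nu2 z l x y) (vDv z x y))) in C; auto.
  2: { intros x y Hxy. rewrite (proj2 (W x y Hxy)). f_equal. ring. }
  rewrite (vDv_ext D (vDu l) (fun x y => vscal (-1 * nu1 z l x y) (vDu z x y))) in C; auto.
  2: { intros x y Hxy. rewrite (proj1 (W x y Hxy)). f_equal. ring. }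
  rewrite (vDu_scal D), (vDv_scal D) in C; auto using smooth2_scal.
  rewrite (Du_mult D), (Dv_mult D), Du_const, Dv_const in C;
    auto using smooth2_const.
  rewrite (vDu_vDv_comm D z) in C; auto.
  rewrite (Dv_EE D), (Du_GG D); auto.
  assert (Cu := f_equal (fun a => mdot (vDu z u v) a) C).
  assert (Cv := f_equal (fun a => mdot (vDv z u v) a) C). simpl in Cu, Cv.
  rewrite !mdot_addr, !mdot_scalr in Cu, Cv.
  fold (FF z u v) (EE z u v) in Cu. rewrite (mdot_comm (vDv z u v) (vDu z u v)) in Cv.
  fold (FF z u v) (GG z u v) in Cv. rewrite HF in Cu, Cv. lra.
Qed.

(** Two derivatives of F = 0 express (E_vv + G_uu) / 2 as the difference of
    z_uv z_uv and z_uu z_vv; these two products are computed in the frame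
    z_u, z_v, l. *)
Lemma gauss_equation D z l u v :
  spacelike_surface D z l -> principal_parameters D z l -> D u v ->
  2 * (Dvv (EE z) u v + Duu (GG z) u v) * (EE z u v * GG z u v)
  = (Du (EE z) u v * Du (GG z) u v + Dv (EE z) u v ^ 2) * GG z u v
    + (Dv (EE z) u v * Dv (GG z) u v + Du (GG z) u v ^ 2) * EE z u v
    + 4 * nu1 z l u v * nu2 z l u v * (EE z u v * GG z u v) ^ 2.
Proof.
  intros S P H. destruct (P u v H) as [HF HM].
  assert (HD := surf_open D z l S). assert (Hz := surf_smooth D z l S).
  assert (Hzu := vsmooth_vDu D z Hz). assert (Hzv := vsmooth_vDv D z Hz).
  assert (Hzuu := vsmooth_vDu D _ Hzu). assert (Hzuv := vsmooth_vDv D _ Hzu).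
  assert (Hzvv := vsmooth_vDv D _ Hzv).
  assert (HE := surf_metric_E D z l S u v H). assert (HG := surf_G_pos D z l u v S H).
  assert (Hll := surf_normal_unit D z l S u v H).
  assert (Hlu := surf_normal_u D z l S u v H).
  assert (Hlv := surf_normal_v D z l S u v H).
  assert (Parseval : forall a b, mdot a b =
     mdot (vDu z u v) a * mdot (vDu z u v) b / EE z u v
     + mdot (vDv z u v) a * mdot (vDv z u v) b / GG z u v
     - mdot (l u v) a * mdot (l u v) b).
  { intros a b.
    assert (Hex : a = vadd (vscal (mdot a (vDu z u v) / EE z u v) (vDu z u v))
       (vadd (vscal (mdot a (vDv z u v) / GG z u v) (vDv z u v))
             (vscal (mdot a (l u v) / -1) (l u v)))).
    { rewrite <- Hll. apply mdot_frame_expand.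
      - exact HF.
      - now rewrite mdot_comm.
      - now rewrite mdot_comm.
      - unfold EE in HE; lra.
      - unfold GG in HG; lra.
      - lra. }
    rewrite Hex at 1. rewrite !mdot_addl, !mdot_scall.
    rewrite (mdot_comm a (vDu z u v)), (mdot_comm a (vDv z u v)), (mdot_comm a (l u v)).
    field. lra. }
  assert (HFu : forall x y, D x y ->
     mdot (vDu (vDu z) x y) (vDv z x y) + mdot (vDu z x y) (vDv (vDu z) x y) = 0).
  { intros x y Hxy. rewrite <- (vDu_vDv_comm D z x y), <- (Du_mdot D); auto.
    rewrite (Du_ext D _ (fun _ _ => 0)); auto using Du_const.
    intros s t Hst. apply (P s t Hst). }
  assert (HFv : mdot (vDv (vDu z) u v) (vDv z u v) + mdot (vDu z u v) (vDv (vDv z) u v) = 0).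
  { rewrite <- (Dv_mdot D); auto.
    rewrite (Dv_ext D _ (fun _ _ => 0)); auto using Dv_const.
    intros s t Hst. apply (P s t Hst). }
  assert (HFuv :
    mdot (vDu (vDv (vDu z)) u v) (vDv z u v) + mdot (vDu (vDu z) u v) (vDv (vDv z) u v)
    + (mdot (vDv (vDu z) u v) (vDv (vDu z) u v)
       + mdot (vDu z u v) (vDv (vDv (vDu z)) u v)) = 0).
  { rewrite (vDu_vDv_comm D (vDu z)); auto.
    rewrite <- (Dv_mdot D (vDu (vDu z)) (vDv z)), <- (Dv_mdot D (vDu z) (vDv (vDu z)));
      auto.
    rewrite <- (Dv_plus D (fun s t => mdot (vDu (vDu z) s t) (vDv z s t))
      (fun s t => mdot (vDu z s t) (vDv (vDu z) s t))); auto using smooth2_mdot.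
    rewrite (Dv_ext D _ (fun _ _ => 0)); auto using Dv_const. }
  assert (HEvv : Dvv (EE z) u v = 2 * (mdot (vDv (vDu z) u v) (vDv (vDu z) u v)
       + mdot (vDu z u v) (vDv (vDv (vDu z)) u v))).
  { unfold Dvv.
    rewrite (Dv_ext D _ (fun x y => 2 * mdot (vDu z x y) (vDv (vDu z) x y)));
      auto.
    rewrite Dv_scal, (Dv_mdot D); auto.
    intros; now apply (Dv_EE D). }
  assert (HGuu : Duu (GG z) u v = 2 * (mdot (vDv (vDu z) u v) (vDv (vDu z) u v)
       + mdot (vDv z u v) (vDu (vDv (vDu z)) u v))).
  { unfold Duu.
    rewrite (Du_ext D _ (fun x y => 2 * mdot (vDv z x y) (vDv (vDu z) x y))); auto.
    rewrite Du_scal, (Du_mdot D), (vDu_vDv_comm D z u v); auto.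
    intros; now apply (Du_GG D). }
  rewrite HEvv, HGuu.
  rewrite (Du_EE D), (Dv_EE D), (Du_GG D), (Dv_GG D); auto.
  assert (HFu0 := HFu u v H).
  assert (HL : LL z l u v = nu1 z l u v * EE z u v) by (unfold nu1; field; lra).
  assert (HN : NN z l u v = nu2 z l u v * GG z u v) by (unfold nu2; field; lra).
  assert (P1 := Parseval (vDv (vDu z) u v) (vDv (vDu z) u v)).
  assert (P2 := Parseval (vDu (vDu z) u v) (vDv (vDv z) u v)).
  fold (MM z l u v) in P1. fold (LL z l u v) (NN z l u v) in P2.
  rewrite HM in P1. rewrite HL, HN in P2.
  rewrite (mdot_comm (vDu (vDu z) u v) (vDv z u v)) in HFu0.
  rewrite (mdot_comm (vDv (vDu z) u v) (vDv z u v)) in HFv.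
  rewrite (mdot_comm (vDu (vDv (vDu z)) u v) (vDv z u v)) in HFuv.
  set (p := mdot (vDu z u v) (vDv (vDu z) u v)) in *.
  set (q := mdot (vDv z u v) (vDv (vDu z) u v)) in *.
  replace (mdot (vDv z u v) (vDu (vDu z) u v)) with (- p) in P2 by lra.
  replace (mdot (vDu z u v) (vDv (vDv z) u v)) with (- q) in P2 by lra.
  set (r := mdot (vDv (vDu z) u v) (vDv (vDu z) u v)) in *.
  set (w := mdot (vDu (vDu z) u v) (vDv (vDv z) u v)) in *.
  transitivity (4 * (r - w) * (EE z u v * GG z u v)).
  { replace (mdot (vDv z u v) (vDu (vDv (vDu z)) u v)) with
      (- w - (r + mdot (vDu z u v) (vDv (vDv (vDu z)) u v))) by lra.
    ring. }
  rewrite P1, P2. field. lra.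
Qed.

(** * The natural PDE in divergence form *)

Lemma constant_of_derive_0 (X : R -> Prop) (h : R -> R) s t :
  is_interval X -> (forall x, X x -> is_derive h x 0) -> X s -> X t -> h s = h t.
Proof.
  intros HX Hh Hs Ht.
  assert (HI : forall x, Rmin s t <= x <= Rmax s t -> X x).
  { intros x Hx. unfold Rmin, Rmax in Hx. destruct (Rle_dec s t).
    - now apply (HX s t).
    - now apply (HX t s). }
  destruct (MVT_gen h s t (fun _ => 0)) as [c [_ Hc]].
  - intros x Hx. apply Hh, HI. lra.
  - intros x Hx. eapply is_derive_continuity_pt. apply Hh, HI. lra.
  - lra.
Qed.

Lemma Weingarten_swap X f g :
  Weingarten_functions X f g -> Weingarten_functions X g f.
Proof.
  intros [a b c d e h]. constructor; auto.
  - intros t Ht. rewrite Rmult_comm. auto.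
  - intros t Ht E. apply (h t Ht). lra.
Qed.

Lemma smooth1_integrand X f g :
  Weingarten_functions X f g -> smooth1 X (fun s => Derive f s / (f s - g s)).
Proof.
  intros W. assert (HX := W_open X f g W).
  assert (Hf := W_smooth_f X f g W). assert (Hg := W_smooth_g X f g W).
  apply smooth1_mult; auto using smooth1_Derive.
  apply smooth1_inv; auto.
  - apply smooth1_ext with (fun t => f t + (-1) * g t); auto.
    + intros; ring.
    + apply smooth1_plus; auto. apply smooth1_mult; auto using smooth1_const.
  - intros t Ht. apply (W_neq X f g W t Ht).
Qed.

Lemma is_derive_primitive (X : R -> Prop) (h : R -> R) s t :
  open X -> is_interval X -> (forall x, X x -> continuity_pt h x) -> X s -> X t ->
  is_derive (fun x => RInt h s x) t (h t).
Proof.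
  intros HX HI Hc Hs Ht.
  assert (Hc' : forall x, X x -> continuous h x).
  { intros x Hx. apply continuity_pt_filterlim. now apply Hc. }
  apply (is_derive_RInt h (fun x => RInt h s x) s); [|now apply Hc'].
  generalize (HX t Ht). apply filter_imp. intros x Hx.
  apply (RInt_correct (V := R_CompleteNormedModule)).
  apply (ex_RInt_continuous (V := R_CompleteNormedModule)).
  intros y Hy. apply Hc'. unfold Rmin, Rmax in Hy. destruct (Rle_dec s x).
  - now apply (HI s x).
  - now apply (HI x s).
Qed.

Lemma is_derive_Iint X f g nu0 t :
  Weingarten_functions X f g -> X nu0 -> X t ->
  is_derive (Iint f g nu0) t (Derive f t / (f t - g t)).
Proof.
  intros W H0 Ht.
  apply (is_derive_primitive X (fun s => Derive f s / (f s - g s))); auto.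
  - apply (W_open X f g W).
  - apply (W_interval X f g W).
  - intros x Hx. apply (smooth1_continuity X); auto. now apply smooth1_integrand.
Qed.

Lemma smooth1_Iint X f g nu0 :
  Weingarten_functions X f g -> X nu0 -> smooth1 X (Iint f g nu0).
Proof.
  intros W H0.
  apply smooth1_intro with (fun s => Derive f s / (f s - g s)).
  - apply (W_open X f g W).
  - intros t Ht. now apply (is_derive_Iint X).
  - now apply smooth1_integrand.
Qed.

(** Closed forms, up to sign and constant factors, of sqrt E and sqrt G as
    functions of nu. The sign is left free so that rational expressions in nu are
    allowed; only nonvanishing matters. *)
Definition line_elements (X : R -> Prop) (f g Xc Yc : R -> R) : Prop :=
  forall t, X t ->
    Xc t <> 0 /\ Yc t <> 0 /\
    is_derive Xc t (- (Derive f t / (f t - g t)) * Xc t) /\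
    is_derive Yc t (- (Derive g t / (g t - f t)) * Yc t).

(** Both sides solve the same linear differential equation. *)
Lemma exp_Iint X f g nu0 (Xc : R -> R) t :
  Weingarten_functions X f g ->
  (forall s, X s -> Xc s <> 0) ->
  (forall s, X s -> is_derive Xc s (- (Derive f s / (f s - g s)) * Xc s)) ->
  X nu0 -> X t ->
  exp (- Iint f g nu0 t) = Xc t / Xc nu0.
Proof.
  intros W Hn Hd H0 Ht.
  assert (E : Xc t * exp (Iint f g nu0 t) = Xc nu0 * exp (Iint f g nu0 nu0)).
  { apply (constant_of_derive_0 X (fun s => Xc s * exp (Iint f g nu0 s))); auto.
    - apply (W_interval X f g W).
    - intros s Hs.
      assert (HI := is_derive_Iint X f g nu0 s W H0 Hs).
      evar_last.
      + apply (is_derive_mult Xc (fun s => exp (Iint f g nu0 s))).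
        * now apply Hd.
        * apply (is_derive_comp exp (Iint f g nu0)); [|exact HI].
          apply is_derive_Reals, derivable_pt_lim_exp.
        * intros; apply Rmult_comm.
      + unfold plus, mult, scal; simpl. unfold mult; simpl. ring. }
  unfold Iint in E at 2. rewrite RInt_point in E. change zero with 0 in E.
  rewrite exp_0, Rmult_1_r in E. rewrite <- E.
  rewrite exp_Ropp. field. split; [apply Rgt_not_eq, exp_pos|auto].
Qed.

(** Each class PDE is Q(lambda)_uu + P(lambda)_vv = R(lambda) with the functions
    Q, P, R below. *)
Definition class_Q (c : basic_class) (x : R) : R :=
  match c with
  | H_zero | H_half | K_minus_one => x
  | Hdiff_one | K_twice_Hdiff => exp x
  | H_prop_gt p | H_prop_lt p | H_affine_gt p | H_affine_lt p => Rpower x p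
  | K_affine p q => exp (p * (/ sqrt q * atan (x / sqrt q)))
  end.

Definition class_P (c : basic_class) (x : R) : R :=
  match c with
  | H_zero | H_half => x
  | K_minus_one => - x
  | H_prop_lt p | H_affine_lt p => - / Rpower x p
  | _ => / class_Q c x
  end.

Definition class_R (c : basic_class) (x : R) : R :=
  match c with
  | H_zero => exp x
  | H_half => sinh x
  | Hdiff_one => 2 * x * (x + 2)
  | H_prop_gt p | H_prop_lt p => 2 * (p * (p + 1) / (p - 1) ^ 2) * x
  | H_affine_gt p | H_affine_lt p =>
      p * ((p - 1) * x + 2) * ((p + 1) * x + 2) / (2 * (p - 1) * x)
  | K_minus_one => - sin x
  | K_twice_Hdiff => 2
  | K_affine p q => p * q / 2 * (x * (p * x - 2 * q) / (x ^ 2 + q))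
  end.

Lemma Dvv_opp f u v : Dvv (fun s t => - f s t) u v = - Dvv f u v.
Proof.
  unfold Dvv, Dv. rewrite <- Derive_opp. apply Derive_ext. intros t.
  apply Derive_opp.
Qed.

Lemma class_pde_divergence c lam u v :
  class_pde c lam u v <->
  Duu (fun s t => class_Q c (lam s t)) u v + Dvv (fun s t => class_P c (lam s t)) u v
  = class_R c (lam u v).
Proof.
  destruct c; simpl; unfold Lap, Lap_bar, Lap_star, Lap_bar_star;
    rewrite ?Dvv_opp; tauto.
Qed.

(** With x = sqrt E and y = sqrt G as functions of nu = nu(lambda), the natural PDE
    is the Gauss equation (y_u / x)_u + (x_v / y)_v = f g x y. It becomes the class
    PDE when the derivatives of y and x in lambda, divided by x and by y, are
    kappa Q' and kappa P', and when f g x y = kappa R. The derivatives of x and y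
    are already replaced by their expressions from [line_elements]. *)
Definition pde_reduction (c : basic_class) (X : R -> Prop) (f g Xc Yc : R -> R)
  : Prop :=
  exists kappa, kappa <> 0 /\
  forall lam, class_admissible c lam -> X (class_subst c lam) ->
    exists qd pd,
      is_derive (class_Q c) lam qd /\ is_derive (class_P c) lam pd /\
      let t := class_subst c lam in
      let m := Derive (class_subst c) lam in
      Derive g t / (f t - g t) * m * Yc t = kappa * qd * Xc t /\
      - (Derive f t / (f t - g t)) * m * Xc t = kappa * pd * Yc t /\
      f t * g t * Xc t * Yc t = kappa * class_R c lam.

Definition class_subst_smooth (c : basic_class) : Prop :=
  open (class_admissible c) /\ smooth1 (class_admissible c) (class_subst c).

Lemma Du_comp D F h u v l :
  smooth2 D h -> D u v -> is_derive F (h u v) l ->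
  Du (fun s t => F (h s t)) u v = l * Du h u v.
Proof.
  intros Hh H HF. apply is_derive_unique.
  rewrite Rmult_comm. apply (is_derive_comp F (fun t => h t v)); auto.
  now apply smooth2_is_derive_u with D.
Qed.

Lemma Dv_comp D F h u v l :
  smooth2 D h -> D u v -> is_derive F (h u v) l ->
  Dv (fun s t => F (h s t)) u v = l * Dv h u v.
Proof.
  intros Hh H HF. apply is_derive_unique.
  rewrite Rmult_comm. apply (is_derive_comp F (fun t => h u t)); auto.
  now apply smooth2_is_derive_v with D.
Qed.

Lemma is_derive_exp x : is_derive exp x (exp x).
Proof. apply is_derive_Reals, derivable_pt_lim_exp. Qed.

Lemma smooth2_exp D f : open2 D -> smooth2 D f -> smooth2 D (fun u v => exp (f u v)).
Proof.
  intros HD Hf. apply smooth2_comp with (fun _ => True); auto.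
  - apply open_true.
  - apply smooth1_exp.
Qed.

(** The constants are chosen so that sqrt E = |Xc| and sqrt G = |Yc|. Then
    kappa Q(lambda)_u is, up to a constant factor, exp (I - J) J_u, which is
    differentiated once more in u; likewise for P in v. *)
Lemma natural_pde_class_pde c X f g nu0 Xc Yc :
  class_subst_smooth c -> Weingarten_functions X f g -> X nu0 ->
  line_elements X f g Xc Yc -> pde_reduction c X f g Xc Yc ->
  forall (D0 : region) (lam : R -> R -> R),
    open2 D0 -> smooth2 D0 lam ->
    (forall u v, D0 u v ->
       class_admissible c (lam u v) /\ X (class_subst c (lam u v))) ->
    forall u v, D0 u v ->
      (natural_pde f g nu0 (/ Rabs (Xc nu0)) (/ Rabs (Yc nu0))
         (fun s t => class_subst c (lam s t)) u v
       <-> class_pde c lam u v).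
Proof.
  intros [Ho Hs] W H0 HL [k [Hk Hred]] D lam HD Hlam Hdom u v H.
  set (nu := fun s t => class_subst c (lam s t)).
  assert (W' := Weingarten_swap X f g W).
  assert (Snu : smooth2 D nu).
  { apply smooth2_comp with (class_admissible c); auto. apply Hdom. }
  set (I := fun s t => Iint f g nu0 (nu s t)).
  set (J := fun s t => Jint f g nu0 (nu s t)).
  assert (SI : smooth2 D I).
  { apply smooth2_comp with X; auto.
    - apply (W_open X f g W).
    - now apply smooth1_Iint.
    - apply Hdom. }
  assert (SJ : smooth2 D J).
  { apply (smooth2_comp D X (Iint g f nu0) nu); auto.
    - apply (W_open X f g W).
    - now apply smooth1_Iint.
    - apply Hdom. }
  set (sX := Xc nu0). set (sY := Yc nu0).
  destruct (HL nu0 H0) as (HsX & HsY & _). fold sX in HsX. fold sY in HsY.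
  assert (EX : forall x y, D x y -> Xc (nu x y) = sX * exp (- I x y)).
  { intros x y Hxy. unfold I.
    rewrite (exp_Iint X f g nu0 Xc); auto.
    - fold sX. field. auto.
    - apply HL.
    - intros s Hx. now apply HL.
    - now apply Hdom. }
  assert (EY : forall x y, D x y -> Yc (nu x y) = sY * exp (- J x y)).
  { intros x y Hxy. unfold J. change (Jint f g nu0) with (Iint g f nu0).
    rewrite (exp_Iint X g f nu0 Yc); auto.
    - fold sY. field. auto.
    - apply HL.
    - intros s Hx. now apply HL.
    - now apply Hdom. }
  assert (Dsub : forall x y, D x y ->
     is_derive (class_subst c) (lam x y) (Derive (class_subst c) (lam x y))).
  { intros x y Hxy. apply smooth1_is_derive with (class_admissible c); auto.
    now apply Hdom. }
  assert (Qu : forall x y, D x y ->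
    Du (fun s t => class_Q c (lam s t)) x y
    = - / k * (sY / sX) * (exp (I x y - J x y) * Du J x y)).
  { intros x y Hxy. destruct (Hdom x y Hxy) as [Ha HXn].
    destruct (Hred (lam x y) Ha HXn) as (qd & pd & Hq & _ & E1 & _ & _).
    rewrite (Du_comp D _ lam x y qd); auto.
    unfold J at 2.
    rewrite (Du_comp D (Jint f g nu0) nu x y _ Snu Hxy
      (is_derive_Iint X g f nu0 (nu x y) W' H0 HXn)).
    change (Du nu x y) with (Du (fun s t => class_subst c (lam s t)) x y).
    rewrite (Du_comp D _ lam x y _ Hlam Hxy (Dsub x y Hxy)).
    fold (nu x y) in E1. cbv zeta in E1.
    rewrite (EX x y Hxy), (EY x y Hxy) in E1.
    replace (exp (I x y - J x y)) with (exp (- J x y) / exp (- I x y)).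
    2: { unfold Rminus. rewrite exp_plus, !exp_Ropp. field.
         split; apply Rgt_not_eq, exp_pos. }
    assert (He : exp (- I x y) <> 0) by apply Rgt_not_eq, exp_pos.
    assert (Hfg := W_neq X f g W _ HXn). fold (nu x y) in Hfg.
    assert (Hgf : g (nu x y) - f (nu x y) <> 0) by lra.
    apply (Rmult_eq_reg_l (k * (sX * exp (- I x y)))).
    2: { repeat apply prod_neq_0; auto. }
    transitivity (k * qd * (sX * exp (- I x y)) * Du lam x y); [ring|].
    rewrite <- E1. field. repeat split; auto. }
  assert (Pv : forall x y, D x y ->
    Dv (fun s t => class_P c (lam s t)) x y
    = - / k * (sX / sY) * (exp (J x y - I x y) * Dv I x y)).
  { intros x y Hxy. destruct (Hdom x y Hxy) as [Ha HXn].
    destruct (Hred (lam x y) Ha HXn) as (qd & pd & _ & Hp & _ & E1 & _).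
    rewrite (Dv_comp D _ lam x y pd); auto.
    unfold I at 2.
    rewrite (Dv_comp D (Iint f g nu0) nu x y _ Snu Hxy
      (is_derive_Iint X f g nu0 (nu x y) W H0 HXn)).
    change (Dv nu x y) with (Dv (fun s t => class_subst c (lam s t)) x y).
    rewrite (Dv_comp D _ lam x y _ Hlam Hxy (Dsub x y Hxy)).
    fold (nu x y) in E1. cbv zeta in E1.
    rewrite (EX x y Hxy), (EY x y Hxy) in E1.
    replace (exp (J x y - I x y)) with (exp (- I x y) / exp (- J x y)).
    2: { unfold Rminus. rewrite exp_plus, !exp_Ropp. field.
         split; apply Rgt_not_eq, exp_pos. }
    assert (He : exp (- J x y) <> 0) by apply Rgt_not_eq, exp_pos.
    assert (Hfg := W_neq X f g W _ HXn). fold (nu x y) in Hfg.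
    apply (Rmult_eq_reg_l (k * (sY * exp (- J x y)))).
    2: { repeat apply prod_neq_0; auto. }
    transitivity (k * pd * (sY * exp (- J x y)) * Dv lam x y); [ring|].
    rewrite <- E1. field. repeat split; auto. }
  assert (Quu : Duu (fun s t => class_Q c (lam s t)) u v
    = - / k * (sY / sX) * exp (I u v - J u v)
      * (Duu J u v + Du I u v * Du J u v - Du J u v ^ 2)).
  { unfold Duu at 1.
    rewrite (Du_ext D _ (fun x y => - / k * (sY / sX) *
       (exp (I x y - J x y) * Du J x y))); auto.
    rewrite Du_scal, (Du_mult D); auto using smooth2_exp, smooth2_minus, smooth2_Du.
    rewrite (Du_comp D exp (fun x y => I x y - J x y) u v (exp (I u v - J u v)));
      auto using smooth2_minus, is_derive_exp.
    rewrite (Du_minus D); auto. unfold Duu. ring. }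
  assert (Pvv : Dvv (fun s t => class_P c (lam s t)) u v
    = - / k * (sX / sY) * exp (J u v - I u v)
      * (Dvv I u v + Dv I u v * Dv J u v - Dv I u v ^ 2)).
  { unfold Dvv at 1.
    rewrite (Dv_ext D _ (fun x y => - / k * (sX / sY) *
       (exp (J x y - I x y) * Dv I x y))); auto.
    rewrite Dv_scal, (Dv_mult D); auto using smooth2_exp, smooth2_minus, smooth2_Dv.
    rewrite (Dv_comp D exp (fun x y => J x y - I x y) u v (exp (J u v - I u v)));
      auto using smooth2_minus, is_derive_exp.
    rewrite (Dv_minus D); auto. unfold Dvv. ring. }
  rewrite class_pde_divergence, Quu, Pvv.
  destruct (Hdom u v H) as [Ha HXn].
  destruct (Hred (lam u v) Ha HXn) as (_ & _ & _ & _ & _ & _ & E3).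
  cbv zeta in E3. fold (nu u v) in E3. rewrite (EX u v H), (EY u v H) in E3.
  set (A := Duu J u v + Du I u v * Du J u v - Du J u v ^ 2).
  set (B := Dvv I u v + Dv I u v * Dv J u v - Dv I u v ^ 2).
  set (R0 := class_R c (lam u v)) in *.
  change (natural_pde f g nu0 (/ Rabs sX) (/ Rabs sY) nu u v) with
    ((/ Rabs sX) ^ 2 * exp (2 * I u v) * A + (/ Rabs sY) ^ 2 * exp (2 * J u v) * B
     = - (f (nu u v) * g (nu u v))).
  assert (Hi : exp (I u v) <> 0) by apply Rgt_not_eq, exp_pos.
  assert (Hj : exp (J u v) <> 0) by apply Rgt_not_eq, exp_pos.
  replace (exp (2 * I u v)) with (exp (I u v) * exp (I u v))
    by (rewrite <- exp_plus; f_equal; ring).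
  replace (exp (2 * J u v)) with (exp (J u v) * exp (J u v))
    by (rewrite <- exp_plus; f_equal; ring).
  unfold Rminus. rewrite !exp_plus, !exp_Ropp. rewrite !exp_Ropp in E3.
  assert (Hx2 : (/ Rabs sX) ^ 2 = / (sX * sX)).
  { rewrite pow_inv. rewrite pow2_abs. f_equal. ring.
    all: now apply Rabs_no_R0. }
  assert (Hy2 : (/ Rabs sY) ^ 2 = / (sY * sY)).
  { rewrite pow_inv. rewrite pow2_abs. f_equal. ring.
    all: now apply Rabs_no_R0. }
  rewrite Hx2, Hy2.
  set (i := exp (I u v)) in *. set (j := exp (J u v)) in *.
  set (N := f (nu u v) * g (nu u v)) in *.
  assert (E3' : R0 = / k * (N * sX * sY / (i * j))).
  { apply (Rmult_eq_reg_l k); auto. rewrite <- E3. field. auto. }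
  rewrite E3'.
  assert (HH : - / k * (sY / sX) * (i * / j) * A + - / k * (sX / sY) * (j * / i) * B
      - / k * (N * sX * sY / (i * j))
    = - (/ k * (sX * sY / (i * j))) *
      (/ (sX * sX) * (i * i) * A + / (sY * sY) * (j * j) * B + N)).
  { field. repeat split; auto. }
  assert (Hc : / k * (sX * sY / (i * j)) <> 0).
  { unfold Rdiv. repeat apply prod_neq_0; auto;
      apply Rinv_neq_0_compat; auto. }
  split; intros E.
  - rewrite E in HH. apply Rminus_diag_uniq. rewrite HH. ring.
  - assert (E0 : / (sX * sX) * (i * i) * A + / (sY * sY) * (j * j) * B + N = 0).
    { apply (Rmult_eq_reg_l (- (/ k * (sX * sY / (i * j))))); [|lra].
      rewrite <- HH, E. ring. }
    lra.
Qed.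

Lemma exp_double x : exp (2 * x) = exp x * exp x.
Proof. rewrite <- exp_plus. f_equal. ring. Qed.

(** The Gauss equation with E = exp (-2I) / ca^2 and G = exp (-2J) / cb^2. *)
Lemma surface_natural_pde D z l X f g nu nu0 ca cb :
  spacelike_surface D z l -> Weingarten_functions X f g -> X nu0 -> smooth2 D nu ->
  natural_principal D z l X f g nu nu0 ca cb ->
  forall u v, D u v -> natural_pde f g nu0 ca cb nu u v.
Proof.
  intros S W H0 Snu (Hca & Hcb & P & HN) u v H.
  assert (HD := surf_open D z l S).
  assert (W' := Weingarten_swap X f g W).
  set (I := fun s t => Iint f g nu0 (nu s t)).
  set (J := fun s t => Jint f g nu0 (nu s t)).
  assert (SI : smooth2 D I).
  { apply smooth2_comp with X; auto.
    - apply (W_open X f g W).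
    - now apply smooth1_Iint.
    - intros x y Hxy. apply (HN x y Hxy). }
  assert (SJ : smooth2 D J).
  { apply (smooth2_comp D X (Iint g f nu0) nu); auto.
    - apply (W_open X f g W).
    - now apply smooth1_Iint.
    - intros x y Hxy. apply (HN x y Hxy). }
  assert (HE : forall x y, D x y -> EE z x y = / ca ^ 2 * exp (-2 * I x y)).
  { intros x y Hxy. destruct (HN x y Hxy) as (_ & _ & _ & E & _).
    rewrite <- (sqrt_sqrt (EE z x y)).
    2: apply Rlt_le, (surf_metric_E D z l S x y Hxy).
    rewrite E. fold (I x y).
    replace (-2 * I x y) with (2 * - I x y) by ring. rewrite exp_double.
    field. lra. }
  assert (HG : forall x y, D x y -> GG z x y = / cb ^ 2 * exp (-2 * J x y)).
  { intros x y Hxy. destruct (HN x y Hxy) as (_ & _ & _ & _ & E).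
    rewrite <- (sqrt_sqrt (GG z x y)).
    2: apply Rlt_le, (surf_G_pos D z l x y S Hxy).
    rewrite E. fold (J x y).
    replace (-2 * J x y) with (2 * - J x y) by ring. rewrite exp_double.
    field. lra. }
  assert (Du_e : forall (c : R) (h : R -> R -> R) x y, D x y -> smooth2 D h ->
    Du (fun s t => c * exp (-2 * h s t)) x y
    = -2 * (Du h x y * (c * exp (-2 * h x y)))).
  { intros c h x y Hxy Sh. rewrite Du_scal.
    rewrite (Du_comp D exp (fun s t => -2 * h s t) x y _ (smooth2_scal D _ h HD Sh) Hxy
      (is_derive_exp _)).
    rewrite Du_scal. ring. }
  assert (Dv_e : forall (c : R) (h : R -> R -> R) x y, D x y -> smooth2 D h ->
    Dv (fun s t => c * exp (-2 * h s t)) x y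
    = -2 * (Dv h x y * (c * exp (-2 * h x y)))).
  { intros c h x y Hxy Sh. rewrite Dv_scal.
    rewrite (Dv_comp D exp (fun s t => -2 * h s t) x y _ (smooth2_scal D _ h HD Sh) Hxy
      (is_derive_exp _)).
    rewrite Dv_scal. ring. }
  assert (Eu : Du (EE z) u v = -2 * (Du I u v * EE z u v)).
  { rewrite (Du_ext D _ _ u v HD HE H), (HE u v H). now apply Du_e. }
  assert (Gu : forall x y, D x y -> Du (GG z) x y = -2 * (Du J x y * GG z x y)).
  { intros x y Hxy. rewrite (Du_ext D _ _ x y HD HG Hxy), (HG x y Hxy). now apply Du_e. }
  assert (Ev : forall x y, D x y -> Dv (EE z) x y = -2 * (Dv I x y * EE z x y)).
  { intros x y Hxy. rewrite (Dv_ext D _ _ x y HD HE Hxy), (HE x y Hxy). now apply Dv_e. }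
  assert (Gv : Dv (GG z) u v = -2 * (Dv J u v * GG z u v)).
  { rewrite (Dv_ext D _ _ u v HD HG H), (HG u v H). now apply Dv_e. }
  assert (SE := smooth2_EE D z HD (surf_smooth D z l S)).
  assert (SG := smooth2_GG D z HD (surf_smooth D z l S)).
  assert (Evv : Dvv (EE z) u v
    = -2 * (Dvv I u v * EE z u v + Dv I u v * (-2 * (Dv I u v * EE z u v)))).
  { unfold Dvv. rewrite (Dv_ext D (Dv (EE z)) _ u v HD Ev H).
    rewrite Dv_scal, (Dv_mult D), Ev; auto using smooth2_Dv. }
  assert (Guu : Duu (GG z) u v
    = -2 * (Duu J u v * GG z u v + Du J u v * (-2 * (Du J u v * GG z u v)))).
  { unfold Duu. rewrite (Du_ext D (Du (GG z)) _ u v HD Gu H).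
    rewrite Du_scal, (Du_mult D), Gu; auto using smooth2_Du. }
  assert (Ga := gauss_equation D z l u v S P H).
  rewrite Evv, Guu, Eu, Gv, (Ev u v H), (Gu u v H) in Ga.
  destruct (HN u v H) as (_ & N1 & N2 & _).
  rewrite N1, N2 in Ga.
  assert (PE := surf_metric_E D z l S u v H). assert (PG := surf_G_pos D z l u v S H).
  assert (QE : ca ^ 2 * exp (2 * I u v) = / EE z u v).
  { rewrite (HE u v H). replace (-2 * I u v) with (- (2 * I u v)) by ring.
    rewrite exp_Ropp. field. split; [apply Rgt_not_eq, exp_pos|lra]. }
  assert (QG : cb ^ 2 * exp (2 * J u v) = / GG z u v).
  { rewrite (HG u v H). replace (-2 * J u v) with (- (2 * J u v)) by ring.
    rewrite exp_Ropp. field. split; [apply Rgt_not_eq, exp_pos|lra]. }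
  change (ca ^ 2 * exp (2 * I u v) * (Duu J u v + Du I u v * Du J u v - Du J u v ^ 2)
    + cb ^ 2 * exp (2 * J u v) * (Dvv I u v + Dv I u v * Dv J u v - Dv I u v ^ 2)
    = - (f (nu u v) * g (nu u v))).
  rewrite QE, QG.
  set (e := EE z u v) in *. set (h := GG z u v) in *.
  apply (Rmult_eq_reg_l (4 * (e * h) ^ 2)).
  2: { apply Rmult_integral_contrapositive_currified; [lra|].
       apply pow_nonzero. apply Rmult_integral_contrapositive_currified; lra. }
  transitivity (4 * (e * h) * (h * (Duu J u v + Du I u v * Du J u v - Du J u v ^ 2)
     + e * (Dvv I u v + Dv I u v * Dv J u v - Dv I u v ^ 2))).
  { field. lra. }
  lra.
Qed.

(** * Parallel surfaces and changes of parameters *)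

Lemma vsmooth_reparam D P Q phi psi a :
  open P -> open Q -> smooth1 P phi -> smooth1 Q psi ->
  vsmooth D a -> (forall u v, box P Q u v -> D (phi u) (psi v)) ->
  vsmooth (box P Q) (fun u v => a (phi u) (psi v)).
Proof.
  intros HP HQ Hphi Hpsi (a1 & a2 & a3) HD. split; [|split].
  - exact (smooth2_reparam D P Q phi psi _ HP HQ Hphi Hpsi a1 HD).
  - exact (smooth2_reparam D P Q phi psi _ HP HQ Hphi Hpsi a2 HD).
  - exact (smooth2_reparam D P Q phi psi _ HP HQ Hphi Hpsi a3 HD).
Qed.

Lemma Du_reparam D P Q phi psi f u v :
  smooth1 P phi -> smooth2 D f ->
  (forall u v, box P Q u v -> D (phi u) (psi v)) -> box P Q u v ->
  Du (fun s t => f (phi s) (psi t)) u v = Derive phi u * Du f (phi u) (psi v).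
Proof.
  intros Hphi Hf HD H. apply is_derive_unique.
  apply (is_derive_comp (fun t => f t (psi v)) phi).
  - apply smooth2_is_derive_u with D; auto.
  - apply smooth1_is_derive with P; auto. apply H.
Qed.

Lemma Dv_reparam D P Q phi psi f u v :
  smooth1 Q psi -> smooth2 D f ->
  (forall u v, box P Q u v -> D (phi u) (psi v)) -> box P Q u v ->
  Dv (fun s t => f (phi s) (psi t)) u v = Derive psi v * Dv f (phi u) (psi v).
Proof.
  intros Hpsi Hf HD H. apply is_derive_unique.
  apply (is_derive_comp (fun t => f (phi u) t) psi).
  - apply smooth2_is_derive_v with D; auto.
  - apply smooth1_is_derive with Q; auto. apply H.
Qed.

Lemma vDu_reparam D P Q phi psi a u v :
  smooth1 P phi -> vsmooth D a ->
  (forall u v, box P Q u v -> D (phi u) (psi v)) -> box P Q u v ->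
  vDu (fun s t => a (phi s) (psi t)) u v
  = vscal (Derive phi u) (vDu a (phi u) (psi v)).
Proof.
  intros Hphi (a1 & a2 & a3) HD H. apply vec_eq.
  - exact (Du_reparam D P Q phi psi _ u v Hphi a1 HD H).
  - exact (Du_reparam D P Q phi psi _ u v Hphi a2 HD H).
  - exact (Du_reparam D P Q phi psi _ u v Hphi a3 HD H).
Qed.

Lemma vDv_reparam D P Q phi psi a u v :
  smooth1 Q psi -> vsmooth D a ->
  (forall u v, box P Q u v -> D (phi u) (psi v)) -> box P Q u v ->
  vDv (fun s t => a (phi s) (psi t)) u v
  = vscal (Derive psi v) (vDv a (phi u) (psi v)).
Proof.
  intros Hpsi (a1 & a2 & a3) HD H. apply vec_eq.
  - exact (Dv_reparam D P Q phi psi _ u v Hpsi a1 HD H).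
  - exact (Dv_reparam D P Q phi psi _ u v Hpsi a2 HD H).
  - exact (Dv_reparam D P Q phi psi _ u v Hpsi a3 HD H).
Qed.

(** By the Weingarten equations the tangent vectors of k (z + a l) are
    k (1 - a nu1) z_u and k (1 - a nu2) z_v, and a change of each parameter
    multiplies them by phi' and psi'. With a = 0 and k = tau = 1 the lemma is about
    the given surface in new parameters. *)
Lemma transformed_surface D z l P Q phi psi a k tau w n :
  spacelike_surface D z l -> principal_parameters D z l ->
  open P -> open Q ->
  regular_curve_parameter P phi -> regular_curve_parameter Q psi ->
  (forall u v, box P Q u v ->
     D (phi u) (psi v) /\ parallel_factor z l a (phi u) (psi v) <> 0) ->
  k <> 0 -> tau ^ 2 = 1 ->
  (forall u v, box P Q u v ->
     w u v = vscal k (vadd (z (phi u) (psi v)) (vscal a (l (phi u) (psi v))))) ->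
  (forall u v, box P Q u v -> n u v = vscal tau (l (phi u) (psi v))) ->
  spacelike_surface (box P Q) w n /\ principal_parameters (box P Q) w n /\
  forall u v, box P Q u v ->
    let x := phi u in let y := psi v in
    EE w u v = (k * Derive phi u * (1 - a * nu1 z l x y)) ^ 2 * EE z x y /\
    GG w u v = (k * Derive psi v * (1 - a * nu2 z l x y)) ^ 2 * GG z x y /\
    nu1 w n u v = tau * nu1 z l x y / (k * (1 - a * nu1 z l x y)) /\
    nu2 w n u v = tau * nu2 z l x y / (k * (1 - a * nu2 z l x y)).
Proof.
  intros S Pr HP HQ [Sphi Nphi] [Spsi Npsi] HD' Hk Htau Ew En.
  assert (HD : forall u v, box P Q u v -> D (phi u) (psi v)) by (intros; now apply HD').
  assert (HB := open2_box P Q HP HQ).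
  assert (HO := surf_open D z l S). assert (Hz := surf_smooth D z l S).
  assert (Hl := surf_normal_smooth D z l S).
  assert (Hzu := vsmooth_vDu D z Hz). assert (Hzv := vsmooth_vDv D z Hz).
  assert (Sn1 := smooth2_nu1 D z l S). assert (Sn2 := smooth2_nu2 D z l S).
  set (p := fun u v => k * Derive phi u * (1 - a * nu1 z l (phi u) (psi v))).
  set (q := fun u v => k * Derive psi v * (1 - a * nu2 z l (phi u) (psi v))).
  assert (Hfac : forall u v, box P Q u v ->
    1 - a * nu1 z l (phi u) (psi v) <> 0 /\ 1 - a * nu2 z l (phi u) (psi v) <> 0).
  { intros u v H. destruct (HD' u v H) as [_ Hf]. unfold parallel_factor in Hf.
    split; intros E; apply Hf; rewrite E; ring. }
  assert (Np : forall u v, box P Q u v -> p u v <> 0).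
  { intros u v H. unfold p. destruct (Hfac u v H). destruct H as [Hu Hv].
    repeat apply prod_neq_0; auto. }
  assert (Nq : forall u v, box P Q u v -> q u v <> 0).
  { intros u v H. unfold q. destruct (Hfac u v H). destruct H as [Hu Hv].
    repeat apply prod_neq_0; auto. }
  assert (Sn : vsmooth (box P Q) (fun u v => vscal tau (l (phi u) (psi v)))).
  { apply (vsmooth_scal (box P Q) (fun _ _ => tau)); auto using smooth2_const.
    now apply (vsmooth_reparam D). }
  assert (Szr := vsmooth_reparam D P Q phi psi z HP HQ Sphi Spsi Hz HD).
  assert (Slr := vsmooth_reparam D P Q phi psi l HP HQ Sphi Spsi Hl HD).
  assert (Sal : vsmooth (box P Q) (fun u v => vscal a (l (phi u) (psi v))))
    by (apply (vsmooth_scal (box P Q) (fun _ _ => a)); auto using smooth2_const).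
  assert (Ssum := vsmooth_add _ _ _ HB Szr Sal).
  assert (Sw : vsmooth (box P Q)
     (fun u v => vscal k (vadd (z (phi u) (psi v)) (vscal a (l (phi u) (psi v))))))
    by (apply (vsmooth_scal (box P Q) (fun _ _ => k)); auto using smooth2_const).
  assert (Szur := vsmooth_reparam D P Q phi psi _ HP HQ Sphi Spsi Hzu HD).
  assert (Szvr := vsmooth_reparam D P Q phi psi _ HP HQ Sphi Spsi Hzv HD).
  assert (Sdphi : smooth2 (box P Q) (fun u _ => Derive phi u)).
  { apply smooth2_subset with (cyl P).
    - intros u v H; apply H.
    - apply smooth1_cyl; auto. now apply smooth1_Derive. }
  assert (Sdpsi : smooth2 (box P Q) (fun _ v => Derive psi v)).
  { apply (smooth2_comp (box P Q) Q (Derive psi) (fun _ v => v)); auto.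
    - now apply smooth1_Derive.
    - intros m. now apply Ck_snd.
    - intros u v H; apply H. }
  assert (S1n : smooth2 (box P Q) (fun u v => nu1 z l (phi u) (psi v)))
    by now apply (smooth2_reparam D).
  assert (S2n : smooth2 (box P Q) (fun u v => nu2 z l (phi u) (psi v)))
    by now apply (smooth2_reparam D).
  assert (Sp : smooth2 (box P Q) p).
  { apply smooth2_mult; auto.
    - now apply smooth2_scal.
    - apply smooth2_minus; auto using smooth2_const. now apply smooth2_scal. }
  assert (Sq : smooth2 (box P Q) q).
  { apply smooth2_mult; auto.
    - now apply smooth2_scal.
    - apply smooth2_minus; auto using smooth2_const. now apply smooth2_scal. }
  assert (Wu : forall u v, box P Q u v ->
    vDu w u v = vscal (p u v) (vDu z (phi u) (psi v))).
  { intros u v H. rewrite (vDu_ext (box P Q) w _ u v HB Ew H).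
    rewrite (vDu_scal (box P Q) (fun _ _ => k)
      (fun s t => vadd (z (phi s) (psi t)) (vscal a (l (phi s) (psi t)))) u v);
      auto using smooth2_const.
    rewrite (vDu_add (box P Q) (fun s t => z (phi s) (psi t))
      (fun s t => vscal a (l (phi s) (psi t)))); auto.
    rewrite (vDu_scal (box P Q) (fun _ _ => a) (fun s t => l (phi s) (psi t)));
      auto using smooth2_const.
    rewrite !Du_const, (vDu_reparam D P Q phi psi z), (vDu_reparam D P Q phi psi l);
      auto.
    rewrite (proj1 (weingarten_equations D z l _ _ S Pr (HD u v H))).
    apply vec_eq; unfold p; simpl; ring. }
  assert (Wv : forall u v, box P Q u v ->
    vDv w u v = vscal (q u v) (vDv z (phi u) (psi v))).
  { intros u v H. rewrite (vDv_ext (box P Q) w _ u v HB Ew H).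
    rewrite (vDv_scal (box P Q) (fun _ _ => k)
      (fun s t => vadd (z (phi s) (psi t)) (vscal a (l (phi s) (psi t)))) u v);
      auto using smooth2_const.
    rewrite (vDv_add (box P Q) (fun s t => z (phi s) (psi t))
      (fun s t => vscal a (l (phi s) (psi t)))); auto.
    rewrite (vDv_scal (box P Q) (fun _ _ => a) (fun s t => l (phi s) (psi t)));
      auto using smooth2_const.
    rewrite !Dv_const, (vDv_reparam D P Q phi psi z), (vDv_reparam D P Q phi psi l);
      auto.
    rewrite (proj2 (weingarten_equations D z l _ _ S Pr (HD u v H))).
    apply vec_eq; unfold q; simpl; ring. }
  assert (EEw : forall u v, box P Q u v ->
    EE w u v = p u v ^ 2 * EE z (phi u) (psi v)).
  { intros u v H. unfold EE. rewrite (Wu u v H), mdot_scall, mdot_scalr. ring. }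
  assert (GGw : forall u v, box P Q u v ->
    GG w u v = q u v ^ 2 * GG z (phi u) (psi v)).
  { intros u v H. unfold GG. rewrite (Wv u v H), mdot_scall, mdot_scalr. ring. }
  assert (FFw : forall u v, box P Q u v -> FF w u v = 0).
  { intros u v H. unfold FF. rewrite (Wu u v H), (Wv u v H), mdot_scall, mdot_scalr.
    destruct (Pr _ _ (HD u v H)) as [HF _]. unfold FF in HF. rewrite HF. ring. }
  assert (PE : forall u v, box P Q u v -> 0 < EE w u v).
  { intros u v H. rewrite (EEw u v H). apply Rmult_lt_0_compat.
    - apply pow2_gt_0; auto.
    - apply (surf_metric_E D z l S); auto. }
  assert (PG : forall u v, box P Q u v -> 0 < GG w u v).
  { intros u v H. rewrite (GGw u v H). apply Rmult_lt_0_compat.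
    - apply pow2_gt_0; auto.
    - apply (surf_G_pos D z l _ _ S); auto. }
  assert (LLw : forall u v, box P Q u v ->
    LL w n u v = tau * p u v * Derive phi u * LL z l (phi u) (psi v)).
  { intros u v H. unfold LL.
    rewrite (vDu_ext (box P Q) (vDu w) _ u v HB Wu H), (En u v H).
    rewrite (vDu_scal (box P Q)), (vDu_reparam D P Q phi psi (vDu z)); auto.
    rewrite mdot_addr, !mdot_scalr, !mdot_scall, (surf_normal_u D z l S); auto. ring. }
  assert (NNw : forall u v, box P Q u v ->
    NN w n u v = tau * q u v * Derive psi v * NN z l (phi u) (psi v)).
  { intros u v H. unfold NN.
    rewrite (vDv_ext (box P Q) (vDv w) _ u v HB Wv H), (En u v H).
    rewrite (vDv_scal (box P Q)), (vDv_reparam D P Q phi psi (vDv z)); auto.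
    rewrite mdot_addr, !mdot_scalr, !mdot_scall, (surf_normal_v D z l S); auto. ring. }
  assert (MMw : forall u v, box P Q u v -> MM w n u v = 0).
  { intros u v H. unfold MM.
    rewrite (vDv_ext (box P Q) (vDu w) _ u v HB Wu H), (En u v H).
    rewrite (vDv_scal (box P Q)), (vDv_reparam D P Q phi psi (vDu z)); auto.
    rewrite mdot_addr, !mdot_scalr, !mdot_scall, (surf_normal_u D z l S); auto.
    destruct (Pr _ _ (HD u v H)) as [_ HM]. unfold MM in HM. rewrite HM. ring. }
  split; [|split].
  - constructor.
    + exact HB.
    + apply (vsmooth_ext (box P Q) _ w HB) with (2 := Sw).
      intros u v H. symmetry. now apply Ew.
    + apply (vsmooth_ext (box P Q) _ n HB) with (2 := Sn).
      intros u v H. symmetry. now apply En.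
    + exact PE.
    + intros u v H. rewrite (FFw u v H).
      assert (0 < EE w u v * GG w u v) by (apply Rmult_lt_0_compat; auto). lra.
    + intros u v H. rewrite (En u v H), mdot_scall, mdot_scalr,
        (surf_normal_unit D z l S); auto. lra.
    + intros u v H. rewrite (En u v H), (Wu u v H), mdot_scall, mdot_scalr,
        (surf_normal_u D z l S); auto. ring.
    + intros u v H. rewrite (En u v H), (Wv u v H), mdot_scall, mdot_scalr,
        (surf_normal_v D z l S); auto. ring.
  - intros u v H. split; auto.
  - intros u v H x y. destruct (Hfac u v H) as [H1 H2].
    assert (HE := surf_metric_E D z l S _ _ (HD u v H)).
    assert (HG := surf_G_pos D z l _ _ S (HD u v H)).
    assert (Hp := Np u v H). assert (Hq := Nq u v H).
    assert (D1 : Derive phi u <> 0) by apply (Nphi u (proj1 H)).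
    assert (D2 : Derive psi v <> 0) by apply (Npsi v (proj2 H)).
    split; [now apply EEw|]. split; [now apply GGw|].
    unfold nu1 at 1, nu2 at 1.
    rewrite (EEw u v H), (GGw u v H), (LLw u v H), (NNw u v H).
    unfold p, q in *. fold x y in H1, H2, HE, HG, Hp, Hq |- *.
    unfold nu1 at 1 2 3, nu2 at 1 2 3.
    unfold nu1 in H1, Hp. unfold nu2 in H2, Hq.
    split; unfold nu1, nu2; field; repeat split; try lra; auto;
      intros E; [apply H1|apply H2];
      [transitivity ((EE z x y - a * LL z l x y) / EE z x y)
      |transitivity ((GG z x y - a * NN z l x y) / GG z x y)];
      try (field; lra); rewrite E; field; lra.
Qed.

(** * The basic classes *)

(** The values of nu that occur for a basic surface with the sign conventions of
    its class. *)
Definition class_dom (c : basic_class) (t : R) : Prop :=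
  match c with
  | H_zero => t < 0
  | H_half => t < 1 / 2
  | Hdiff_one => True
  | H_prop_gt p | H_prop_lt p => 0 < t
  | H_affine_gt p | H_affine_lt p => 0 < 2 * (t - 1) / (p - 1)
  | K_minus_one | K_affine _ _ => t <> 0
  | K_twice_Hdiff => t <> 0 /\ t <> 1
  end.

Definition class_f_slope (c : basic_class) : R :=
  match c with
  | H_zero | H_half => -1
  | H_prop_gt p | H_prop_lt p | H_affine_gt p | H_affine_lt p => (p + 1) / (p - 1)
  | _ => 1
  end.

Definition class_f_const (c : basic_class) : R :=
  match c with
  | H_half => 1
  | Hdiff_one => 2
  | H_affine_gt p | H_affine_lt p => - 2 / (p - 1)
  | K_twice_Hdiff => -1
  | K_affine p q => - p / 2
  | _ => 0
  end.

(** In every class nu1 is an affine function of nu. *)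
Definition class_f (c : basic_class) (t : R) : R :=
  class_f_slope c * t + class_f_const c.

Definition class_g (c : basic_class) (t : R) : R :=
  match c with
  | K_minus_one => - / t
  | K_twice_Hdiff => 1 - / t
  | K_affine p q => p / 2 - (p ^ 2 / 4 + q) / t
  | _ => t
  end.

Definition class_dg (c : basic_class) (t : R) : R :=
  match c with
  | K_minus_one | K_twice_Hdiff => / t ^ 2
  | K_affine p q => (p ^ 2 / 4 + q) / t ^ 2
  | _ => 1
  end.

(** A right inverse of the substitution nu = nu(lambda). *)
Definition class_lam (c : basic_class) (t : R) : R :=
  match c with
  | H_zero => ln (- t)
  | H_half => ln (1 - 2 * t)
  | Hdiff_one | H_prop_gt _ | H_prop_lt _ => t
  | H_affine_gt p | H_affine_lt p => 2 * (t - 1) / (p - 1)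
  | K_minus_one => 2 * atan t
  | K_twice_Hdiff => (2 * t - 4) / (t - 1)
  | K_affine p q => t - p / 2
  end.

(** The function called I in the PDE of the last class. *)
Definition atan_scaled (q x : R) : R := / sqrt q * atan (x / sqrt q).

(** Solutions x and y of x' / x = - f' / (f - g) and y' / y = - g' / (g - f): they
    are sqrt E and sqrt G up to sign. The constant factors are those for which the
    Gauss equation takes the normalized form of the list. *)
Definition class_rootE (c : basic_class) (t : R) : R :=
  match c with
  | H_zero => exp (- ln (- (2 * t)) / 2)
  | H_half => exp (- ln (1 - 2 * t) / 2)
  | Hdiff_one => exp (- t / 2)
  | H_prop_gt p | H_prop_lt p => exp (- ((p + 1) / 2) * ln t)
  | H_affine_gt p | H_affine_lt p =>
      exp (- ((p + 1) / 2) * ln (2 * (t - 1) / (p - 1)))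
  | K_minus_one => exp (- ln (1 + t ^ 2) / 2)
  | K_twice_Hdiff => exp (- ((2 * t - 4) / (t - 1)) / 2) / (t - 1)
  | K_affine p q =>
      sqrt q * sqrt (p ^ 2 / 4 + q) *
      (exp (- ln ((t - p / 2) ^ 2 + q) / 2) * exp (- (p / 2) * atan_scaled q (t - p / 2)))
  end.

Definition class_rootG (c : basic_class) (t : R) : R :=
  match c with
  | H_zero => exp (- ln (- (2 * t)) / 2)
  | H_half => exp (- ln (1 - 2 * t) / 2)
  | Hdiff_one => exp (t / 2)
  | H_prop_gt p => sqrt ((p + 1) / (p - 1)) * exp ((p - 1) / 2 * ln t)
  | H_prop_lt p => sqrt ((p + 1) / (1 - p)) * exp ((p - 1) / 2 * ln t)
  | H_affine_gt p =>
      sqrt ((p + 1) / (p - 1)) * exp ((p - 1) / 2 * ln (2 * (t - 1) / (p - 1)))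
  | H_affine_lt p =>
      sqrt ((p + 1) / (1 - p)) * exp ((p - 1) / 2 * ln (2 * (t - 1) / (p - 1)))
  | K_minus_one => t * exp (- ln (1 + t ^ 2) / 2)
  | K_twice_Hdiff => exp ((2 * t - 4) / (t - 1) / 2) * (t / (t - 1))
  | K_affine p q =>
      sqrt q * t *
      (exp (- ln ((t - p / 2) ^ 2 + q) / 2) * exp (p / 2 * atan_scaled q (t - p / 2)))
  end.

Lemma sq_gt_1_neq p : 1 < p ^ 2 -> p - 1 <> 0 /\ p + 1 <> 0 /\ p <> 0.
Proof. intros H. repeat split; intros E; nra. Qed.

Lemma sq_lt_1_neq p : p ^ 2 < 1 -> p - 1 < 0 /\ 0 < p + 1.
Proof. intros H. split; nra. Qed.

Lemma sq_gt_1_ratio p : 1 < p ^ 2 -> 0 < (p + 1) / (p - 1).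
Proof.
  intros H. destruct (sq_gt_1_neq p H) as (H1 & _).
  replace ((p + 1) / (p - 1)) with ((p ^ 2 - 1) / (p - 1) ^ 2) by (field; auto).
  apply Rdiv_lt_0_compat; [lra|]. now apply pow2_gt_0.
Qed.

Lemma sq_lt_1_ratio p : p ^ 2 < 1 -> 0 < (p + 1) / (1 - p).
Proof.
  intros H. destruct (sq_lt_1_neq p H). apply Rdiv_lt_0_compat; lra.
Qed.

Lemma valid_class_p c : valid_class c ->
  match c with
  | H_prop_gt p | H_affine_gt p => p - 1 <> 0 /\ p + 1 <> 0 /\ p <> 0 /\ 0 < (p + 1) / (p - 1)
  | H_prop_lt p | H_affine_lt p => p - 1 <> 0 /\ p + 1 <> 0 /\ p <> 0 /\ 0 < (p + 1) / (1 - p)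
  | K_affine p q => p <> 0 /\ 0 < q /\ 0 < p ^ 2 / 4 + q
  | _ => True
  end.
Proof.
  destruct c; simpl; auto; intros H.
  - generalize (sq_gt_1_neq p H) (sq_gt_1_ratio p H); tauto.
  - destruct H as [H H']. generalize (sq_lt_1_neq p H) (sq_lt_1_ratio p H).
    intros [? ?]; repeat split; lra.
  - generalize (sq_gt_1_neq p H) (sq_gt_1_ratio p H); tauto.
  - destruct H as [H H']. generalize (sq_lt_1_neq p H) (sq_lt_1_ratio p H).
    intros [? ?]; repeat split; lra.
  - destruct H as [H H']. generalize (pow2_ge_0 p). repeat split; auto. lra.
Qed.

Lemma open_and_R (A B : R -> Prop) : open A -> open B -> open (fun t : R => A t /\ B t).
Proof. exact (open_and A B). Qed.

Lemma open_preimage (f : R -> R) (A : R -> Prop) :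
  continuity f -> open A -> open (fun t => A (f t)).
Proof.
  intros Hf HA. apply (open_comp f A); auto.
  intros t _. exact (proj1 (continuity_pt_filterlim f t) (Hf t)).
Qed.

Lemma open_affine_pos a b : open (fun t : R => 0 < a * t + b).
Proof.
  apply (open_preimage (fun t => a * t + b) (fun s => 0 < s)); [reg|exact open_pos].
Qed.

Lemma open_neq_R a : open (fun t : R => t <> a).
Proof. exact (open_neq a). Qed.

Lemma open_ext_R (A B : R -> Prop) : (forall t, A t <-> B t) -> open A -> open B.
Proof. exact (open_ext A B). Qed.

Lemma open_affine_dom p : open (fun t => 0 < 2 * (t - 1) / (p - 1)).
Proof.
  apply open_ext_R with (2 := open_affine_pos (2 / (p - 1)) (- 2 / (p - 1))).
  intros t. replace (2 * (t - 1) / (p - 1)) with (2 / (p - 1) * t + - 2 / (p - 1));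
    [reflexivity|]. unfold Rdiv. ring.
Qed.

Lemma class_dom_open c : open (class_dom c).
Proof.
  destruct c; simpl.
  - exact (open_lt 0).
  - exact (open_lt (1 / 2)).
  - exact open_true.
  - exact open_pos.
  - exact open_pos.
  - exact (open_affine_dom p).
  - exact (open_affine_dom p).
  - exact (open_neq_R 0).
  - apply open_and_R; apply open_neq_R.
  - exact (open_neq_R 0).
Qed.

Lemma smooth1_affine X a b : open X -> smooth1 X (fun t => a * t + b).
Proof.
  intros HX. apply smooth1_plus; auto using smooth1_const.
  apply smooth1_mult; auto using smooth1_const, smooth1_id.
Qed.

Lemma smooth1_affine_inv (X : R -> Prop) a b :
  open X -> (forall t, X t -> t <> 0) -> smooth1 X (fun t => a + b * / t).
Proof.
  intros HX H0. apply smooth1_plus; auto using smooth1_const.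
  apply smooth1_mult; auto using smooth1_const.
  apply smooth1_inv; auto using smooth1_id.
Qed.

Lemma class_f_smooth c : smooth1 (class_dom c) (class_f c).
Proof. apply smooth1_affine, class_dom_open. Qed.

Lemma class_g_smooth c : smooth1 (class_dom c) (class_g c).
Proof.
  assert (HO := class_dom_open c).
  destruct c; try (exact (smooth1_id _ HO)).
  - apply smooth1_ext with (fun t => 0 + -1 * / t); auto.
    { intros; simpl; ring. }
    apply smooth1_affine_inv; auto.
  - apply smooth1_ext with (fun t => 1 + -1 * / t); auto.
    { intros; simpl; ring. }
    apply smooth1_affine_inv; auto. intros t Ht. apply Ht.
  - apply smooth1_ext with (fun t => p / 2 + - (p ^ 2 / 4 + q) * / t); auto.
    { intros; simpl; unfold Rdiv; ring. }
    apply smooth1_affine_inv; auto.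
Qed.

Lemma class_f_derive c t : Derive (class_f c) t = class_f_slope c.
Proof.
  apply is_derive_unique. unfold class_f. auto_derive; auto. ring.
Qed.

Lemma class_g_derive c t : class_dom c t -> Derive (class_g c) t = class_dg c t.
Proof.
  intros Ht. apply is_derive_unique.
  destruct c; unfold class_g, class_dg; simpl in Ht;
    try (apply (is_derive_id t)).
  - auto_derive; auto. field. auto.
  - auto_derive; [tauto|]. field. tauto.
  - auto_derive; auto. field. auto.
Qed.

(** The points with f = g would be umbilical. *)
Lemma class_fg_neq c t : valid_class c -> class_dom c t -> class_f c t - class_g c t <> 0.
Proof.
  intros Hv Ht. apply valid_class_p in Hv.
  destruct c; unfold class_f, class_g; simpl in *.
  - lra.
  - lra.
  - lra.
  - replace (_ - _) with (2 * t / (p - 1)) by (field; tauto).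
    apply div_neq_0; [lra|tauto].
  - replace (_ - _) with (2 * t / (p - 1)) by (field; tauto).
    apply div_neq_0; [lra|tauto].
  - replace (_ - _) with (2 * (t - 1) / (p - 1)) by (field; tauto). lra.
  - replace (_ - _) with (2 * (t - 1) / (p - 1)) by (field; tauto). lra.
  - replace (_ - _) with ((t ^ 2 + 1) / t) by (field; auto).
    apply div_neq_0; [nra|auto].
  - replace (_ - _) with ((t - 1) ^ 2 / t) by (field; tauto).
    apply div_neq_0.
    + apply pow_nonzero. lra.
    + tauto.
  - replace (_ - _) with (((t - p / 2) ^ 2 + q) / t) by (field; auto).
    apply div_neq_0.
    + generalize (pow2_ge_0 (t - p / 2)). lra.
    + tauto.
Qed.

Lemma class_fg_derive_neq c t : valid_class c -> class_dom c t ->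
  Derive (class_f c) t <> 0 /\ Derive (class_g c) t <> 0.
Proof.
  intros Hv Ht. rewrite class_f_derive, class_g_derive; auto.
  apply valid_class_p in Hv.
  destruct c; simpl class_dom in Ht; unfold class_f_slope, class_dg;
    (split; [try lra; apply div_neq_0; tauto|]); try lra.
  - apply Rinv_neq_0_compat, pow_nonzero; auto.
  - apply Rinv_neq_0_compat, pow_nonzero; tauto.
  - apply div_neq_0; [lra|]. apply pow_nonzero; auto.
Qed.

Lemma class_lam_spec c t : valid_class c -> class_dom c t ->
  class_admissible c (class_lam c t) /\ class_subst c (class_lam c t) = t.
Proof.
  intros Hv Ht. apply valid_class_p in Hv.
  destruct c; simpl in *; split; auto.
  - rewrite exp_ln; lra.
  - rewrite exp_ln; lra.
  - field; tauto.
  - field; tauto.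
  - replace (2 * atan t / 2) with (atan t) by field.
    apply Rgt_not_eq. destruct (atan_bound t).
    apply cos_gt_0; lra.
  - replace (2 * atan t / 2) with (atan t) by field. apply tan_atan.
  - intros E. assert (2 * t - 4 = 2 * (t - 1)); [|lra].
    rewrite <- E at 2. field. lra.
  - field. split; lra.
  - ring.
Qed.

Lemma class_lam_smooth c : valid_class c -> smooth1 (class_dom c) (class_lam c).
Proof.
  intros Hv. assert (HO := class_dom_open c).
  destruct c; try (exact (smooth1_id _ HO)).
  - apply (smooth1_comp _ (fun t => 0 < t) ln (fun t => - t)); auto using open_pos, smooth1_ln.
    + apply smooth1_ext with (fun t => -1 * t + 0); auto using smooth1_affine.
      intros; ring.
    + simpl; intros; lra.
  - apply (smooth1_comp _ (fun t => 0 < t) ln (fun t => 1 - 2 * t)); auto using open_pos, smooth1_ln.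
    + apply smooth1_ext with (fun t => -2 * t + 1); auto using smooth1_affine.
      intros; ring.
    + simpl; intros; lra.
  - apply smooth1_ext with (fun t => 2 / (p - 1) * t + - 2 / (p - 1));
      auto using smooth1_affine.
    intros; simpl; unfold Rdiv; ring.
  - apply smooth1_ext with (fun t => 2 / (p - 1) * t + - 2 / (p - 1));
      auto using smooth1_affine.
    intros; simpl; unfold Rdiv; ring.
  - apply smooth1_mult; auto using smooth1_const.
    apply smooth1_subset with (fun _ => True); auto using smooth1_atan.
  - apply smooth1_mult; auto.
    + apply smooth1_ext with (fun t => 2 * t + (-4)); auto using smooth1_affine.
    + apply smooth1_inv; auto.
      * apply smooth1_ext with (fun t => 1 * t + (-1)); auto using smooth1_affine.
        intros; ring.
      * simpl; intros; lra.
  - apply smooth1_ext with (fun t => 1 * t + - p / 2); auto using smooth1_affine.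
    intros; simpl; field.
Qed.

Definition class_dsubst (c : basic_class) (x : R) : R :=
  match c with
  | H_zero => - exp x
  | H_half => - exp x / 2
  | Hdiff_one | H_prop_gt _ | H_prop_lt _ | K_affine _ _ => 1
  | H_affine_gt p | H_affine_lt p => (p - 1) / 2
  | K_minus_one => (1 + tan (x / 2) ^ 2) / 2
  | K_twice_Hdiff => 2 / (x - 2) ^ 2
  end.

Lemma class_subst_is_derive c x : class_admissible c x ->
  is_derive (class_subst c) x (class_dsubst c x).
Proof.
  intros Hx. destruct c; unfold class_subst, class_dsubst; simpl in Hx;
    try (apply (is_derive_id x)).
  - auto_derive; auto. ring.
  - auto_derive; auto. field.
  - auto_derive; auto. field.
  - auto_derive; auto. field.
  - evar_last.
    + apply (is_derive_comp tan (fun x => x / 2)).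
      * apply is_derive_tan. exact Hx.
      * auto_derive; auto.
    + unfold scal; simpl; unfold mult; simpl. field.
  - auto_derive; [lra|]. field. lra.
  - auto_derive; auto.
Qed.

Lemma class_admissible_open c : open (class_admissible c).
Proof.
  destruct c; simpl; try exact open_pos; try exact open_true.
  - apply (open_preimage (fun t => cos (t / 2)) (fun s => s <> 0)); [|exact open_neq0].
    apply derivable_continuous. reg.
  - exact (open_neq_R 2).
Qed.

Lemma class_subst_is_smooth c : class_subst_smooth c.
Proof.
  assert (HO := class_admissible_open c). split; [exact HO|].
  destruct c; try (exact (smooth1_id _ HO)).
  - apply smooth1_ext with (fun x => -1 * exp x); auto. { intros; simpl; ring. }
    apply smooth1_mult; auto using smooth1_const.
    apply smooth1_subset with (fun _ => True); auto using smooth1_exp.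
  - apply smooth1_ext with (fun x => 1 / 2 + -1 / 2 * exp x); auto.
    { intros; simpl; field. }
    apply smooth1_plus; auto using smooth1_const.
    apply smooth1_mult; auto using smooth1_const.
    apply smooth1_subset with (fun _ => True); auto using smooth1_exp.
  - apply smooth1_ext with (fun x => (p - 1) / 2 * x + 1); auto using smooth1_affine.
    intros; simpl; field.
  - apply smooth1_ext with (fun x => (p - 1) / 2 * x + 1); auto using smooth1_affine.
    intros; simpl; field.
  - apply smooth1_ode with (Y := fun _ => True) (k := fun y => 1 / 2 * (y * y) + 1 / 2);
      auto using open_true.
    + apply smooth1_plus; auto using open_true, smooth1_const.
      apply smooth1_mult; auto using open_true, smooth1_const.
      apply smooth1_mult; auto using open_true, smooth1_id.
    + intros x Hx. evar_last; [now apply class_subst_is_derive|]. simpl. field.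
  - apply smooth1_mult; auto.
    + apply smooth1_ext with (fun t => 1 * t + (-4)); auto using smooth1_affine.
      intros; ring.
    + apply smooth1_inv; auto.
      * apply smooth1_ext with (fun t => 1 * t + (-2)); auto using smooth1_affine.
        intros; ring.
      * simpl; intros; lra.
  - apply smooth1_ext with (fun t => 1 * t + p / 2); auto using smooth1_affine.
    intros; simpl; field.
Qed.

Lemma atan_scaled_derive q x : 0 < q -> is_derive (atan_scaled q) x (/ (x ^ 2 + q)).
Proof.
  intros Hq. assert (Hs : 0 < sqrt q) by now apply sqrt_lt_R0.
  assert (E := sqrt_sqrt q (Rlt_le _ _ Hq)).
  unfold atan_scaled. evar_last.
  - apply (is_derive_scal (fun x => atan (x / sqrt q))).
    apply (is_derive_comp atan (fun x => x / sqrt q)).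
    + apply is_derive_atan.
    + auto_derive; auto.
  - unfold scal, mult; simpl. unfold mult; simpl. unfold Rsqr.
    replace (x * (x * 1) + q) with (x * x + sqrt q * sqrt q) by (rewrite E; ring).
    field. split; nra.
Qed.

Lemma exp_neq_0 x : exp x <> 0.
Proof. apply Rgt_not_eq, exp_pos. Qed.

Lemma sqrt_neq_0 x : 0 < x -> sqrt x <> 0.
Proof. intros. apply Rgt_not_eq. now apply sqrt_lt_R0. Qed.

Lemma affine_arg_neq t p : 0 < 2 * (t - 1) / (p - 1) -> t - 1 <> 0.
Proof.
  intros H E. rewrite E in H. unfold Rdiv in H. rewrite Rmult_0_r, Rmult_0_l in H. lra.
Qed.

(* [cond] proves that the logarithms are taken of positive numbers. *)
Ltac line_element_goals cond :=
  refine (conj _ (conj _ (conj _ _)));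
  [ try apply prod_neq_0; auto using exp_neq_0, sqrt_neq_0
  | try apply prod_neq_0; auto using exp_neq_0, sqrt_neq_0
  | auto_derive; [cond|]; simpl pow; unfold Rdiv, Rminus; field; repeat split; auto; nra
  | auto_derive; [cond|]; simpl pow; unfold Rdiv, Rminus; field; repeat split; auto; nra ].

Lemma class_line_elements c : valid_class c ->
  line_elements (class_dom c) (class_f c) (class_g c) (class_rootE c) (class_rootG c).
Proof.
  intros Hv t Ht. assert (Hn := class_fg_neq c t Hv Ht).
  rewrite class_f_derive, class_g_derive; auto.
  apply valid_class_p in Hv.
  assert (Hn' : class_g c t - class_f c t <> 0) by lra.
  destruct c; simpl in Hv, Ht;
    cbv beta iota zeta delta
      [class_rootE class_rootG class_dg class_f_slope class_f_const class_f class_g] in *.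
  - line_element_goals ltac:(lra).
  - line_element_goals ltac:(lra).
  - line_element_goals ltac:(auto).
  - destruct Hv as (p1 & p2 & p3 & p4). line_element_goals ltac:(auto).
  - destruct Hv as (p1 & p2 & p3 & p4). line_element_goals ltac:(auto).
  - destruct Hv as (p1 & p2 & p3 & p4).
    assert (t - 1 <> 0) by exact (affine_arg_neq t p Ht).
    line_element_goals ltac:(exact Ht).
  - destruct Hv as (p1 & p2 & p3 & p4).
    assert (t - 1 <> 0) by exact (affine_arg_neq t p Ht).
    line_element_goals ltac:(exact Ht).
  - assert (0 < 1 + t ^ 2) by (generalize (pow2_ge_0 t); lra).
    line_element_goals ltac:(simpl in *; lra).
  - destruct Ht as [t0 t1].
    assert (t - 1 <> 0) by lra.
    refine (conj _ (conj _ (conj _ _))).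
    + apply div_neq_0; auto using exp_neq_0.
    + apply prod_neq_0; auto using exp_neq_0, div_neq_0.
    + auto_derive; [auto|]. unfold Rdiv, Rminus. field. repeat split; auto.
      intros E. apply (prod_neq_0 (t - 1) (t - 1)); auto; lra.
    + auto_derive; [auto|]. unfold Rdiv, Rminus. field. repeat split; auto.
      intros E. apply (prod_neq_0 (t - 1) (t - 1)); auto; lra.
  - destruct Hv as (p0 & q0 & r0).
    assert (Hw : 0 < (t - p / 2) ^ 2 + q) by (generalize (pow2_ge_0 (t - p / 2)); lra).
    assert (Hd := atan_scaled_derive q (t - p / 2) q0).
    assert (Hdl : is_derive (fun t => atan_scaled q (t - p / 2)) t (/ ((t - p / 2) ^ 2 + q))).
    { evar_last.
      - apply (is_derive_comp (atan_scaled q) (fun t => t - p / 2)); [exact Hd|].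
        auto_derive; auto.
      - unfold scal; simpl; unfold mult; simpl. field. lra. }
    refine (conj _ (conj _ (conj _ _))).
    + repeat apply prod_neq_0; auto using exp_neq_0, sqrt_neq_0.
    + repeat apply prod_neq_0; auto using exp_neq_0, sqrt_neq_0.
    + set (A := fun t => atan_scaled q (t - p / 2)) in *.
      change (atan_scaled q (t - p / 2)) with (A t).
      assert (HA : is_derive A t (/ ((t - p / 2) ^ 2 + q))) by exact Hdl.
      apply is_derive_ext with (fun t => sqrt q * sqrt (p ^ 2 / 4 + q) *
        (exp (- ln ((t - p / 2) * (t - p / 2) + q) / 2) * exp (- (p / 2) * A t))).
      { intros s. now replace ((s - p / 2) * (s - p / 2)) with ((s - p / 2) ^ 2) by ring. }
      auto_derive.
      { split; [nra|]. split; [|auto]. eexists; exact HA. }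
      change (fun x => A x) with A. rewrite (is_derive_unique _ _ _ HA).
      clearbody A. unfold Rdiv, Rminus in *.
      replace ((t + - (p * / 2)) ^ 2) with ((t + - (p * / 2)) * (t + - (p * / 2))) in * by ring.
      change (p ^ 2) with (p * (p * 1)). field. repeat split; auto; nra.
    + set (A := fun t => atan_scaled q (t - p / 2)) in *.
      change (atan_scaled q (t - p / 2)) with (A t).
      assert (HA : is_derive A t (/ ((t - p / 2) ^ 2 + q))) by exact Hdl.
      apply is_derive_ext with (fun t => sqrt q * t *
        (exp (- ln ((t - p / 2) * (t - p / 2) + q) / 2) * exp (p / 2 * A t))).
      { intros s. now replace ((s - p / 2) * (s - p / 2)) with ((s - p / 2) ^ 2) by ring. }
      auto_derive.
      { split; [nra|]. split; [|auto]. eexists; exact HA. }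
      change (fun x => A x) with A. rewrite (is_derive_unique _ _ _ HA).
      clearbody A. unfold Rdiv, Rminus in *.
      replace ((t + - (p * / 2)) ^ 2) with ((t + - (p * / 2)) * (t + - (p * / 2))) in * by ring.
      change (p ^ 2) with (p * (p * 1)). field. repeat split; auto; nra.
Qed.

(** The choices of sign and of order of the principal curvatures that a class
    requires besides its relation; at a single point they hold after a choice of
    the normal and of the labels. *)
Definition class_side (c : basic_class) (k1 k2 : R) : Prop :=
  match c with
  | H_zero => k2 < 0
  | H_half => k2 < 1 / 2
  | H_prop_gt _ | H_prop_lt _ => 0 < k2
  | H_affine_gt _ | H_affine_lt _ => 0 < k1 - k2
  | _ => True
  end.

Lemma class_nu_dom c k1 k2 :
  valid_class c -> k1 <> k2 -> class_side c k1 k2 ->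
  class_relation c (k1 * k2) ((k1 + k2) / 2) ((k1 - k2) / 2) ->
  class_dom c (class_nu c k1 k2).
Proof.
  intros Hv Hk Hs Hr. apply valid_class_p in Hv.
  assert (Haff : forall p, p - 1 <> 0 -> (k1 + k2) / 2 = p * ((k1 - k2) / 2) + 1 ->
    2 * (k2 - 1) / (p - 1) = k1 - k2).
  { intros p Hp E. apply (Rmult_eq_reg_r (p - 1)); auto.
    transitivity (2 * (k2 - 1)); [field; auto|lra]. }
  destruct c; simpl in *; try lra; auto.
  - rewrite Haff; tauto.
  - rewrite Haff; tauto.
  - intros E. rewrite E in Hr. lra.
  - split.
    + intros E. assert (k1 = -1) by lra. subst k1. lra.
    + intros E. assert (k1 = 0) by lra. subst k1. apply Hk. lra.
  - intros E. assert (k1 = - p / 2) by lra. subst k1. nra.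
Qed.

(** The sign conditions are now contained in the condition on nu, which is open;
    so they propagate from one point to a neighbourhood. *)
Lemma class_relation_curvatures c k1 k2 :
  valid_class c -> class_dom c (class_nu c k1 k2) ->
  class_relation c (k1 * k2) ((k1 + k2) / 2) ((k1 - k2) / 2) ->
  k1 = class_f c (class_nu c k1 k2) /\ k2 = class_g c (class_nu c k1 k2).
Proof.
  intros Hv Hd Hr. apply valid_class_p in Hv.
  assert (Hcancel : forall s a b, s <> 0 -> a * s = b * s -> a = b).
  { intros s a b Hs E. now apply (Rmult_eq_reg_r s). }
  destruct c; unfold class_f; simpl in *; split; try lra.
  - apply (Hcancel (p - 1)); [tauto|].
    transitivity ((p + 1) * k2); [lra|]. field; tauto.
  - apply (Hcancel (p - 1)); [tauto|].
    transitivity ((p + 1) * k2); [lra|]. field; tauto.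
  - apply (Hcancel (p - 1)); [tauto|].
    transitivity ((p + 1) * k2 - 2); [lra|]. field; tauto.
  - apply (Hcancel (p - 1)); [tauto|].
    transitivity ((p + 1) * k2 - 2); [lra|]. field; tauto.
  - apply (Hcancel k1); auto. rewrite Rmult_comm, Hr. field. auto.
  - apply (Hcancel (k1 + 1)); [tauto|].
    transitivity k1; [lra|]. field. tauto.
  - apply (Hcancel (k1 + p / 2)); auto.
    transitivity (p / 2 * k1 - q); [lra|]. field. lra.
Qed.

Lemma is_derive_Rpower x p : 0 < x ->
  is_derive (fun y => Rpower y p) x (p / x * exp (p * ln x)).
Proof.
  intros Hx. unfold Rpower. auto_derive; auto. unfold Rdiv. ring.
Qed.

(** In the classes where H is affine in H' with slope p, the ratio y / x is a
    constant multiple of lambda^p and the product x y one of 1 / lambda. *)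
Lemma Rpower_factors p x : 0 < x ->
  let A := exp (p * ln x) in let w := exp (- ((p + 1) / 2) * ln x) in
  exp ((p - 1) / 2 * ln x) = A * w /\ w * (A * w) = / x /\ A <> 0 /\ w <> 0.
Proof.
  intros Hx A w. assert (E : exp ((p - 1) / 2 * ln x) = A * w).
  { unfold A, w. rewrite <- exp_plus. f_equal. field. }
  repeat split; try apply exp_neq_0; auto.
  rewrite <- E. unfold w. rewrite <- exp_plus.
  replace (_ + _) with (- ln x) by field. rewrite exp_Ropp, exp_ln; auto.
Qed.

(** The common computation for these classes. The square of the constant s in y is
    (p + 1) / d with d = eps (1 - p). *)
Ltac power_class p x d eps :=
  match goal with
  | Hp : _ /\ _ /\ p <> 0 /\ _, Ha : 0 < x |- _ =>
    let s := fresh "s" in let A := fresh "A" in let w := fresh "w" in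
    let Hs := fresh "Hs" in
    let E1 := fresh "E" in let E2 := fresh "E" in
    destruct Hp as (? & ? & ? & ?);
    set (s := sqrt ((p + 1) / d));
    assert (Hs : s * s = (p + 1) / d) by (apply sqrt_sqrt; lra);
    assert (s <> 0) by (now apply sqrt_neq_0);
    destruct (Rpower_factors p x Ha) as (E1 & E2 & ? & ?); rewrite E1;
    set (A := exp (p * ln x)) in *;
    set (w := exp (- ((p + 1) / 2) * ln x)) in *;
    assert (1 - p <> 0) by lra;
    split; [field; repeat split; auto; lra|]; split;
    [ transitivity (eps * (s * s) * ((p - 1) / (2 * x) * w));
      [rewrite Hs|]; field; repeat split; auto; lra
    | rewrite Rmult_assoc;
      replace (w * (s * (A * w))) with (s * (w * (A * w))) by ring;
      rewrite E2; field; repeat split; auto; lra ]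
  end.

Lemma class_pde_reduction c : valid_class c ->
  pde_reduction c (class_dom c) (class_f c) (class_g c) (class_rootE c) (class_rootG c).
Proof.
  intros Hv. assert (Hp := valid_class_p c Hv).
  set (kappa := match c with
    | H_zero | H_half => -1 / 2
    | H_prop_gt p | H_affine_gt p => sqrt ((p + 1) / (p - 1)) * (p - 1) / (2 * p)
    | H_prop_lt p | H_affine_lt p => sqrt ((p + 1) / (1 - p)) * (p - 1) / (2 * p)
    | K_affine p q => sqrt (p ^ 2 / 4 + q) / p
    | _ => 1 / 2 end).
  exists kappa. split.
  { destruct c; unfold kappa; try lra;
      try (destruct Hp as (H1 & H2 & H3 & H4);
           apply div_neq_0; [apply prod_neq_0; auto; now apply sqrt_neq_0|lra]).
    apply div_neq_0; [apply sqrt_neq_0|]; tauto. }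
  intros x Ha Ht.
  set (t := class_subst c x) in *.
  set (qd := match c with
    | H_zero | H_half | K_minus_one => 1
    | H_prop_gt p | H_prop_lt p | H_affine_gt p | H_affine_lt p =>
        p / x * exp (p * ln x)
    | K_affine p q => p / (x ^ 2 + q) * exp (p * atan_scaled q x)
    | _ => exp x end).
  set (pd := match c with
    | H_zero | H_half => 1
    | K_minus_one => -1
    | H_prop_gt p | H_affine_gt p => - (p / x * / exp (p * ln x))
    | H_prop_lt p | H_affine_lt p => p / x * / exp (p * ln x)
    | K_affine p q => - (p / (x ^ 2 + q) * / exp (p * atan_scaled q x))
    | _ => - / exp x end).
  exists qd, pd.
  assert (Hq : is_derive (class_Q c) x qd).
  { destruct c; unfold class_Q, qd; simpl in Ha;
      try (apply (is_derive_id x)); try apply is_derive_exp;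
      try (now apply is_derive_Rpower).
    evar_last.
    - apply (is_derive_comp exp (fun x => p * atan_scaled q x)).
      + apply is_derive_exp.
      + apply (is_derive_scal (atan_scaled q)). apply atan_scaled_derive. tauto.
    - unfold scal, mult; simpl. unfold mult; simpl. unfold Rdiv. ring. }
  split; [exact Hq|].
  assert (Hinv : forall Q q0 : R -> R, is_derive Q x (q0 x * Q x) -> Q x <> 0 ->
    is_derive (fun y => / Q y) x (- (q0 x * / Q x))).
  { intros Q q0 HQ Hn. evar_last; [now apply is_derive_inv; [exact HQ|]|].
    field. auto. }
  split.
  { destruct c; simpl in Ha.
    - apply (is_derive_id x).
    - apply (is_derive_id x).
    - evar_last; [apply (Hinv exp (fun _ => 1)); [|apply exp_neq_0]|].
      + rewrite Rmult_1_l. apply is_derive_exp.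
      + unfold pd. ring.
    - apply (Hinv (fun y => Rpower y p) (fun y => p / y)).
      + now apply is_derive_Rpower.
      + apply exp_neq_0.
    - evar_last; [apply (is_derive_opp (fun y => / Rpower y p));
        apply (Hinv (fun y => Rpower y p) (fun y => p / y))|].
      + now apply is_derive_Rpower.
      + apply exp_neq_0.
      + unfold pd, opp; simpl. unfold Rpower. ring.
    - apply (Hinv (fun y => Rpower y p) (fun y => p / y)).
      + now apply is_derive_Rpower.
      + apply exp_neq_0.
    - evar_last; [apply (is_derive_opp (fun y => / Rpower y p));
        apply (Hinv (fun y => Rpower y p) (fun y => p / y))|].
      + now apply is_derive_Rpower.
      + apply exp_neq_0.
      + unfold pd, opp; simpl. unfold Rpower. ring.
    - unfold class_P, pd. auto_derive; auto.
    - evar_last; [apply (Hinv exp (fun _ => 1)); [|apply exp_neq_0]|].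
      + rewrite Rmult_1_l. apply is_derive_exp.
      + unfold pd. ring.
    - apply (Hinv (class_Q (K_affine p q)) (fun y => p / (y ^ 2 + q))).
      + exact Hq.
      + apply exp_neq_0. }
  cbv zeta.
  assert (Hfg := class_fg_neq c t Hv Ht).
  rewrite class_f_derive, class_g_derive, (is_derive_unique _ _ _ (class_subst_is_derive c x Ha)); auto.
  destruct c; unfold t, class_f in *; clear t;
    cbv beta iota zeta delta [class_subst class_dsubst class_dom class_admissible
      class_f_slope class_f_const class_g class_dg class_rootE class_rootG class_R] in *;
    unfold kappa, qd, pd; clear kappa qd pd Hq Hinv.
  - assert (He := exp_pos x).
    replace (- (2 * - exp x)) with (2 * exp x) by ring.
    set (w := exp (- ln (2 * exp x) / 2)).
    assert (Hw : w * w = / (2 * exp x)).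
    { unfold w. rewrite <- exp_plus.
      replace (_ + _) with (- ln (2 * exp x)) by field.
      rewrite exp_Ropp, exp_ln; lra. }
    repeat split; try (field; lra).
    rewrite Rmult_assoc, Hw. field. lra.
  - assert (He := exp_pos x).
    replace (1 - 2 * ((1 - exp x) / 2)) with (exp x) by field.
    rewrite ln_exp.
    set (w := exp (- x / 2)).
    assert (Hw : w * w = / exp x).
    { unfold w. rewrite <- exp_plus, <- exp_Ropp. f_equal. field. }
    repeat split; try (field; lra).
    rewrite Rmult_assoc, Hw. unfold sinh. rewrite exp_Ropp. field. lra.
  - set (w := exp (x / 2)).
    assert (Hw : exp (- x / 2) = / w).
    { unfold w. rewrite <- exp_Ropp. f_equal. field. }
    assert (Hx : exp x = w * w).
    { unfold w. rewrite <- exp_plus. f_equal. field. }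
    assert (w <> 0) by apply exp_neq_0.
    rewrite Hw, Hx. repeat split; field; lra.
  - power_class p x (p - 1) (-1).
  - power_class p x (1 - p) 1.
  - assert (p1 : p - 1 <> 0) by tauto.
    replace (2 * (((p - 1) * x + 2) / 2 - 1) / (p - 1)) with x by (field; auto).
    replace ((p + 1) / (p - 1) * (((p - 1) * x + 2) / 2) + -2 / (p - 1)
      - ((p - 1) * x + 2) / 2) with x by (field; auto).
    power_class p x (p - 1) (-1).
  - assert (p1 : p - 1 <> 0) by tauto.
    replace (2 * (((p - 1) * x + 2) / 2 - 1) / (p - 1)) with x by (field; auto).
    replace ((p + 1) / (p - 1) * (((p - 1) * x + 2) / 2) + -2 / (p - 1)
      - ((p - 1) * x + 2) / 2) with x by (field; auto).
    power_class p x (1 - p) 1.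
  - set (T := tan (x / 2)) in *.
    assert (HT : 0 < 1 + T ^ 2) by (generalize (pow2_ge_0 T); lra).
    set (w := exp (- ln (1 + T ^ 2) / 2)).
    assert (Hw : w * w = / (1 + T ^ 2)).
    { unfold w. rewrite <- exp_plus.
      replace (_ + _) with (- ln (1 + T ^ 2)) by field.
      rewrite exp_Ropp, exp_ln; lra. }
    split; [field; repeat split; auto; nra|].
    split; [field; repeat split; auto; nra|].
    rewrite Rmult_assoc. replace (w * (T * w)) with (T * (w * w)) by ring. rewrite Hw.
    assert (Hsin : sin x = 2 * T / (1 + T ^ 2)).
    { replace x with (2 * (x / 2)) by field. rewrite sin_2a. unfold T, tan.
      assert (Hcs := sin2_cos2 (x / 2)). unfold Rsqr in Hcs.
      replace (1 + (sin (x / 2) / cos (x / 2)) ^ 2) with (/ cos (x / 2) ^ 2).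
      - replace (2 * (x / 2) / 2) with (x / 2) by field. field. auto.
      - transitivity ((sin (x / 2) * sin (x / 2) + cos (x / 2) * cos (x / 2))
          / cos (x / 2) ^ 2); [rewrite Hcs|]; field; auto. }
    rewrite Hsin. field. split; [lra|auto].
  - destruct Ht as [t0 t1].
    assert (x <> 2) by auto. assert (x - 2 <> 0) by lra.
    assert (x - 4 <> 0).
    { intros E. apply t0. rewrite E. unfold Rdiv. ring. }
    replace ((2 * ((x - 4) / (x - 2)) - 4) / ((x - 4) / (x - 2) - 1)) with x
      by (field; repeat split; auto; lra).
    set (w := exp (x / 2)).
    assert (Hw : exp (- x / 2) = / w).
    { unfold w. rewrite <- exp_Ropp. f_equal. field. }
    assert (Hx : exp x = w * w).
    { unfold w. rewrite <- exp_plus. f_equal. field. }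
    assert (w <> 0) by apply exp_neq_0.
    rewrite Hw, Hx. repeat split; field; repeat split; auto; lra.
  - destruct Hp as (p0 & q0 & r0).
    replace (x + p / 2 - p / 2) with x by ring.
    set (r := sqrt (p ^ 2 / 4 + q)). set (s := sqrt q).
    assert (Hr : r * r = p ^ 2 / 4 + q) by (apply sqrt_sqrt; lra).
    assert (Hs : s * s = q) by (apply sqrt_sqrt; lra).
    assert (Hq : 0 < x ^ 2 + q) by (generalize (pow2_ge_0 x); lra).
    set (w := exp (- ln (x ^ 2 + q) / 2)).
    assert (Hw : w * w = / (x ^ 2 + q)).
    { unfold w. rewrite <- exp_plus.
      replace (_ + _) with (- ln (x ^ 2 + q)) by field.
      rewrite exp_Ropp, exp_ln; lra. }
    set (h := exp (p / 2 * atan_scaled q x)).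
    assert (Hh : exp (- (p / 2) * atan_scaled q x) = / h).
    { unfold h. rewrite <- exp_Ropp. f_equal. ring. }
    assert (Hh2 : exp (p * atan_scaled q x) = h * h).
    { unfold h. rewrite <- exp_plus. f_equal. field. }
    assert (h <> 0) by apply exp_neq_0.
    assert (r <> 0) by now apply sqrt_neq_0. assert (s <> 0) by now apply sqrt_neq_0.
    rewrite Hh, Hh2, <- Hr.
    replace (1 * (x + p / 2) + - p / 2 - (p / 2 - r * r / (x + p / 2)))
      with ((x ^ 2 + q) / (x + p / 2)).
    2: { replace q with (r * r - p ^ 2 / 4) by lra. field. lra. }
    assert (2 * x + p <> 0) by lra.
    split; [field; repeat split; auto; lra|].
    split; [field; repeat split; auto; lra|].
    transitivity ((1 * (x + p / 2) + - p / 2) * (p / 2 - r * r / (x + p / 2))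
      * (s * s * r * (x + p / 2) * (w * w))).
    { field. repeat split; lra. }
    rewrite Hw, Hs, Hr. field. repeat split; auto; lra.
Qed.

(** * Weingarten functions of parallel surfaces *)

(** If s is a principal curvature of a surface similar to the parallel surface at
    distance a, this is the principal curvature of the original surface; mu is the
    ratio of the similarity with the sign of the normal. *)
Definition unparallel (a mu s : R) : R := mu * s / (1 + a * mu * s).

Lemma unparallel_derive a mu (f : R -> R) t d :
  is_derive f t d -> 1 + a * mu * f t <> 0 ->
  is_derive (fun s => unparallel a mu (f s)) t (mu * d / (1 + a * mu * f t) ^ 2).
Proof.
  intros Hf Hn. unfold unparallel. auto_derive.
  - split; [eexists; exact Hf|]. split; [eexists; exact Hf|]. auto.
  - change (fun x => f x) with f. rewrite (is_derive_unique f t d Hf). field. auto.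
Qed.

(** The quotients y' / x and x' / y do not change, and neither does f g x y: this is
    why a surface and its parallel surfaces have the same natural PDE. *)
Lemma parallel_data c X f g Xc Yc a mu k :
  Weingarten_functions X f g -> line_elements X f g Xc Yc ->
  pde_reduction c X f g Xc Yc -> k <> 0 -> mu * mu = k * k ->
  (forall t, X t -> 1 + a * mu * f t <> 0 /\ 1 + a * mu * g t <> 0) ->
  let f' := fun t => unparallel a mu (f t) in
  let g' := fun t => unparallel a mu (g t) in
  let X' := fun t => Xc t * (1 + a * mu * f t) / k in
  let Y' := fun t => Yc t * (1 + a * mu * g t) / k in
  Weingarten_functions X f' g' /\ line_elements X f' g' X' Y' /\
  pde_reduction c X f' g' X' Y'.
Proof.
  intros W HL [kap [Hkap HR]] Hk Hmu Hn f' g' X' Y'.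
  assert (Hmu0 : mu <> 0).
  { intros E. apply Hk. rewrite E, Rmult_0_l in Hmu. symmetry in Hmu.
    destruct (Rmult_integral _ _ Hmu); auto. }
  assert (HX := W_open X f g W).
  assert (Hf := W_smooth_f X f g W). assert (Hg := W_smooth_g X f g W).
  assert (Df : forall t, X t -> is_derive f' t (mu * Derive f t / (1 + a * mu * f t) ^ 2)).
  { intros t Ht. apply unparallel_derive; [|now apply Hn].
    now apply smooth1_is_derive with X. }
  assert (Dg : forall t, X t -> is_derive g' t (mu * Derive g t / (1 + a * mu * g t) ^ 2)).
  { intros t Ht. apply unparallel_derive; [|now apply Hn].
    now apply smooth1_is_derive with X. }
  assert (Ediff : forall t, X t ->
    f' t - g' t = mu * (f t - g t) / ((1 + a * mu * f t) * (1 + a * mu * g t))).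
  { intros t Ht. destruct (Hn t Ht). unfold f', g', unparallel. field. auto. }
  assert (Smooth : forall h, smooth1 X h -> (forall t, X t -> 1 + a * mu * h t <> 0) ->
     smooth1 X (fun t => unparallel a mu (h t))).
  { intros h Hh H0. unfold unparallel, Rdiv. apply smooth1_mult; auto.
    - apply smooth1_mult; auto using smooth1_const.
    - apply smooth1_inv; auto. apply smooth1_plus; auto using smooth1_const.
      apply smooth1_mult; auto using smooth1_const. }
  split; [|split].
  - constructor; auto.
    + apply (W_interval X f g W).
    + apply Smooth; auto. intros; now apply Hn.
    + apply Smooth; auto. intros; now apply Hn.
    + intros t Ht. rewrite (is_derive_unique _ _ _ (Df t Ht)),
        (is_derive_unique _ _ _ (Dg t Ht)).
      destruct (Hn t Ht) as [N1 N2]. assert (N := W_derive X f g W t Ht).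
      replace (_ * _) with (mu * mu * (Derive f t * Derive g t)
         * (/ (1 + a * mu * f t) ^ 2 * / (1 + a * mu * g t) ^ 2)) by (field; auto).
      repeat apply prod_neq_0; auto;
        try (apply Rinv_neq_0_compat, pow_nonzero; auto); intros E; apply N; rewrite E; ring.
    + intros t Ht. rewrite Ediff; auto. destruct (Hn t Ht).
      apply prod_neq_0.
      * apply prod_neq_0; auto. apply (W_neq X f g W t Ht).
      * apply Rinv_neq_0_compat. now apply prod_neq_0.
  - intros t Ht. destruct (HL t Ht) as (X0 & Y0 & DX & DY). destruct (Hn t Ht) as [N1 N2].
    assert (N := W_neq X f g W t Ht).
    assert (N' : g t - f t <> 0) by lra.
    assert (Hft : is_derive f t (Derive f t)) by now apply smooth1_is_derive with X.
    assert (Hgt : is_derive g t (Derive g t)) by now apply smooth1_is_derive with X.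
    assert (Ediff' : g' t - f' t = - (mu * (f t - g t) / ((1 + a * mu * f t) * (1 + a * mu * g t))))
      by (rewrite <- Ediff; auto; ring).
    rewrite (is_derive_unique _ _ _ (Df t Ht)), (is_derive_unique _ _ _ (Dg t Ht)),
      Ediff', Ediff; auto.
    refine (conj _ (conj _ (conj _ _))).
    + unfold X'. repeat apply prod_neq_0; auto.
      now apply Rinv_neq_0_compat.
    + unfold Y'. repeat apply prod_neq_0; auto.
      now apply Rinv_neq_0_compat.
    + unfold X'. auto_derive.
      { split; [eexists; exact DX|]. split; [eexists; exact Hft|]. auto. }
      change (fun x => f x) with f. change (fun x => Xc x) with Xc.
      rewrite (is_derive_unique _ _ _ DX). field. repeat split; auto.
    + unfold Y'. auto_derive.
      { split; [eexists; exact DY|]. split; [eexists; exact Hgt|]. auto. }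
      change (fun x => g x) with g. change (fun x => Yc x) with Yc.
      rewrite (is_derive_unique _ _ _ DY). field. repeat split; auto.
  - exists kap. split; auto. intros lam Ha Ht.
    destruct (HR lam Ha Ht) as (qd & pd & Hq & Hp & E1 & E2 & E3).
    exists qd, pd. split; auto. split; auto. cbv zeta in *.
    set (t := class_subst c lam) in *. set (m := Derive (class_subst c) lam) in *.
    destruct (Hn t Ht) as [N1 N2]. assert (N := W_neq X f g W t Ht).
    rewrite (is_derive_unique _ _ _ (Df t Ht)), (is_derive_unique _ _ _ (Dg t Ht)),
      Ediff; auto.
    split; [|split].
    + unfold X', Y'. transitivity ((Derive g t / (f t - g t) * m * Yc t)
        * ((1 + a * mu * f t) / k)); [field; repeat split; auto|].
      rewrite E1. field. auto.
    + unfold X', Y'. transitivity ((- (Derive f t / (f t - g t)) * m * Xc t)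
        * ((1 + a * mu * g t) / k)); [field; repeat split; auto|].
      rewrite E2. field. auto.
    + unfold f', g', X', Y', unparallel.
      transitivity (mu * mu / (k * k) * (f t * g t * Xc t * Yc t)); [field; auto|].
      rewrite E3, Hmu. field. auto.
Qed.

(** * Natural principal parameters *)

Lemma open_Ioo a b : open (fun t : R => a < t < b).
Proof. exact (open_and (fun t => a < t) (fun t => t < b) (open_gt a) (open_lt b)). Qed.

(** The inverse of a primitive of h solves phi' = 1 / h(phi). *)
Lemma arclength_parameter (h : R -> R) u0 r :
  0 < r -> smooth1 (fun t => u0 - r < t < u0 + r) h ->
  (forall t, u0 - r < t < u0 + r -> 0 < h t) ->
  exists a b (phi : R -> R), a < 0 < b /\ phi 0 = u0 /\
    smooth1 (fun s => a < s < b) phi /\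
    forall s, a < s < b ->
      u0 - r < phi s < u0 + r /\ is_derive phi s (/ h (phi s)).
Proof.
  intros Hr Hh Hpos.
  set (X := fun t => u0 - r < t < u0 + r) in *.
  assert (HX : open X) by apply open_Ioo.
  assert (HI : is_interval X) by (unfold is_interval, X; intros; lra).
  set (S := fun x => RInt h u0 x).
  assert (DS : forall t, X t -> is_derive S t (h t)).
  { intros t Ht. apply is_derive_primitive with X; auto.
    - intros x Hx. now apply smooth1_continuity with X.
    - unfold X; lra. }
  assert (Mean : forall s t, X s -> X t -> exists y, Rmin s t <= y <= Rmax s t /\
     S t - S s = h y * (t - s)).
  { intros s t Hs Ht.
    assert (HIs : forall x, Rmin s t <= x <= Rmax s t -> X x).
    { intros x Hx. unfold Rmin, Rmax in Hx. destruct (Rle_dec s t);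
        [now apply (HI s t)|now apply (HI t s)]. }
    destruct (MVT_gen S s t h) as [y Hy].
    - intros x Hx. apply DS, HIs. lra.
    - intros x Hx. eapply is_derive_continuity_pt. apply DS, HIs. lra.
    - now exists y. }
  assert (Mono : forall s t, X s -> X t -> s < t -> S s < S t).
  { intros s t Hs Ht Hst. destruct (Mean s t Hs Ht) as [y [Hy E]].
    assert (0 < h y).
    { apply Hpos. rewrite Rmin_left, Rmax_right in Hy by lra.
      apply (HI s t); auto. }
    assert (0 < h y * (t - s)) by (apply Rmult_lt_0_compat; lra). lra. }
  set (l := u0 - r / 2). set (u := u0 + r / 2).
  assert (Xl : X l) by (unfold X, l; lra). assert (Xu : X u) by (unfold X, u; lra).
  assert (Inv : forall s, S l < s < S u -> exists x, l < x < u /\ S x = s).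
  { intros s Hs. destruct (f_interv_is_interv S l u s) as [x [Hx E]].
    - unfold l, u; lra.
    - lra.
    - intros x Hx. eapply is_derive_continuity_pt. apply DS. unfold X, l, u in *; lra.
    - exists x. split; auto.
      destruct (Req_dec x l) as [->|]; [lra|]. destruct (Req_dec x u) as [->|]; lra. }
  (* The closed interval [l, u] keeps the values of phi inside X. *)
  set (phi := fun s => epsilon (inhabits 0) (fun x => l < x < u /\ S x = s)).
  assert (Hphi : forall s, S l < s < S u -> l < phi s < u /\ S (phi s) = s).
  { intros s Hs. apply (epsilon_spec (inhabits 0) (fun x => l < x < u /\ S x = s)).
    now apply Inv. }
  assert (XI : forall x, l < x < u -> X x) by (unfold X, l, u; intros; lra).
  assert (S0 : S u0 = 0) by exact (RInt_point u0 h).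
  assert (H0 : S l < 0 < S u).
  { rewrite <- S0. split; apply Mono; auto; unfold X, l, u; lra. }
  assert (Cont : forall s, S l < s < S u -> forall eps, 0 < eps -> exists d, 0 < d /\
     forall s', Rabs (s' - s) < d -> S l < s' < S u /\ Rabs (phi s' - phi s) < eps).
  { intros s Hs eps He. destruct (Hphi s Hs) as [Hx Ex].
    set (x := phi s) in *.
    set (e := Rmin (eps / 2) (Rmin ((x - l) / 2) ((u - x) / 2))).
    assert (He0 : 0 < e) by (unfold e; repeat apply Rmin_pos; lra).
    assert (e <= eps / 2) by apply Rmin_l.
    assert (e <= (x - l) / 2).
    { eapply Rle_trans; [apply Rmin_r|apply Rmin_l]. }
    assert (e <= (u - x) / 2).
    { eapply Rle_trans; [apply Rmin_r|apply Rmin_r]. }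
    assert (A1 : S l < S (x - e)) by (apply Mono; auto; try (apply XI); lra).
    assert (A2 : S (x - e) < S x) by (apply Mono; try (apply XI); lra).
    assert (A3 : S x < S (x + e)) by (apply Mono; try (apply XI); lra).
    assert (A4 : S (x + e) < S u) by (apply Mono; auto; try (apply XI); lra).
    exists (Rmin (s - S (x - e)) (S (x + e) - s)). split; [apply Rmin_pos; lra|].
    intros s' Hs'.
    assert (Hs1 := Rlt_le_trans _ _ _ Hs' (Rmin_l _ _)).
    assert (Hs2 := Rlt_le_trans _ _ _ Hs' (Rmin_r _ _)).
    apply Rabs_lt_between in Hs1. apply Rabs_lt_between in Hs2.
    assert (Hs3 : S l < s' < S u) by lra. split; auto.
    destruct (Hphi s' Hs3) as [Hx' Ex'].
    apply Rabs_def1.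
    - destruct (Rlt_le_dec (phi s') (x + e)) as [|Hle]; [lra|].
      assert (S (x + e) <= S (phi s')).
      { destruct Hle as [Hlt|Heq]; [|rewrite Heq; lra]. apply Rlt_le, Mono; auto. apply XI; lra. }
      lra.
    - destruct (Rlt_le_dec (x - e) (phi s')) as [|Hle]; [lra|].
      assert (S (phi s') <= S (x - e)).
      { destruct Hle as [Hlt|Heq]; [|rewrite Heq; lra]. apply Rlt_le, Mono; auto. apply XI; lra. }
      lra. }
  assert (Dphi : forall s, S l < s < S u -> is_derive phi s (/ h (phi s))).
  { intros s Hs. apply is_derive_Reals. intros eps He.
    destruct (Hphi s Hs) as [Hx Ex].
    assert (Ci : continuity_pt (fun x => / h x) (phi s)).
    { apply (continuity_pt_inv h).
      - apply smooth1_continuity with X; auto.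
      - apply Rgt_not_eq, Hpos. now apply XI. }
    apply continuity_pt_locally with (eps := mkposreal eps He) in Ci.
    destruct Ci as [eta Heta]. simpl in Heta.
    destruct (Cont s Hs eta (cond_pos eta)) as [d [Hd Hc]].
    exists (mkposreal d Hd). simpl. intros x Hx0 Hxd.
    destruct (Hc (s + x)) as [Hsx Hclose].
    { now replace (s + x - s) with x by ring. }
    destruct (Hphi _ Hsx) as [Hx' Ex'].
    destruct (Mean (phi s) (phi (s + x))) as [y [Hy Ey]]; auto.
    rewrite Ex, Ex' in Ey.
    assert (Hyc : Rabs (y - phi s) < eta).
    { apply Rabs_lt_between in Hclose. apply Rabs_def1;
        unfold Rmin, Rmax in Hy; destruct (Rle_dec (phi s) (phi (s + x))); lra. }
    assert (Hhy : 0 < h y).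
    { apply Hpos, XI. unfold Rmin, Rmax in Hy.
      destruct (Rle_dec (phi s) (phi (s + x))); lra. }
    replace ((phi (s + x) - phi s) / x) with (/ h y).
    - apply Heta. exact Hyc.
    - apply (Rmult_eq_reg_l (h y * x)).
      + transitivity x; [field; lra|]. transitivity (h y * (phi (s + x) - phi s)); [lra|].
        field. auto.
      + apply prod_neq_0; lra. }
  exists (S l), (S u), phi. split; [exact H0|]. split.
  { destruct (Hphi 0 H0) as [Hx Ex].
    destruct (Rtotal_order (phi 0) u0) as [Hlt|[->|Hgt]]; auto.
    - apply Mono in Hlt; auto; [lra|unfold X; lra].
    - apply Mono in Hgt; auto; [lra|unfold X; lra]. }
  split.
  - apply smooth1_ode with (Y := X) (k := fun x => / h x); auto.
    + apply open_Ioo.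
    + apply smooth1_inv; auto. intros t Ht. apply Rgt_not_eq, Hpos, Ht.
    + intros t Ht. apply XI, Hphi, Ht.
  - intros s Hs. split; [apply XI, Hphi, Hs|auto].
Qed.

Lemma is_interval_Ioo a b : is_interval (fun t => a < t < b).
Proof. unfold is_interval; intros; lra. Qed.

(** The integrated Codazzi equations: sqrt E exp I depends on u only and
    sqrt G exp J on v only. *)
Lemma weingarten_line_element P Q z l X f g nu nu0 :
  is_interval P -> is_interval Q ->
  spacelike_surface (box P Q) z l -> principal_parameters (box P Q) z l ->
  Weingarten_functions X f g -> X nu0 -> smooth2 (box P Q) nu ->
  (forall u v, box P Q u v ->
     X (nu u v) /\ nu1 z l u v = f (nu u v) /\ nu2 z l u v = g (nu u v)) ->
  (forall u v v', P u -> Q v -> Q v' ->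
     EE z u v * exp (2 * Iint f g nu0 (nu u v))
     = EE z u v' * exp (2 * Iint f g nu0 (nu u v'))) /\
  (forall u u' v, P u -> P u' -> Q v ->
     GG z u v * exp (2 * Jint f g nu0 (nu u v))
     = GG z u' v * exp (2 * Jint f g nu0 (nu u' v))).
Proof.
  intros IP IQ S Pr W H0 Snu HN.
  assert (HD := surf_open _ z l S).
  assert (W' := Weingarten_swap X f g W).
  assert (SE := smooth2_EE _ z HD (surf_smooth _ z l S)).
  assert (SG := smooth2_GG _ z HD (surf_smooth _ z l S)).
  split.
  - intros u v v' Hu Hv Hv'.
    apply (constant_of_derive_0 Q (fun t => EE z u t * exp (2 * Iint f g nu0 (nu u t)))); auto.
    intros t Ht. assert (H : box P Q u t) by (split; auto).
    destruct (HN u t H) as (HXn & N1 & N2).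
    assert (DI := is_derive_Iint X f g nu0 _ W H0 HXn).
    assert (Dn := smooth2_is_derive_v _ nu u t Snu H).
    assert (DE := smooth2_is_derive_v _ _ u t SE H).
    destruct (codazzi_equations _ z l u t S Pr H) as [C _].
    rewrite (Dv_ext _ (nu1 z l) (fun x y => f (nu x y)) u t HD) in C; auto.
    2: { intros x y Hxy. apply (HN x y Hxy). }
    assert (Df := smooth1_is_derive X f (nu u t) (W_smooth_f X f g W) HXn).
    rewrite (Dv_comp _ f nu u t _ Snu H Df), N1, N2 in C.
    assert (Hfg := W_neq X f g W _ HXn).
    evar_last.
    + apply (is_derive_mult (EE z u) (fun t => exp (2 * Iint f g nu0 (nu u t)))).
      * exact DE.
      * apply (is_derive_comp exp (fun t => 2 * Iint f g nu0 (nu u t))).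
        -- apply is_derive_exp.
        -- apply (is_derive_scal (fun t => Iint f g nu0 (nu u t))).
           apply (is_derive_comp (Iint f g nu0) (nu u)); [exact DI|exact Dn].
      * intros; apply Rmult_comm.
    + unfold plus, mult, scal; simpl. unfold mult; simpl.
      replace (Dv (EE z) u t) with
        (- (2 * (Derive f (nu u t) * Dv nu u t) * EE z u t) / (f (nu u t) - g (nu u t)));
        [field; auto|].
      apply (Rmult_eq_reg_l (f (nu u t) - g (nu u t))); auto.
      transitivity (- (2 * (Derive f (nu u t) * Dv nu u t) * EE z u t)); [field; auto|lra].
  - intros u u' v Hu Hu' Hv.
    apply (constant_of_derive_0 P (fun t => GG z t v * exp (2 * Jint f g nu0 (nu t v)))); auto.
    intros t Ht. assert (H : box P Q t v) by (split; auto).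
    destruct (HN t v H) as (HXn & N1 & N2).
    assert (DI : is_derive (Jint f g nu0) (nu t v)
      (Derive g (nu t v) / (g (nu t v) - f (nu t v))))
      by exact (is_derive_Iint X g f nu0 _ W' H0 HXn).
    assert (Dn := smooth2_is_derive_u _ nu t v Snu H).
    assert (DG := smooth2_is_derive_u _ _ t v SG H).
    destruct (codazzi_equations _ z l t v S Pr H) as [_ C].
    rewrite (Du_ext _ (nu2 z l) (fun x y => g (nu x y)) t v HD) in C; auto.
    2: { intros x y Hxy. apply (HN x y Hxy). }
    assert (Dg := smooth1_is_derive X g (nu t v) (W_smooth_g X f g W) HXn).
    rewrite (Du_comp _ g nu t v _ Snu H Dg), N1, N2 in C.
    assert (Hfg := W_neq X f g W _ HXn).
    assert (Hgf : g (nu t v) - f (nu t v) <> 0) by lra.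
    evar_last.
    + apply (is_derive_mult (fun t => GG z t v) (fun t => exp (2 * Jint f g nu0 (nu t v)))).
      * exact DG.
      * apply (is_derive_comp exp (fun t => 2 * Jint f g nu0 (nu t v))).
        -- apply is_derive_exp.
        -- apply (is_derive_scal (fun t => Jint f g nu0 (nu t v))).
           apply (is_derive_comp (Jint f g nu0) (fun t => nu t v)); [exact DI|exact Dn].
      * intros; apply Rmult_comm.
    + unfold plus, mult, scal; simpl. unfold mult; simpl.
      replace (Du (GG z) t v) with
        (- (2 * (Derive g (nu t v) * Du nu t v) * GG z t v) / (g (nu t v) - f (nu t v)));
        [field; auto|].
      apply (Rmult_eq_reg_l (g (nu t v) - f (nu t v))); auto.
      transitivity (- (2 * (Derive g (nu t v) * Du nu t v) * GG z t v)); [field; auto|lra].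
Qed.

Lemma line_element_abs X f g nu0 (Xc : R -> R) t :
  Weingarten_functions X f g ->
  (forall s, X s -> Xc s <> 0) ->
  (forall s, X s -> is_derive Xc s (- (Derive f s / (f s - g s)) * Xc s)) ->
  X nu0 -> X t ->
  / / Rabs (Xc nu0) * exp (- Iint f g nu0 t) = Rabs (Xc t).
Proof.
  intros W Hn Hd H0 Ht. rewrite Rinv_inv.
  rewrite <- (Rabs_right (exp (- Iint f g nu0 t))), <- Rabs_mult.
  - rewrite (exp_Iint X f g nu0 Xc t); auto. f_equal. field. auto.
  - apply Rgt_ge, exp_pos.
Qed.

(** The functions sqrt E exp I of u and sqrt G exp J of v are absorbed by a change
    of each parameter. *)
Lemma natural_parameters_exist z l X f g nu nu0 u0 v0 r ca cb :
  let B := box (fun t => u0 - r < t < u0 + r) (fun t => v0 - r < t < v0 + r) in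
  0 < r -> 0 < ca -> 0 < cb ->
  spacelike_surface B z l -> principal_parameters B z l ->
  Weingarten_functions X f g -> X nu0 -> smooth2 B nu ->
  (forall u v, B u v ->
     X (nu u v) /\ nu1 z l u v = f (nu u v) /\ nu2 z l u v = g (nu u v)) ->
  exists a1 b1 a2 b2 (phi psi : R -> R),
    a1 < 0 < b1 /\ a2 < 0 < b2 /\ phi 0 = u0 /\ psi 0 = v0 /\
    regular_curve_parameter (fun t => a1 < t < b1) phi /\
    regular_curve_parameter (fun t => a2 < t < b2) psi /\
    forall u v, open_rect a1 b1 a2 b2 u v ->
      B (phi u) (psi v) /\
      Rabs (Derive phi u) * sqrt (EE z (phi u) (psi v))
        = / ca * exp (- Iint f g nu0 (nu (phi u) (psi v))) /\
      Rabs (Derive psi v) * sqrt (GG z (phi u) (psi v))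
        = / cb * exp (- Jint f g nu0 (nu (phi u) (psi v))).
Proof.
  intros B Hr Hca Hcb S Pr W H0 Snu HN.
  set (P := fun t => u0 - r < t < u0 + r) in *.
  set (Q := fun t => v0 - r < t < v0 + r) in *.
  assert (HD := surf_open _ z l S).
  assert (W' := Weingarten_swap X f g W).
  assert (OP : open P) by apply open_Ioo. assert (OQ : open Q) by apply open_Ioo.
  assert (Pu0 : P u0) by (unfold P; lra). assert (Qv0 : Q v0) by (unfold Q; lra).
  destruct (weingarten_line_element P Q z l X f g nu nu0 (is_interval_Ioo _ _)
    (is_interval_Ioo _ _) S Pr W H0 Snu HN) as [LE LG].
  assert (SE := smooth2_EE _ z HD (surf_smooth _ z l S)).
  assert (SG := smooth2_GG _ z HD (surf_smooth _ z l S)).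
  assert (SI : smooth2 B (fun u v => Iint f g nu0 (nu u v))).
  { apply smooth2_comp with X; auto.
    - apply (W_open X f g W).
    - now apply smooth1_Iint.
    - intros x y Hxy. apply (HN x y Hxy). }
  assert (SJ : smooth2 B (fun u v => Jint f g nu0 (nu u v))).
  { apply (smooth2_comp B X (Iint g f nu0) nu); auto.
    - apply (W_open X f g W).
    - now apply smooth1_Iint.
    - intros x y Hxy. apply (HN x y Hxy). }
  set (rE := fun u v => EE z u v * exp (2 * Iint f g nu0 (nu u v))).
  set (rG := fun u v => GG z u v * exp (2 * Jint f g nu0 (nu u v))).
  assert (SrE : smooth2 B rE) by (apply smooth2_mult; auto using smooth2_exp, smooth2_scal).
  assert (SrG : smooth2 B rG) by (apply smooth2_mult; auto using smooth2_exp, smooth2_scal).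
  assert (PrE : forall u v, B u v -> 0 < rE u v).
  { intros u v H. apply Rmult_lt_0_compat; [apply (surf_metric_E B z l S u v H)|apply exp_pos]. }
  assert (PrG : forall u v, B u v -> 0 < rG u v).
  { intros u v H. apply Rmult_lt_0_compat; [apply (surf_G_pos B z l u v S H)|apply exp_pos]. }
  set (hE := fun u => ca * sqrt (rE u v0)). set (hG := fun v => cb * sqrt (rG u0 v)).
  assert (S1 : smooth1 P hE).
  { apply smooth1_mult; auto using smooth1_const.
    apply (smooth1_comp P (fun t => 0 < t) sqrt (fun u => rE u v0)); auto using open_pos, smooth1_sqrt.
    - apply smooth1_subset with (fun u => B u v0); [intros t Ht; split; auto|].
      apply (smooth2_smooth1 B rE v0 SrE).
    - intros t Ht. apply PrE. split; auto. }
  assert (S2 : smooth1 Q hG).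
  { apply smooth1_mult; auto using smooth1_const.
    apply (smooth1_comp Q (fun t => 0 < t) sqrt (fun v => rG u0 v)); auto using open_pos, smooth1_sqrt.
    - apply smooth1_subset with (fun v => B u0 v); [intros t Ht; split; auto|].
      apply (smooth2_smooth1_snd B rG u0 SrG).
    - intros t Ht. apply PrG. split; auto. }
  assert (PhE : forall t, P t -> 0 < hE t).
  { intros t Ht. apply Rmult_lt_0_compat; auto. apply sqrt_lt_R0, PrE. split; auto. }
  assert (PhG : forall t, Q t -> 0 < hG t).
  { intros t Ht. apply Rmult_lt_0_compat; auto. apply sqrt_lt_R0, PrG. split; auto. }
  destruct (arclength_parameter hE u0 r Hr S1 PhE) as (a1 & b1 & phi & I1 & Z1 & C1 & D1).
  destruct (arclength_parameter hG v0 r Hr S2 PhG) as (a2 & b2 & psi & I2 & Z2 & C2 & D2).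
  assert (Dphi : forall s, a1 < s < b1 -> Derive phi s = / hE (phi s)).
  { intros s Hs. apply is_derive_unique. now apply D1. }
  assert (Dpsi : forall s, a2 < s < b2 -> Derive psi s = / hG (psi s)).
  { intros s Hs. apply is_derive_unique. now apply D2. }
  assert (Root : forall a x, 0 < a * exp (2 * x) -> 0 < a ->
     sqrt a = sqrt (a * exp (2 * x)) * exp (- x)).
  { intros a x _ Ha. rewrite exp_double, sqrt_mult, sqrt_square;
      try (apply Rlt_le); try apply exp_pos; auto.
    - rewrite exp_Ropp. field. apply exp_neq_0.
    - apply Rmult_lt_0_compat; apply exp_pos. }
  exists a1, b1, a2, b2, phi, psi.
  do 4 (split; auto). split; [|split].
  - split; auto. intros t Ht. rewrite Dphi; auto.
    apply Rgt_not_eq, Rinv_0_lt_compat, PhE. now apply D1.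
  - split; auto. intros t Ht. rewrite Dpsi; auto.
    apply Rgt_not_eq, Rinv_0_lt_compat, PhG. now apply D2.
  - intros u v [Hu Hv].
    assert (HP : P (phi u)) by now apply D1. assert (HQ : Q (psi v)) by now apply D2.
    assert (H : B (phi u) (psi v)) by (split; auto).
    assert (PE := PrE _ _ H). assert (PG := PrG _ _ H).
    split; [exact H|]. rewrite Dphi, Dpsi; auto.
    rewrite !Rabs_right.
    2: { apply Rgt_ge, Rinv_0_lt_compat, PhG; auto. }
    2: { apply Rgt_ge, Rinv_0_lt_compat, PhE; auto. }
    unfold hE, hG.
    replace (rE (phi u) v0) with (rE (phi u) (psi v)) by (apply LE; auto).
    replace (rG u0 (psi v)) with (rG (phi u) (psi v)) by (apply LG; auto).
    split.
    + rewrite (Root (EE z (phi u) (psi v)) (Iint f g nu0 (nu (phi u) (psi v))) PE).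
      2: apply (surf_metric_E B z l S _ _ H).
      fold (rE (phi u) (psi v)). field. split; try lra.
      now apply sqrt_neq_0.
    + rewrite (Root (GG z (phi u) (psi v)) (Jint f g nu0 (nu (phi u) (psi v))) PG).
      2: apply (surf_G_pos B z l _ _ S H).
      fold (rG (phi u) (psi v)). field. split; try lra.
      now apply sqrt_neq_0.
Qed.

(** * Local form of the theorem *)

Lemma continuity_2d_pt_open f x y (A : R -> Prop) :
  continuity_2d_pt f x y -> open A -> A (f x y) ->
  locally_2d (fun u v => A (f u v)) x y.
Proof.
  intros Hf HA H. destruct (HA _ H) as [eps He]. destruct (Hf eps) as [d Hd].
  exists d. intros u v Hu Hv. apply He. exact (Hd u v Hu Hv).
Qed.

Lemma continuity_pt_neq_0 h t : continuity_pt h t -> h t <> 0 ->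
  locally t (fun s => h s <> 0).
Proof.
  intros Hc H. exact (proj1 (continuity_pt_filterlim h t) Hc _ (open_neq0 _ H)).
Qed.

Lemma locally_ball_R (P : R -> Prop) t : locally t P ->
  exists e, 0 < e /\ forall s, t - e < s < t + e -> P s.
Proof.
  intros [e He]. exists e. split; [apply cond_pos|].
  intros s Hs. apply He. apply Rabs_def1; unfold minus, plus, opp; simpl; lra.
Qed.

Lemma spacelike_surface_subset D B z l :
  open2 B -> (forall u v, B u v -> D u v) ->
  spacelike_surface D z l -> spacelike_surface B z l.
Proof.
  intros HB Sub [a (b1 & b2 & b3) (c1 & c2 & c3) d e f g h]. constructor; auto.
  - split; [|split]; eapply smooth2_subset; eauto.
  - split; [|split]; eapply smooth2_subset; eauto.
Qed.

Lemma smooth2_parallel_factor D z l a :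
  spacelike_surface D z l -> smooth2 D (parallel_factor z l a).
Proof.
  intros S. assert (HD := surf_open D z l S).
  apply smooth2_mult; auto; apply smooth2_minus; auto using smooth2_const;
    apply smooth2_scal; auto.
  - exact (smooth2_nu1 D z l S).
  - exact (smooth2_nu2 D z l S).
Qed.

Lemma open2_parallel_domain D z l a :
  spacelike_surface D z l -> open2 (parallel_domain D z l a).
Proof.
  intros S u v [H H0]. apply locally_2d_and.
  - exact (surf_open D z l S u v H).
  - apply (continuity_2d_pt_open _ u v (fun t => t <> 0)); auto using open_neq0.
    exact (smooth2_continuity D _ u v (smooth2_parallel_factor D z l a S) H).
Qed.

Lemma parallel_factor_neq z l a u v :
  parallel_factor z l a u v <> 0 ->
  1 - a * nu1 z l u v <> 0 /\ 1 - a * nu2 z l u v <> 0.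
Proof.
  unfold parallel_factor. intros H. split; intros E; apply H; rewrite E; ring.
Qed.

(** The principal curvature, for the normal tau l, of k (z + a l) in terms of that
    of z. *)
Definition parallel_curvature (a k tau s : R) : R := tau * s / (k * (1 - a * s)).

Lemma parallel_curvature_inverse a k tau s :
  k <> 0 -> tau * tau = 1 -> 1 - a * s <> 0 ->
  1 + a * (k * tau) * parallel_curvature a k tau s = / (1 - a * s) /\
  s = unparallel a (k * tau) (parallel_curvature a k tau s).
Proof.
  intros Hk Ht H.
  assert (E : 1 + a * (k * tau) * parallel_curvature a k tau s = / (1 - a * s)).
  { unfold parallel_curvature.
    transitivity (1 + a * (tau * tau) * s / (1 - a * s)); [field; auto|].
    rewrite Ht. field. auto. }
  split; auto. unfold unparallel. rewrite E. unfold parallel_curvature.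
  transitivity ((tau * tau) * s); [rewrite Ht; ring|]. field. auto.
Qed.

Lemma smooth2_parallel_curvature D h a k tau :
  open2 D -> smooth2 D h -> k <> 0 -> (forall u v, D u v -> 1 - a * h u v <> 0) ->
  smooth2 D (fun u v => parallel_curvature a k tau (h u v)).
Proof.
  intros HD Hh Hk H.
  assert (H1 : smooth2 D (fun u v => tau * h u v)) by now apply smooth2_scal.
  assert (H2 : smooth2 D (fun u v => 1 - a * h u v))
    by (apply smooth2_minus; auto using smooth2_const, smooth2_scal).
  assert (H3 : smooth2 D (fun u v => k * (1 - a * h u v))).
  { exact (smooth2_scal D k (fun u v => 1 - a * h u v) HD H2). }
  apply (smooth2_div D _ _ HD H1 H3).
  intros u v Huv. apply prod_neq_0; auto.
Qed.

Lemma smooth2_class_nu D c h1 h2 :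
  open2 D -> smooth2 D h1 -> smooth2 D h2 ->
  smooth2 D (fun u v => class_nu c (h1 u v) (h2 u v)).
Proof.
  intros HD H1 H2. destruct c; auto.
  - apply smooth2_plus; auto using smooth2_const.
  - apply smooth2_plus; auto using smooth2_const.
Qed.

Lemma Weingarten_class c (X : R -> Prop) :
  valid_class c -> open X -> is_interval X -> (forall t, X t -> class_dom c t) ->
  Weingarten_functions X (class_f c) (class_g c).
Proof.
  intros Hv HX HI Sub. constructor; auto.
  - exact (smooth1_subset _ _ _ Sub (class_f_smooth c)).
  - exact (smooth1_subset _ _ _ Sub (class_g_smooth c)).
  - intros t Ht. destruct (class_fg_derive_neq c t Hv (Sub t Ht)).
    now apply prod_neq_0.
  - intros t Ht. apply class_fg_neq; auto.
Qed.

Lemma pde_reduction_subset c (X Y : R -> Prop) f g Xc Yc :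
  (forall t, Y t -> X t) -> pde_reduction c X f g Xc Yc -> pde_reduction c Y f g Xc Yc.
Proof.
  intros Sub [k [Hk H]]. exists k. split; auto.
Qed.

Lemma sqrt_sq_mult a b : 0 < b -> sqrt (a ^ 2 * b) = Rabs a * sqrt b.
Proof.
  intros Hb. replace (a ^ 2) with (Rsqr a) by (unfold Rsqr; ring).
  rewrite sqrt_mult, sqrt_Rsqr_abs; auto using Rle_0_sqr. lra.
Qed.

(** The conclusion of the theorem at a point, with the identity as linear isometry:
    a homothety and a choice of the normal are enough. *)
Definition chart_of_class (D : region) (z l : R -> R -> vec3) (a u0 v0 k : R)
  (c : basic_class) (swap : bool) : Prop :=
  exists (a1 b1 a2 b2 : R) (phi psi : R -> R) (sigma : R) (lam : R -> R -> R),
    parameter_change (parallel_domain D z l a) u0 v0 a1 b1 a2 b2 swap phi psi /\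
    (sigma = 1 \/ sigma = -1) /\
    let D' := open_rect a1 b1 a2 b2 in
    let w := reparam swap phi psi
               (similar_point k (fun x => x) (Vec 0 0 0) (parallel_point z l a)) in
    let n := reparam swap phi psi
               (similar_normal sigma (fun x => x) (parallel_normal z l a)) in
    let nu := fun u v => class_subst c (lam u v) in
    basic_surface c D' w n lam /\
    natural_pde_is c D' w n nu /\
    natural_pde_is c D'
      (reparam swap phi psi z) (reparam swap phi psi l) nu /\
    (forall u v, D' u v -> class_pde c lam u v).

(** Near the point nu takes values in a small interval on which the Weingarten
    functions of the basic surface and those of the given surface are defined.
    Natural parameters for the given surface are natural for the parallel surface
    as well, because there sqrt E is multiplied by k |1 - a nu1|, which is the
    factor between the two closed forms of sqrt E. *)
Lemma chart_exists D z l a u0 v0 k tau c :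
  spacelike_surface D z l -> principal_parameters D z l ->
  parallel_domain D z l a u0 v0 -> valid_class c -> 0 < k -> tau * tau = 1 ->
  let kap1 := fun x y => parallel_curvature a k tau (nu1 z l x y) in
  let kap2 := fun x y => parallel_curvature a k tau (nu2 z l x y) in
  kap1 u0 v0 <> kap2 u0 v0 -> class_side c (kap1 u0 v0) (kap2 u0 v0) ->
  (forall x y, parallel_domain D z l a x y ->
     class_relation c (kap1 x y * kap2 x y) ((kap1 x y + kap2 x y) / 2)
       ((kap1 x y - kap2 x y) / 2)) ->
  chart_of_class D z l a u0 v0 k c false.
Proof.
  intros S Pr H0 Hv Hk Htau kap1 kap2 Hneq Hside Hrel.
  set (U := parallel_domain D z l a) in *.
  assert (HU : open2 U) by now apply open2_parallel_domain.
  assert (Hfac : forall x y, U x y -> 1 - a * nu1 z l x y <> 0 /\ 1 - a * nu2 z l x y <> 0).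
  { intros x y [_ H]. now apply parallel_factor_neq. }
  assert (UD : forall x y, U x y -> D x y) by (intros x y H; apply H).
  assert (Hk0 : k <> 0) by lra.
  assert (SU := spacelike_surface_subset D U z l HU UD S).
  assert (PU : principal_parameters U z l) by (intros x y H; apply Pr; auto).
  assert (Sk1 : smooth2 U kap1).
  { apply smooth2_parallel_curvature; auto.
    - exact (smooth2_nu1 U z l SU).
    - intros; now apply Hfac. }
  assert (Sk2 : smooth2 U kap2).
  { apply smooth2_parallel_curvature; auto.
    - exact (smooth2_nu2 U z l SU).
    - intros; now apply Hfac. }
  set (nuh := fun x y => class_nu c (kap1 x y) (kap2 x y)).
  assert (Snu : smooth2 U nuh) by now apply smooth2_class_nu.
  set (f := class_f c). set (g := class_g c). set (mu := k * tau).
  set (t0 := nuh u0 v0).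
  assert (Hdom0 : class_dom c t0) by (apply class_nu_dom; auto).
  assert (Hfg : forall x y, U x y -> class_dom c (nuh x y) ->
     kap1 x y = f (nuh x y) /\ kap2 x y = g (nuh x y)).
  { intros x y H Hd. apply class_relation_curvatures; auto. }
  assert (Hinv : forall x y, U x y ->
    1 + a * mu * kap1 x y = / (1 - a * nu1 z l x y) /\
    nu1 z l x y = unparallel a mu (kap1 x y) /\
    1 + a * mu * kap2 x y = / (1 - a * nu2 z l x y) /\
    nu2 z l x y = unparallel a mu (kap2 x y)).
  { intros x y H. destruct (Hfac x y H) as [F1 F2].
    destruct (parallel_curvature_inverse a k tau _ Hk0 Htau F1).
    destruct (parallel_curvature_inverse a k tau _ Hk0 Htau F2). auto. }
  (* An interval of values of nu on which both pairs of functions are defined. *)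
  assert (HX : exists e, 0 < e /\ forall t, t0 - e < t < t0 + e ->
     class_dom c t /\ 1 + a * mu * f t <> 0 /\ 1 + a * mu * g t <> 0).
  { apply locally_ball_R.
    destruct (Hfg u0 v0 H0 Hdom0) as [E1 E2].
    destruct (Hinv u0 v0 H0) as (I1 & _ & I2 & _). destruct (Hfac u0 v0 H0).
    rewrite E1 in I1. rewrite E2 in I2. fold t0 in I1, I2.
    assert (Cont : forall h, smooth1 (class_dom c) h ->
      continuity_pt (fun t => 1 + a * mu * h t) t0).
    { intros h Hh. apply continuity_pt_plus; [apply continuity_pt_const; now intros ? ?|].
      apply continuity_pt_mult; [apply continuity_pt_const; now intros ? ?|].
      now apply smooth1_continuity with (class_dom c). }
    repeat apply filter_and.
    - exact (class_dom_open c t0 Hdom0).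
    - apply (continuity_pt_neq_0 (fun t => 1 + a * mu * f t)).
      + apply Cont, class_f_smooth.
      + rewrite I1. now apply Rinv_neq_0_compat.
    - apply (continuity_pt_neq_0 (fun t => 1 + a * mu * g t)).
      + apply Cont, class_g_smooth.
      + rewrite I2. now apply Rinv_neq_0_compat. }
  destruct HX as [e [He HX]].
  set (X := fun t => t0 - e < t < t0 + e) in HX.
  assert (OX : open X) by apply open_Ioo.
  assert (IX : is_interval X) by apply is_interval_Ioo.
  assert (Xt0 : X t0) by (unfold X; lra).
  (* A square on which nu stays in that interval and the sign in the normal of the
     parallel surface is constant. *)
  set (s0 := sign (parallel_factor z l a u0 v0)).
  assert (Hs0 : s0 = 1 \/ s0 = -1).
  { unfold s0. destruct (Rtotal_order (parallel_factor z l a u0 v0) 0) as [N|[N|N]].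
    - right. now apply sign_eq_m1.
    - elim (proj2 H0 N).
    - left. now apply sign_eq_1. }
  assert (HB : locally_2d (fun x y => U x y /\ (X (nuh x y) /\
     0 < parallel_factor z l a u0 v0 * parallel_factor z l a x y)) u0 v0).
  { apply locally_2d_and; [now apply HU|]. apply locally_2d_and.
    - apply continuity_2d_pt_open; auto. exact (smooth2_continuity U nuh u0 v0 Snu H0).
    - apply (continuity_2d_pt_open
        (fun x y => parallel_factor z l a u0 v0 * parallel_factor z l a x y)
        u0 v0 (fun t => 0 < t)); auto using open_pos.
      + apply continuity_2d_pt_mult; [apply continuity_2d_pt_const|].
        exact (smooth2_continuity D _ u0 v0 (smooth2_parallel_factor D z l a S) (UD _ _ H0)).
      + generalize (pow2_gt_0 _ (proj2 H0)). simpl. rewrite Rmult_1_r. auto. }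
  destruct HB as [r Hr].
  set (P := fun t => u0 - r < t < u0 + r). set (Q := fun t => v0 - r < t < v0 + r).
  assert (HBox : forall x y, box P Q x y -> U x y /\ X (nuh x y) /\
     sign (parallel_factor z l a x y) = s0).
  { intros x y [Hx Hy]. unfold P in Hx. unfold Q in Hy.
    destruct (Hr x y) as (h1 & h2 & h3); [apply Rabs_def1; lra|apply Rabs_def1; lra|].
    split; auto. split; auto. unfold s0.
    destruct (Rtotal_order (parallel_factor z l a u0 v0) 0) as [N|[N|N]].
    - rewrite (sign_eq_m1 _ N). apply sign_eq_m1. nra.
    - elim (proj2 H0 N).
    - rewrite (sign_eq_1 _ N). apply sign_eq_1. nra. }
  assert (OB : open2 (box P Q)) by (apply open2_box; apply open_Ioo).
  assert (SB : spacelike_surface (box P Q) z l).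
  { apply spacelike_surface_subset with U; auto. intros; now apply HBox. }
  assert (PB : principal_parameters (box P Q) z l).
  { intros x y H. apply PU. now apply HBox. }
  assert (SnB : smooth2 (box P Q) nuh).
  { apply smooth2_subset with U; auto. intros; now apply HBox. }
  assert (XD : forall t, X t -> class_dom c t) by (intros t Ht; now apply HX).
  assert (W : Weingarten_functions X f g) by now apply Weingarten_class.
  assert (LEl : line_elements X f g (class_rootE c) (class_rootG c)).
  { intros t Ht. apply class_line_elements; auto. }
  assert (PR : pde_reduction c X f g (class_rootE c) (class_rootG c)).
  { apply pde_reduction_subset with (class_dom c); auto. now apply class_pde_reduction. }
  assert (Hmu : mu * mu = k * k).
  { unfold mu. transitivity (k * k * (tau * tau)); [ring|rewrite Htau; ring]. }
  destruct (parallel_data c X f g (class_rootE c) (class_rootG c) a mu k W LEl PR Hk0 Hmu)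
    as (Wz & LElz & PRz). { intros t Ht. now apply HX. }
  set (fz := fun t => unparallel a mu (f t)) in *.
  set (gz := fun t => unparallel a mu (g t)) in *.
  set (Xz := fun t => class_rootE c t * (1 + a * mu * f t) / k) in *.
  set (Yz := fun t => class_rootG c t * (1 + a * mu * g t) / k) in *.
  assert (Wz' := Weingarten_swap _ _ _ Wz). assert (W' := Weingarten_swap _ _ _ W).
  assert (Curv : forall x y, box P Q x y ->
     X (nuh x y) /\ nu1 z l x y = fz (nuh x y) /\ nu2 z l x y = gz (nuh x y)).
  { intros x y H. destruct (HBox x y H) as (h1 & h2 & _). split; auto.
    destruct (Hinv x y h1) as (_ & i1 & _ & i2).
    destruct (Hfg x y h1 (XD _ h2)) as [E1 E2].
    unfold fz, gz. rewrite <- E1, <- E2. auto. }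
  assert (Cpos : forall Zc : R -> R, Zc t0 <> 0 -> 0 < / Rabs (Zc t0)).
  { intros Zc HZ. apply Rinv_0_lt_compat, Rabs_pos_lt, HZ. }
  destruct (LElz t0 Xt0) as (NXz & NYz & _). destruct (LEl t0 Xt0) as (NX & NY & _).
  destruct (natural_parameters_exist z l X fz gz nuh t0 u0 v0 r
    (/ Rabs (Xz t0)) (/ Rabs (Yz t0)) (cond_pos r) (Cpos Xz NXz) (Cpos Yz NYz)
    SB PB Wz Xt0 SnB Curv)
    as (a1 & b1 & a2 & b2 & phi & psi & I1 & I2 & Z1 & Z2 & Rphi & Rpsi & Hnat).
  fold P in Hnat. fold Q in Hnat.
  set (D' := open_rect a1 b1 a2 b2) in *.
  set (P' := fun t => a1 < t < b1) in *. set (Q' := fun t => a2 < t < b2) in *.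
  assert (OP' : open P') by apply open_Ioo. assert (OQ' : open Q') by apply open_Ioo.
  assert (OD' : open2 D') by exact (open2_box P' Q' OP' OQ').
  set (nu' := fun u v => nuh (phi u) (psi v)).
  assert (Snu' : smooth2 D' nu').
  { apply (smooth2_reparam (box P Q) P' Q' phi psi nuh); auto.
    - apply Rphi.
    - apply Rpsi.
    - intros u v H. now apply Hnat. }
  assert (Xnu' : forall u v, D' u v -> X (nu' u v)).
  { intros u v H. apply Curv. now apply Hnat. }
  set (lam := fun u v => class_lam c (nu' u v)).
  assert (Slam : smooth2 D' lam).
  { apply smooth2_comp with (class_dom c); auto.
    - apply class_dom_open.
    - now apply class_lam_smooth. }
  assert (Hlam : forall u v, D' u v ->
    class_admissible c (lam u v) /\ class_subst c (lam u v) = nu' u v).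
  { intros u v H. apply class_lam_spec; auto. }
  (* The normal of the parallel surface carries the sign s0, so that sigma = tau s0
     gives the normal tau l. *)
  set (sigma := tau * s0).
  assert (Hsig : sigma * s0 = tau).
  { unfold sigma. destruct Hs0 as [->| ->]; ring. }
  set (w := reparam false phi psi
    (similar_point k (fun x => x) (Vec 0 0 0) (parallel_point z l a))).
  set (n := reparam false phi psi
    (similar_normal sigma (fun x => x) (parallel_normal z l a))).
  destruct (transformed_surface (box P Q) z l P' Q' phi psi a k tau w n SB PB OP' OQ'
    Rphi Rpsi) as (Sw & Pw & Cw); auto.
  { intros u v H. destruct (Hnat u v H) as [HB' _]. split; auto. apply HBox; auto. }
  { simpl. lra. }
  { intros u v H. unfold w, reparam, similar_point, parallel_point.
    apply vec_eq; simpl; ring. }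
  { intros u v H. unfold n, reparam, similar_normal, parallel_normal.
    destruct (HBox _ _ (proj1 (Hnat u v H))) as (_ & _ & ->).
    rewrite <- Hsig. apply vec_eq; simpl; ring. }
  destruct (transformed_surface (box P Q) z l P' Q' phi psi 0 1 1
    (reparam false phi psi z) (reparam false phi psi l) SB PB OP' OQ' Rphi Rpsi)
    as (Sz & Pz & Cz); auto.
  { intros u v H. split; [now apply Hnat|]. unfold parallel_factor. lra. }
  { ring. }
  { intros u v H. unfold reparam. apply vec_eq; simpl; ring. }
  { intros u v H. unfold reparam. apply vec_eq; simpl; ring. }
  assert (LX : forall f0 g0 X0 Y0 t, Weingarten_functions X f0 g0 ->
     line_elements X f0 g0 X0 Y0 -> X t ->
     / / Rabs (X0 t0) * exp (- Iint f0 g0 t0 t) = Rabs (X0 t) /\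
     / / Rabs (Y0 t0) * exp (- Jint f0 g0 t0 t) = Rabs (Y0 t)).
  { intros f0 g0 X0 Y0 t W0 L0 Ht. split.
    - apply (line_element_abs X); auto; intros s Hs; now apply L0.
    - apply (line_element_abs X g0 f0); auto.
      + now apply Weingarten_swap.
      + intros s Hs; now apply L0.
      + intros s Hs; now apply L0. }
  assert (Npz : natural_principal D' (reparam false phi psi z) (reparam false phi psi l)
    X fz gz nu' t0 (/ Rabs (Xz t0)) (/ Rabs (Yz t0))).
  { split; [auto|]. split; [auto|]. split; [exact Pz|].
    intros u v H. destruct (Hnat u v H) as (HB' & N1 & N2).
    destruct (Cz u v H) as (E1 & E2 & E3 & E4).
    destruct (Curv _ _ HB') as (C1 & C2 & C3).
    split; [exact C1|].
    rewrite E1, E2, E3, E4.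
    split; [rewrite C2; unfold nu'; field|].
    split; [rewrite C3; unfold nu'; field|].
    split.
    - unfold nu'. rewrite <- N1.
      rewrite sqrt_sq_mult; [|exact (surf_metric_E _ z l SB _ _ HB')].
      do 2 f_equal. ring.
    - unfold nu'. rewrite <- N2.
      rewrite sqrt_sq_mult; [|exact (surf_G_pos _ z l _ _ SB HB')].
      do 2 f_equal. ring. }
  assert (Npw : natural_principal D' w n
    X f g nu' t0 (/ Rabs (class_rootE c t0)) (/ Rabs (class_rootG c t0))).
  { split; [auto|]. split; [auto|]. split; [exact Pw|].
    intros u v H. destruct (Hnat u v H) as (HB' & N1 & N2).
    destruct (Cw u v H) as (E1 & E2 & E3 & E4).
    destruct (HBox _ _ HB') as (C0 & C1 & _).
    destruct (Hfg _ _ C0 (XD _ C1)) as [K1 K2].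
    destruct (Hinv _ _ C0) as (J1 & _ & J2 & _).
    destruct (Hfac _ _ C0) as [F1 F2].
    split; [exact C1|].
    rewrite E1, E2, E3, E4.
    split; [exact K1|]. split; [exact K2|].
    destruct (LX f g (class_rootE c) (class_rootG c) (nu' u v) W LEl C1) as [L1 L2].
    destruct (LX fz gz Xz Yz (nu' u v) Wz LElz C1) as [L3 L4].
    rewrite L1, L2. fold (nu' u v) in N1, N2, K1, K2. rewrite L3 in N1. rewrite L4 in N2.
    rewrite K1 in J1. rewrite K2 in J2.
    split.
    - rewrite sqrt_sq_mult; [|exact (surf_metric_E _ z l SB _ _ HB')].
      rewrite !Rabs_mult.
      transitivity (Rabs k * Rabs (1 - a * nu1 z l (phi u) (psi v)) * Rabs (Xz (nu' u v))).
      { rewrite <- N1. ring. }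
      rewrite <- !Rabs_mult. f_equal. unfold Xz. rewrite J1. field. auto.
    - rewrite sqrt_sq_mult; [|exact (surf_G_pos _ z l _ _ SB HB')].
      rewrite !Rabs_mult.
      transitivity (Rabs k * Rabs (1 - a * nu2 z l (phi u) (psi v)) * Rabs (Yz (nu' u v))).
      { rewrite <- N2. ring. }
      rewrite <- !Rabs_mult. f_equal. unfold Yz. rewrite J2. field. auto. }
  set (nu := fun u v => class_subst c (lam u v)).
  assert (Enu : forall u v, D' u v -> nu u v = nu' u v) by (intros; now apply Hlam).
  assert (Snuf : smooth2 D' nu).
  { apply smooth2_ext with nu'; auto. intros; symmetry; auto. }
  assert (Np_ext : forall z0 l0 f0 g0 ca cb,
    natural_principal D' z0 l0 X f0 g0 nu' t0 ca cb ->
    natural_principal D' z0 l0 X f0 g0 nu t0 ca cb).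
  { intros z0 l0 f0 g0 ca cb (h1 & h2 & h3 & h4). repeat (split; auto).
    all: rewrite Enu; auto; now apply h4. }
  assert (Cs := class_subst_is_smooth c).
  exists a1, b1, a2, b2, phi, psi, sigma, lam.
  split; [|split].
  - split; [exact Rphi|]. split; [exact Rpsi|]. split.
    + intros u v H. unfold reparam. apply HBox. now apply Hnat.
    + exists 0, 0. split; [split; auto|]. unfold reparam. auto.
  - unfold sigma. assert (tau = 1 \/ tau = -1) as [->| ->].
    { destruct (Req_dec tau 1); auto. right.
      assert ((tau - 1) * (tau + 1) = 0) by lra.
      destruct (Rmult_integral _ _ H1); lra. }
    + destruct Hs0 as [->| ->]; [left|right]; ring.
    + destruct Hs0 as [->| ->]; [right|left]; ring.
  - cbv zeta. fold D' w n nu. split; [|split; [|split]].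
    + split; [exact Sw|]. split; [exact Pw|]. split; [exact Slam|].
      intros u v H. destruct (Cw u v H) as (_ & _ & E3 & E4).
      destruct (Hnat u v H) as (HB' & _). destruct (HBox _ _ HB') as (C0 & C1 & _).
      unfold Kext, Hmean, Hdiff. rewrite E3, E4.
      split; [exact (Hrel _ _ C0)|].
      destruct (Hlam u v H) as [A1 A2]. split; [exact A1|]. rewrite A2. reflexivity.
    + exists X, f, g, t0, (/ Rabs (class_rootE c t0)), (/ Rabs (class_rootG c t0)).
      split; [exact W|]. split; [exact Xt0|]. split; [now apply Np_ext|].
      apply (natural_pde_class_pde c X); auto.
    + exists X, fz, gz, t0, (/ Rabs (Xz t0)), (/ Rabs (Yz t0)).
      split; [exact Wz|]. split; [exact Xt0|]. split; [now apply Np_ext|].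
      apply (natural_pde_class_pde c X); auto.
    + intros u v H.
      apply (natural_pde_class_pde c X f g t0 (class_rootE c) (class_rootG c) Cs W Xt0 LEl PR D' lam);
        auto.
      * intros x y Hxy. split; [now apply Hlam|]. fold (nu x y). rewrite Enu; auto.
      * apply (surface_natural_pde D' w n X); auto.
Qed.

(** * Interchange of the two families of principal lines *)

Definition swap2 {T : Type} (h : R -> R -> T) : R -> R -> T := fun u v => h v u.

Lemma continuity_2d_pt_swap f u v :
  continuity_2d_pt f u v -> continuity_2d_pt (swap2 f) v u.
Proof.
  intros H eps. destruct (H eps) as [d Hd]. exists d. intros x y Hx Hy.
  now apply Hd.
Qed.

Lemma ex_diff_n_swap n f u v : ex_diff_n f n u v -> ex_diff_n (swap2 f) n v u.
Proof.
  revert f. induction n as [|n IH]; intros f H.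
  - split; [|exact I]. apply continuity_2d_pt_swap, H.
  - destruct H as (H1 & H2 & H3 & H4 & H5). split; [now apply continuity_2d_pt_swap|].
    split; [exact H3|]. split; [exact H2|]. split.
    + exact (IH _ H5).
    + exact (IH _ H4).
Qed.

Lemma smooth2_swap D f : smooth2 D f -> smooth2 (swap2 D) (swap2 f).
Proof. intros H n u v Huv. apply ex_diff_n_swap. now apply H. Qed.

Lemma vsmooth_swap D a : vsmooth D a -> vsmooth (swap2 D) (swap2 a).
Proof.
  intros (H1 & H2 & H3). split; [|split].
  - exact (smooth2_swap D _ H1).
  - exact (smooth2_swap D _ H2).
  - exact (smooth2_swap D _ H3).
Qed.

Lemma FF_swap z u v : FF (swap2 z) u v = FF z v u.
Proof. exact (mdot_comm (vDv z v u) (vDu z v u)). Qed.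

Lemma spacelike_surface_swap D z l :
  spacelike_surface D z l -> spacelike_surface (swap2 D) (swap2 z) (swap2 l).
Proof.
  intros S. constructor.
  - intros u v H. destruct (surf_open D z l S v u H) as [d Hd].
    exists d. intros x y Hx Hy. now apply Hd.
  - apply vsmooth_swap, (surf_smooth D z l S).
  - apply vsmooth_swap, (surf_normal_smooth D z l S).
  - intros u v H. exact (surf_G_pos D z l v u S H).
  - intros u v H. rewrite FF_swap.
    change (0 < GG z v u * EE z v u - FF z v u ^ 2).
    generalize (surf_metric_det D z l S v u H). lra.
  - intros u v H. exact (surf_normal_unit D z l S v u H).
  - intros u v H. exact (surf_normal_v D z l S v u H).
  - intros u v H. exact (surf_normal_u D z l S v u H).
Qed.

Lemma principal_parameters_swap D z l :
  spacelike_surface D z l -> principal_parameters D z l ->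
  principal_parameters (swap2 D) (swap2 z) (swap2 l).
Proof.
  intros S P u v H. destruct (P v u H) as [HF HM]. split; [now rewrite FF_swap|].
  change (mdot (l v u) (vDu (vDv z) v u) = 0).
  rewrite (vDu_vDv_comm D); auto; [apply (surf_open D z l S)|apply (surf_smooth D z l S)].
Qed.

Lemma parallel_factor_swap z l a :
  parallel_factor (swap2 z) (swap2 l) a = swap2 (parallel_factor z l a).
Proof.
  apply functional_extensionality; intros u. apply functional_extensionality; intros v.
  exact (Rmult_comm (1 - a * nu2 z l v u) (1 - a * nu1 z l v u)).
Qed.

Lemma parallel_domain_swap D z l a u v :
  parallel_domain (swap2 D) (swap2 z) (swap2 l) a u v <-> parallel_domain D z l a v u.
Proof. unfold parallel_domain. rewrite parallel_factor_swap. unfold swap2. tauto. Qed.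

Lemma chart_of_class_swap D z l a u0 v0 k c :
  chart_of_class (swap2 D) (swap2 z) (swap2 l) a v0 u0 k c false ->
  chart_of_class D z l a u0 v0 k c true.
Proof.
  intros (a1 & b1 & a2 & b2 & phi & psi & sigma & lam & (R1 & R2 & R3 & R4) & Hs & HC).
  exists a1, b1, a2, b2, psi, phi, sigma, lam. split; [|split].
  - split; [exact R2|]. split; [exact R1|]. split.
    + intros u v H. apply (proj1 (parallel_domain_swap D z l a (phi u) (psi v))).
      exact (R3 u v H).
    + destruct R4 as (u & v & H & E1 & E2). exists u, v. split; auto.
      split; auto.
  - exact Hs.
  - unfold parallel_normal in HC. rewrite parallel_factor_swap in HC. exact HC.
Qed.

(** * Reduction of the linear relation to normal form *)

Definition linear_relation (delta alpha beta gamma q1 q2 : R) : Prop :=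
  delta * (q1 * q2) = alpha * ((q1 + q2) / 2) + beta * ((q1 - q2) / 2) + gamma.

(** The relation is linear in the products and sums of the curvature radii
    1 / s, and these are translated by a; the discriminant
    alpha^2 - beta^2 + 4 gamma delta does not change. *)
Lemma linear_relation_parallel delta alpha beta gamma a s1 s2 :
  1 - a * s1 <> 0 -> 1 - a * s2 <> 0 ->
  linear_relation delta alpha beta gamma s1 s2 ->
  linear_relation (delta - a * alpha - gamma * a ^ 2) (alpha + 2 * gamma * a) beta gamma
    (s1 / (1 - a * s1)) (s2 / (1 - a * s2)).
Proof.
  unfold linear_relation. intros H1 H2 H.
  apply (Rmult_eq_reg_r ((1 - a * s1) * (1 - a * s2))); [|now apply prod_neq_0].
  transitivity ((delta - a * alpha - gamma * a ^ 2) * (s1 * s2)); [field; auto|].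
  rewrite !Rmult_minus_distr_r, H. field; auto.
Qed.

(** A real root a of gamma a^2 + alpha a - delta removes K' from the relation. If
    there is none, the vertex of this parabola removes H, and then the discriminant
    alpha^2 + 4 gamma delta < 0 determines the sign
    of gamma divided by the new delta. *)
Lemma parallel_reduction alpha beta gamma delta :
  alpha ^ 2 - beta ^ 2 + 4 * gamma * delta <> 0 ->
  exists a,
    let delta' := delta - a * alpha - gamma * a ^ 2 in
    let alpha' := alpha + 2 * gamma * a in
    alpha' ^ 2 - beta ^ 2 + 4 * gamma * delta' <> 0 /\
    (delta' = 0 \/ alpha' = 0 /\ delta' <> 0 /\ (gamma = 0 \/ gamma / delta' < 0)).
Proof.
  intros Hd.
  assert (Inv : forall a, (alpha + 2 * gamma * a) ^ 2 - beta ^ 2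
     + 4 * gamma * (delta - a * alpha - gamma * a ^ 2)
     = alpha ^ 2 - beta ^ 2 + 4 * gamma * delta) by (intros; ring).
  destruct (Req_dec delta 0) as [D0|D0].
  { exists 0. cbv zeta. rewrite Inv. split; auto. left. rewrite D0. ring. }
  destruct (Req_dec gamma 0) as [G0|G0].
  { destruct (Req_dec alpha 0) as [A0|A0].
    - exists 0. cbv zeta. rewrite Inv. split; auto. right. rewrite A0, G0.
      repeat split; auto; lra.
    - exists (delta / alpha). cbv zeta. rewrite Inv. split; auto. left. rewrite G0.
      field. auto. }
  set (disc := alpha ^ 2 + 4 * gamma * delta).
  destruct (Rle_lt_dec 0 disc) as [Hp|Hn].
  - exists ((- alpha + sqrt disc) / (2 * gamma)). cbv zeta. rewrite Inv. split; auto. left.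
    assert (E := sqrt_sqrt disc Hp). set (s := sqrt disc) in *.
    transitivity ((disc - s * s) / (4 * gamma)); [unfold disc; field; auto|].
    rewrite E. field. auto.
  - exists (- alpha / (2 * gamma)). cbv zeta. rewrite Inv. split; auto. right.
    assert (E : delta - - alpha / (2 * gamma) * alpha - gamma * (- alpha / (2 * gamma)) ^ 2
      = disc / (4 * gamma)) by (unfold disc; field; auto).
    rewrite E. split; [field; auto|].
    assert (disc <> 0) by lra. split; [apply div_neq_0; auto; lra|]. right.
    replace (gamma / (disc / (4 * gamma))) with (- (4 * gamma ^ 2 / - disc)) by (field; auto).
    apply Ropp_lt_gt_0_contravar, Rlt_gt, Rdiv_lt_0_compat; [|lra].
    generalize (pow2_gt_0 gamma G0). lra.
Qed.

Definition class_relation_curv (c : basic_class) (x1 x2 : R) : Prop :=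
  class_relation c (x1 * x2) ((x1 + x2) / 2) ((x1 - x2) / 2).

(** Without K', the relation says that H' or H is constant or that H is an affine
    function of H'; without H, it expresses K' by H'. The factor e brings the
    constants to the values of the list and, by its sign, together with the order
    of the two curvatures, gives the sign conditions of the class. *)
Lemma classification delta alpha beta gamma p1 p2 :
  alpha ^ 2 - beta ^ 2 + 4 * gamma * delta <> 0 ->
  delta = 0 \/ alpha = 0 /\ delta <> 0 /\ (gamma = 0 \/ gamma / delta < 0) ->
  p1 <> p2 -> linear_relation delta alpha beta gamma p1 p2 ->
  exists c e (sw : bool), valid_class c /\ e <> 0 /\
    class_side c (e * if sw then p2 else p1) (e * if sw then p1 else p2) /\
    forall q1 q2, linear_relation delta alpha beta gamma q1 q2 ->
      class_relation_curv c (e * if sw then q2 else q1) (e * if sw then q1 else q2).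
Proof.
  intros Hd Hcase Hp Hrel.
  assert (Hinv : forall x, x <> 0 -> / x <> 0) by (intros; now apply Rinv_neq_0_compat).
  destruct Hcase as [->|(-> & D0 & HG)].
  - destruct (Req_dec alpha 0) as [->|A0].
    { assert (B0 : beta <> 0) by (intros ->; apply Hd; ring).
      assert (Hh : forall q1 q2, linear_relation 0 0 beta gamma q1 q2 ->
         (q1 - q2) / 2 = - gamma / beta).
      { intros q1 q2 H. unfold linear_relation in H. apply (Rmult_eq_reg_l beta); auto.
        transitivity (- gamma); [lra|field; auto]. }
      set (h := - gamma / beta) in *.
      assert (h0 : h <> 0) by (intros E; apply Hh in Hrel; lra).
      exists Hdiff_one, (/ h), false. split; [exact I|]. split; [auto|]. split; [exact I|].
      intros q1 q2 H. apply Hh in H. unfold class_relation_curv; simpl.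
      transitivity (/ h * ((q1 - q2) / 2)); [field; auto|]. rewrite H. field. auto. }
    destruct (Req_dec beta 0) as [->|B0].
    { assert (Hh : forall q1 q2, linear_relation 0 alpha 0 gamma q1 q2 ->
         (q1 + q2) / 2 = - gamma / alpha).
      { intros q1 q2 H. unfold linear_relation in H. apply (Rmult_eq_reg_l alpha); auto.
        transitivity (- gamma); [lra|field; auto]. }
      set (h := - gamma / alpha) in *.
      destruct (Req_dec h 0) as [E0|h0].
      - exists H_zero, 1.
        apply Hh in Hrel. rewrite E0 in Hrel.
        destruct (Rlt_le_dec p2 0) as [N|N]; [exists false|exists true];
          (split; [exact I|]; split; [lra|]; split; [simpl; lra|];
           intros q1 q2 H; apply Hh in H; unfold class_relation_curv; simpl; lra).
      - exists H_half, (/ (2 * h)).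
        assert (Hx : forall q1 q2, linear_relation 0 alpha 0 gamma q1 q2 ->
           / (2 * h) * q1 + / (2 * h) * q2 = 1).
        { intros q1 q2 H. apply Hh in H. transitivity (/ h * ((q1 + q2) / 2)); [field; auto|].
          rewrite H. field; auto. }
        assert (Hne : / (2 * h) * p1 <> / (2 * h) * p2).
        { intros E. apply Hp. apply Rmult_eq_reg_l in E; [exact E|apply Hinv; lra]. }
        apply Hx in Hrel.
        destruct (Rlt_le_dec (/ (2 * h) * p2) (1 / 2)) as [N|N]; [exists false|exists true];
          (split; [exact I|]; split; [apply Hinv; lra|]; split; [simpl; lra|];
           intros q1 q2 H; apply Hx in H; unfold class_relation_curv; simpl; lra). }
    assert (Hh : forall q1 q2, linear_relation 0 alpha beta gamma q1 q2 ->
       (q1 + q2) / 2 = - beta / alpha * ((q1 - q2) / 2) + - gamma / alpha).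
    { intros q1 q2 H. unfold linear_relation in H. apply (Rmult_eq_reg_l alpha); auto.
      transitivity (- beta * ((q1 - q2) / 2) - gamma); [lra|field; auto]. }
    assert (P0 : - beta / alpha <> 0) by (apply div_neq_0; lra).
    assert (P1 : (- beta / alpha) ^ 2 <> 1).
    { intros E. apply Hd. replace (beta ^ 2) with ((- beta / alpha) ^ 2 * alpha ^ 2) by (field; auto).
      rewrite E. ring. }
    set (P := - beta / alpha) in *. set (C := - gamma / alpha) in *.
    destruct (Req_dec C 0) as [C0|C0].
    + assert (p20 : p2 <> 0).
      { intros E. apply Hh in Hrel. rewrite C0, E in Hrel.
        assert (HH : p1 * (P - 1) = 0) by lra.
        destruct (Rmult_integral _ _ HH) as [E1|E1].
        - apply Hp. lra.
        - apply P1. replace P with 1 by lra. ring. }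
      assert (He : exists e, e <> 0 /\ 0 < e * p2).
      { destruct (Rlt_le_dec 0 p2); [exists 1|exists (-1)]; lra. }
      destruct He as (e & He & Hep).
      assert (Hr : forall q1 q2, linear_relation 0 alpha beta gamma q1 q2 ->
        (e * q1 + e * q2) / 2 = P * ((e * q1 - e * q2) / 2)).
      { intros q1 q2 H. apply Hh in H. rewrite C0 in H.
        transitivity (e * ((q1 + q2) / 2)); [field|]. rewrite H. field. }
      destruct (Rlt_le_dec 1 (P ^ 2)).
      * exists (H_prop_gt P), e, false. repeat split; auto.
      * exists (H_prop_lt P), e, false. simpl in *. repeat split; auto. lra.
    + assert (Hr : forall q1 q2, linear_relation 0 alpha beta gamma q1 q2 ->
        (/ C * q1 + / C * q2) / 2 = P * ((/ C * q1 - / C * q2) / 2) + 1).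
      { intros q1 q2 H. apply Hh in H.
        transitivity (/ C * ((q1 + q2) / 2)); [field; auto|]. rewrite H. field; auto. }
      assert (Hne : / C * p1 <> / C * p2).
      { intros E. apply Hp. apply Rmult_eq_reg_l in E; auto. }
      destruct (Rlt_le_dec (/ C * p2) (/ C * p1)) as [N|N].
      * destruct (Rlt_le_dec 1 (P ^ 2)).
        -- exists (H_affine_gt P), (/ C), false. simpl. repeat split; auto. lra.
        -- exists (H_affine_lt P), (/ C), false. simpl in *. repeat split; auto; lra.
      * assert (Hr' : forall q1 q2, linear_relation 0 alpha beta gamma q1 q2 ->
          (/ C * q2 + / C * q1) / 2 = - P * ((/ C * q2 - / C * q1) / 2) + 1).
        { intros q1 q2 H. apply Hr in H. rewrite Rplus_comm, H. field; auto. }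
        assert (E2 : (- P) ^ 2 = P ^ 2) by ring.
        destruct (Rlt_le_dec 1 (P ^ 2)).
        -- exists (H_affine_gt (- P)), (/ C), true. simpl in *. repeat split; auto; lra.
        -- exists (H_affine_lt (- P)), (/ C), true. simpl in *. repeat split; auto; lra.
  - assert (Hh : forall q1 q2, linear_relation delta 0 beta gamma q1 q2 ->
       q1 * q2 = beta / delta * ((q1 - q2) / 2) - - (gamma / delta)).
    { intros q1 q2 H. unfold linear_relation in H. apply (Rmult_eq_reg_l delta); auto. rewrite H. field; auto. }
    destruct HG as [->|HG].
    + assert (B0 : beta <> 0) by (intros ->; apply Hd; ring).
      exists K_twice_Hdiff, (2 * (delta / beta)), false.
      split; [exact I|]. split.
      { apply prod_neq_0; [lra|]. now apply div_neq_0. }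
      split; [exact I|].
      intros q1 q2 H. apply Hh in H. unfold class_relation_curv; simpl.
      transitivity ((2 * (delta / beta)) ^ 2 * (q1 * q2)); [ring|]. rewrite H. field; auto.
    + set (Q := - (gamma / delta)) in *. assert (Q0 : 0 < Q) by (unfold Q; lra).
      destruct (Req_dec beta 0) as [->|B0].
      * exists K_minus_one, (/ sqrt Q), false.
        assert (sqrt Q <> 0) by now apply sqrt_neq_0.
        split; [exact I|]. split; [auto|]. split; [exact I|].
        intros q1 q2 H0. apply Hh in H0. unfold class_relation_curv; simpl.
        transitivity (/ (sqrt Q * sqrt Q) * (q1 * q2)); [field; auto|].
        rewrite sqrt_sqrt, H0 by lra. field. lra.
      * exists (K_affine (beta / delta) Q), 1, false.
        split; [split; auto; now apply div_neq_0|]. split; [lra|]. split; [exact I|].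
        intros q1 q2 H0. apply Hh in H0. unfold class_relation_curv; simpl.
        rewrite !Rmult_1_l. exact H0.
Qed.

(** * Density of the points where the parallel surface is regular *)

(** By the Codazzi equation for nu2, a constant nu2 means gamma2 = 0. *)
Lemma nu2_not_constant D z l (B : region) s :
  spacelike_surface D z l -> principal_parameters D z l ->
  strongly_regular D z l \/ gamma1_zero_kind D z l ->
  open2 B -> (forall u v, B u v -> D u v) ->
  (forall u v, B u v -> nu2 z l u v = s) -> forall u v, ~ B u v.
Proof.
  intros S Pr Reg HB Sub Hc u v H.
  destruct (codazzi_equations D z l u v S Pr (Sub u v H)) as [_ C].
  rewrite (Du_ext B (nu2 z l) (fun _ _ => s) u v HB Hc H), Du_const in C.
  assert (N : (nu1 z l u v - nu2 z l u v) * gamma2 z u v <> 0).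
  { destruct Reg as [Rg|Rg]; specialize (Rg u v (Sub u v H)).
    - intros E. apply Rg.
      transitivity ((nu1 z l u v - nu2 z l u v) * gamma2 z u v * gamma1 z u v); [ring|].
      rewrite E. ring.
    - apply Rg. }
  apply N. unfold gamma2, Rdiv.
  rewrite <- Rmult_assoc, <- C. ring.
Qed.

(** If (1 - a nu1) (1 - a nu2) vanished on an open set, then nu1 or nu2 would be
    equal to 1 / a on a smaller one. In the first case the linear relation
    makes nu2 constant too, as its discriminant does not vanish. *)
Lemma parallel_domain_dense D z l alpha beta gamma delta a :
  spacelike_surface D z l -> principal_parameters D z l ->
  strongly_regular D z l \/ gamma1_zero_kind D z l ->
  alpha ^ 2 - beta ^ 2 + 4 * gamma * delta <> 0 ->
  (forall u v, D u v -> linear_relation delta alpha beta gamma (nu1 z l u v) (nu2 z l u v)) ->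
  dense_in D (parallel_domain D z l a).
Proof.
  intros S Pr Reg Hd Hrel u v H eps Heps.
  destruct (classic (exists u' v', Rabs (u' - u) < eps /\ Rabs (v' - v) < eps /\
    parallel_domain D z l a u' v')) as [Hyes|Hno]; auto.
  exfalso.
  set (B := fun x y => D x y /\ (Rabs (x - u) < eps /\ Rabs (y - v) < eps)).
  assert (HD := surf_open D z l S).
  assert (HB : open2 B).
  { intros x y [Hx [Hu Hv]]. apply locally_2d_and; [now apply HD|].
    apply locally_2d_and.
    - apply (continuity_2d_pt_open (fun s t => Rabs (s - u)) x y (fun r => r < eps)).
      + apply continuity_1d_2d_pt_comp with (f := Rabs); [apply Rcontinuity_abs|].
        apply continuity_2d_pt_minus; [apply continuity_2d_pt_id1|apply continuity_2d_pt_const].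
      + exact (open_lt eps).
      + exact Hu.
    - apply (continuity_2d_pt_open (fun s t => Rabs (t - v)) x y (fun r => r < eps)).
      + apply continuity_1d_2d_pt_comp with (f := Rabs); [apply Rcontinuity_abs|].
        apply continuity_2d_pt_minus; [apply continuity_2d_pt_id2|apply continuity_2d_pt_const].
      + exact (open_lt eps).
      + exact Hv. }
  assert (BD : forall x y, B x y -> D x y) by (intros x y Hxy; apply Hxy).
  assert (B0 : B u v).
  { split; auto. rewrite !Rminus_diag, Rabs_R0. auto. }
  assert (Hz : forall x y, B x y ->
    (1 - a * nu1 z l x y) * (1 - a * nu2 z l x y) = 0).
  { intros x y (Hx & Hu & Hv). apply NNPP. intros Hn. apply Hno.
    exists x, y. repeat split; auto. }
  assert (Det : forall x y, B x y -> 1 - a * nu1 z l x y = 0 ->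
     nu2 z l x y = ((alpha + beta) / 2 + gamma * a) / (delta - (alpha - beta) / 2 * a)).
  { intros x y Hxy E. assert (R0 := Hrel x y (BD x y Hxy)). unfold linear_relation in R0.
    assert (R1 : nu2 z l x y * (delta - (alpha - beta) / 2 * a)
       = (alpha + beta) / 2 + gamma * a).
    { replace delta with (delta * (a * nu1 z l x y)) by (replace (a * nu1 z l x y) with 1 by lra; ring).
      replace ((alpha + beta) / 2) with ((alpha + beta) / 2 * (a * nu1 z l x y))
        by (replace (a * nu1 z l x y) with 1 by lra; ring).
      transitivity (a * (delta * (nu1 z l x y * nu2 z l x y))
        - (alpha - beta) / 2 * a * nu2 z l x y); [ring|]. rewrite R0. field. }
    assert (N : delta - (alpha - beta) / 2 * a <> 0).
    { intros N. rewrite N, Rmult_0_r in R1. apply Hd.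
      assert (a <> 0) by (intros ->; lra).
      apply (Rmult_eq_reg_l (a ^ 2)); [|now apply pow_nonzero].
      transitivity ((4 * ((alpha + beta) / 2 * a) * ((alpha - beta) / 2 * a))
        + 4 * (gamma * a) * (delta * a)); [field|].
      replace (gamma * a) with (- ((alpha + beta) / 2)) by lra.
      replace ((alpha - beta) / 2 * a) with delta by lra. ring. }
    apply (Rmult_eq_reg_r (delta - (alpha - beta) / 2 * a)); auto.
    rewrite R1. field. intros N'. apply N. lra. }
  destruct (classic (exists x y, B x y /\ 1 - a * nu1 z l x y <> 0)) as [(x & y & Hxy & N)|Hall].
  - (* Near this point the first factor does not vanish, hence the second one does. *)
    set (B' := fun s t => B s t /\ 1 - a * nu1 z l s t <> 0).
    assert (HB' : open2 B').
    { intros s t [Hst Hn]. apply locally_2d_and; [now apply HB|].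
      apply (continuity_2d_pt_open (fun s t => 1 - a * nu1 z l s t) s t (fun r => r <> 0));
        auto using open_neq0.
      apply continuity_2d_pt_minus; [apply continuity_2d_pt_const|].
      apply continuity_2d_pt_mult; [apply continuity_2d_pt_const|].
      apply (smooth2_continuity D); auto. now apply smooth2_nu1. }
    apply (nu2_not_constant D z l B' (/ a) S Pr Reg HB') with x y; [| |now split].
    + intros s t Hst. apply BD, Hst.
    + intros s t [Hst Hn]. destruct (Rmult_integral _ _ (Hz s t Hst)) as [E|E]; [tauto|].
      assert (a <> 0) by (intros ->; lra).
      apply (Rmult_eq_reg_l a); auto. rewrite Rinv_r; auto. lra.
  - refine (nu2_not_constant D z l B _ S Pr Reg HB BD _ u v B0).
    intros x y Hxy. apply Det; auto. apply NNPP. intros Hn. apply Hall. now exists x, y.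
Qed.

Lemma linear_isometry_id : linear_isometry (fun x => x).
Proof. repeat split; auto. Qed.

Theorem theorem5p2 :
  forall (D : region) (z l : R -> R -> vec3) (alpha beta gamma delta : R),
    spacelike_surface D z l ->
    principal_parameters D z l ->
    strongly_regular D z l \/ gamma1_zero_kind D z l ->
    alpha ^ 2 - beta ^ 2 + 4 * gamma * delta <> 0 ->
    (forall u v, D u v ->
       delta * Kext z l u v
       = alpha * Hmean z l u v + beta * Hdiff z l u v + gamma) ->
    exists a : R,
      dense_in D (parallel_domain D z l a) /\
      forall u0 v0, parallel_domain D z l a u0 v0 ->
      exists (c : basic_class)
             (a1 b1 a2 b2 : R) (swap : bool) (phi psi : R -> R)
             (k sigma : R) (A : vec3 -> vec3) (b : vec3)
             (lam : R -> R -> R),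
        valid_class c /\
        parameter_change (parallel_domain D z l a) u0 v0
          a1 b1 a2 b2 swap phi psi /\
        0 < k /\ (sigma = 1 \/ sigma = -1) /\ linear_isometry A /\
        let D' := open_rect a1 b1 a2 b2 in
        let w := reparam swap phi psi
                   (similar_point k A b (parallel_point z l a)) in
        let n := reparam swap phi psi
                   (similar_normal sigma A (parallel_normal z l a)) in
        let nu := fun u v => class_subst c (lam u v) in
        basic_surface c D' w n lam /\
        natural_pde_is c D' w n nu /\
        natural_pde_is c D'
          (reparam swap phi psi z) (reparam swap phi psi l) nu /\
        (forall u v, D' u v -> class_pde c lam u v).
Proof.
  intros D z l alpha beta gamma delta S Pr Reg Hd Hrel.
  destruct (parallel_reduction alpha beta gamma delta Hd) as [a [Hd' Hcase]].
  exists a. split.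
  { now apply (parallel_domain_dense D z l alpha beta gamma delta). }
  intros u0 v0 H0.
  set (q := fun s => s / (1 - a * s)).
  assert (Hq : forall x y, parallel_domain D z l a x y ->
    linear_relation (delta - a * alpha - gamma * a ^ 2) (alpha + 2 * gamma * a) beta gamma
      (q (nu1 z l x y)) (q (nu2 z l x y))).
  { intros x y [Hxy Hf]. destruct (parallel_factor_neq z l a x y Hf) as [F1 F2].
    apply linear_relation_parallel; auto. exact (Hrel x y Hxy). }
  assert (Hneq : q (nu1 z l u0 v0) <> q (nu2 z l u0 v0)).
  { destruct H0 as [Hxy Hf]. destruct (parallel_factor_neq z l a u0 v0 Hf) as [F1 F2].
    assert (N : nu1 z l u0 v0 - nu2 z l u0 v0 <> 0).
    { destruct Reg as [Rg|Rg]; specialize (Rg u0 v0 Hxy).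
      - intros E. apply Rg. rewrite E. ring.
      - intros E. apply (proj2 Rg). rewrite E. ring. }
    intros E. apply N. unfold q in E.
    replace (nu1 z l u0 v0 - nu2 z l u0 v0) with
      ((nu1 z l u0 v0 / (1 - a * nu1 z l u0 v0) - nu2 z l u0 v0 / (1 - a * nu2 z l u0 v0))
       * ((1 - a * nu1 z l u0 v0) * (1 - a * nu2 z l u0 v0))) by (field; auto).
    rewrite E. ring. }
  destruct (classification _ _ beta gamma _ _ Hd' Hcase Hneq (Hq u0 v0 H0))
    as (c & e & sw & Hv & He & Hside & Hclass).
  set (k := / Rabs e). set (tau := sign e).
  assert (Hk : 0 < k) by (apply Rinv_0_lt_compat, Rabs_pos_lt, He).
  assert (Htau : tau * tau = 1).
  { unfold tau. destruct (Rtotal_order e 0) as [N|[N|N]]; [|tauto|].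
    - rewrite sign_eq_m1; auto; ring.
    - rewrite sign_eq_1; auto; ring. }
  assert (Hpc : forall s, 1 - a * s <> 0 -> parallel_curvature a k tau s = e * q s).
  { intros s Hs. unfold parallel_curvature, q, k, tau.
    destruct (Rtotal_order e 0) as [N|[N|N]]; [|tauto|].
    - rewrite sign_eq_m1, Rabs_left; auto. field. auto.
    - rewrite sign_eq_1, Rabs_right; auto; [|lra]. field. auto. }
  assert (Hpc' : forall x y, parallel_domain D z l a x y ->
    parallel_curvature a k tau (nu1 z l x y) = e * q (nu1 z l x y) /\
    parallel_curvature a k tau (nu2 z l x y) = e * q (nu2 z l x y)).
  { intros x y [_ Hf]. destruct (parallel_factor_neq z l a x y Hf). auto. }
  assert (Hchart : chart_of_class D z l a u0 v0 k c sw).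
  { destruct (Hpc' u0 v0 H0) as [E1 E2]. destruct sw.
    - apply chart_of_class_swap. apply chart_exists with tau; auto.
      + now apply spacelike_surface_swap.
      + now apply principal_parameters_swap.
      + now apply parallel_domain_swap.
      + change (parallel_curvature a k tau (nu2 z l u0 v0)
          <> parallel_curvature a k tau (nu1 z l u0 v0)).
        rewrite E1, E2. intros E. apply Hneq. symmetry. now apply Rmult_eq_reg_l in E.
      + change (class_side c (parallel_curvature a k tau (nu2 z l u0 v0))
          (parallel_curvature a k tau (nu1 z l u0 v0))).
        rewrite E1, E2. exact Hside.
      + intros x y Hxy. apply parallel_domain_swap in Hxy.
        destruct (Hpc' y x Hxy) as [F1 F2].
        change (class_relation_curv c (parallel_curvature a k tau (nu2 z l y x))
          (parallel_curvature a k tau (nu1 z l y x))).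
        rewrite F1, F2. apply (Hclass _ _ (Hq y x Hxy)).
    - apply chart_exists with tau; auto.
      + rewrite E1, E2. intros E. apply Hneq. now apply Rmult_eq_reg_l in E.
      + rewrite E1, E2. exact Hside.
      + intros x y Hxy. destruct (Hpc' x y Hxy) as [F1 F2].
        rewrite F1, F2. apply (Hclass _ _ (Hq x y Hxy)). }
  destruct Hchart as (a1 & b1 & a2 & b2 & phi & psi & sigma & lam & Hpar & Hs & HC).
  exists c, a1, b1, a2, b2, sw, phi, psi, k, sigma, (fun x => x), (Vec 0 0 0), lam.
  split; [exact Hv|]. split; [exact Hpar|]. split; [exact Hk|]. split; [exact Hs|].
  split; [exact linear_isometry_id|]. exact HC.
Qed.
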